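(* For the 4-dimensional cylindrical Veselova top, the reconstruction to $T^*\mathrm{S}^3$ and to $D$ of the solutions of the reduced equations on $\mathcal{R}$ is as follows. (i) In $S_0,S_0'$ the solutions are equilibria. (ii) In $S_1,S_1'$ the relative equilibria are steady rotations in pure inertial planes (for $S_1$ they rotate in a principal plane $\Pi$ with $\mathrm{in}(\Pi)=2J_2$, while in $S_1'$ it has $\mathrm{in}(\Pi)=2J_1$). (iii) In $S_2$ there are two possibilities: if $P=0$ the top is in equilibrium, whereas if $P>0$ the solutions are steady rotations in mixed inertial planes, and they are not relative equilibria. (iv) In $S_3,S_3'$ the motion lies on tori of dimension at most 2 in both $T^*\mathrm{S}^3$ and $D$, and behaves in the same way as the 3D axisymmetric Veselova top. (v) In $S_4$ there are two possibilities. In the (relative) equilibria in $S_4$ the motion lies on tori of dimension at most 2 in $T^*\mathrm{S}^3$ and at most 3 in $D$; these relative equilibria are $G_R$-Lyapunov stable. Over the periodic orbits in $S_4$ the motion lies on tori of dimension at most 3 in $T^*\mathrm{S}^3$ and at most 4 in $D$.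
   Context: $\mathbb{J}=\mathrm{diag}[J_1,J_1,J_2,J_2]$, $J_1,J_2>0$, $J_1\neq J_2$. The $m$-dimensional Veselova top with positive diagonal mass tensor $\mathbb{J}$ (here $m=4$): $a\wedge b=ab^T-ba^T$, $\langle\Lambda,\Omega\rangle=\tfrac12\mathrm{tr}(\Lambda^T\Omega)$, $\mathbb{I}(\Omega)=\mathbb{J}\Omega+\Omega\mathbb{J}$ on $\mathfrak{so}(m)$; with $e_1,\dots,e_m$ the standard space basis, $q=g^{-1}e_1$, $E_r=g^{-1}e_r$, the phase space is $D=\{(g,\Omega)\in\mathrm{O}(m)\times\mathfrak{so}(m):\Omega=q\wedge v\text{ for some }v\}$ and the dynamics is $\dot g=g\Omega$, $\frac{d}{dt}\mathbb{I}(\Omega)=[\mathbb{I}(\Omega),\Omega]+\sum_{2\le r<s\le m}\lambda_{rs}E_r\wedge E_s$, with $\lambda_{rs}$ uniquely determined by preservation of $\langle E_r\wedge E_s,\Omega\rangle=0$. The projection $(g,\Omega)\mapsto(q,p)=(g^{-1}e_1,-\mathbb{I}(\Omega)g^{-1}e_1)$ takes it to $T^*\mathrm{S}^{m-1}=\{(q,p):\|q\|=1,q\cdot p=0\}$ with $$\dot q=C\left[p-\frac{p\cdot Cq}{q\cdot Cq}q\right],\quad \dot p=-2Hq,\quad C=(\mathbb{J}+(q\cdot\mathbb{J}q)\mathrm{Id}_m)^{-1},\quad H=\tfrac12\left(p\cdot Cp-\tfrac{(p\cdot Cq)^2}{q\cdot Cq}\right).$$ $G_R=\mathrm{O}(2)\times\mathrm{O}(2)$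 acts on $T^*\mathrm{S}^3$ by $h\cdot(q,p)=(hq,hp)$ and $G=G_L\times G_R$ acts on $D$ by $(A,B)\cdot(g,\Omega)=(AgB^{-1},B\Omega B^{-1})$, $G_L\cong\mathrm{O}(3)$ being the stabiliser of $e_1$. $\mathcal{R}=T^*\mathrm{S}^3/G_R=D/G$. Write $q=(q_1,q_2)$, $p=(p_1,p_2)\in\mathbb{R}^2\times\mathbb{R}^2$, $P=\|p\|^2$. Strata (in $T^*\mathrm{S}^3$, or their images in $\mathcal{R}$ or preimages in $D$): $S_0$: $q_1=p_1=p_2=0$. $S_0'$: $q_2=p_1=p_2=0$. $S_1$: $q_1=p_1=0$, $p_2\ne0$. $S_1'$: $q_2=p_2=0$, $p_1\neq0$. $S_2$: for $j=1$ and $j=2$, $q_j,p_j$ are linearly dependent and not both zero. $S_3$: $q_1,p_1$ linearly dependent, not both zero, and $q_2,p_2$ linearly independent. $S_3'$: the same with indices 1 and 2 exchanged. $S_4$: $q_1,p_1$ linearly independent and $q_2,p_2$ linearly independent. On $\mathcal{R}$ every solution is an equilibrium or periodic. A relative equilibrium is a solution projecting to an equilibrium on $\mathcal{R}$. A steady rotation is a solution with constant nonzero $\Omega$; then $\Omega$ is a multiple of $a\wedge b$ with $\Pi=\mathrm{span}\{a,b\}$ a principal ($\mathbb{J}$-invariant) plane, whose moment of inertia $\mathrm{in}(\Pi)$ is the sum of the eigenvalues of $\mathbb{J}|_\Pi$. $\Pi$ is pure if contained in an eigenspace of $\mathbb{J}$, and mixed if spanned by one eigenvector of each eigenvalue.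 ''The motion lies on tori'' means that the solutions are contained in invariant tori of the indicated dimension carrying quasi-periodic dynamics (flow conjugate to a linear flow) in the time $t$. ''Behaves in the same way as the 3D axisymmetric Veselova top'' means that, after suitable choice of orthonormal bases, the motion takes place in a 3-dimensional subspace and its equations of motion are those of the 3-dimensional Veselova top with axisymmetric mass tensor ($\mathrm{diag}[J_1,J_2,J_2]$ for $S_3$; with $J_1,J_2$ exchanged for $S_3'$). A relative equilibrium is $G_R$-Lyapunov stable if the $G_R$-orbit $S$ of its trajectory in $T^*\mathrm{S}^3$ satisfies: for every $G_R$-invariant neighbourhood $U$ of $S$ there is a $G_R$-invariant neighbourhood $V$ of $S$ such that any trajectory meeting $V$ is contained in $U$. *)

(* Defs.v *)
From HB Require Import structures.
From mathcomp Require Import all_boot all_order all_algebra.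
From mathcomp Require Import all_classical all_reals all_analysis.
Set Implicit Arguments.
Unset Strict Implicit.
Unset Printing Implicit Defensive.
Import Order.TTheory GRing.Theory Num.Theory.
Import numFieldNormedType.Exports.
Local Open Scope classical_set_scope.
Local Open Scope ring_scope.

(* Vectors are column vectors.  Since the norm [`|_|] on matrices is the sup
   norm, Euclidean norms are written through [dot]. *)

Section Veselova.
Variables (R : realType) (n : nat).
Local Notation vec := 'cV[R]_n.+1.
Local Notation mat := 'M[R]_n.+1.

Definition dot (a b : vec) : R := (a^T *m b) 0 0.

Definition wedge (a b : vec) : mat := a *m b^T - b *m a^T.

Definition orthogonal_mx m (g : 'M[R]_m) : Prop := g^T *m g = 1%:M.

(* Basis vectors are numbered from 0, so that [ebasis 0] is the e_1 of the
   literature. *)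
Definition ebasis (r : 'I_n.+1) : vec := delta_mx r 0.

Variable J : mat.

Definition inertia_op (Om : mat) : mat := J *m Om + Om *m J.

Definition poisson (r : 'I_n.+1) (g : mat) : vec := invmx g *m ebasis r.

Definition veselova_D : set (mat * mat) :=
  [set x | [/\ orthogonal_mx x.1, x.2^T = - x.2 &
               exists v, x.2 = wedge (poisson 0 x.1) v]].

(* The multipliers are pinned down by the requirement that the curve stays in
   [veselova_D], the E_r /\ E_s being linearly independent. *)
Definition veselova_D_sol (x : R -> mat * mat) : Prop :=
  forall t : R,
  [/\ veselova_D (x t),
      is_derive t (1 : R) (fun s => (x s).1) ((x t).1 *m (x t).2) &
      exists lam : 'I_n.+1 -> 'I_n.+1 -> R,
        is_derive t (1 : R) (fun s => inertia_op (x s).2)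
          (inertia_op (x t).2 *m (x t).2 - (x t).2 *m inertia_op (x t).2
           + \sum_(r < n.+1 | (0 < r)%N) \sum_(s < n.+1 | (r < s)%N)
               lam r s *: wedge (poisson r (x t).1) (poisson s (x t).1))].

Definition veselova_proj (x : mat * mat) : vec * vec :=
  (poisson 0 x.1, - (inertia_op x.2 *m poisson 0 x.1)).

Definition cotangent_sphere : set (vec * vec) :=
  [set y | dot y.1 y.1 = 1 /\ dot y.1 y.2 = 0].

Definition Cmx (q : vec) : mat := invmx (J + (dot q (J *m q))%:M).

Definition energy (q p : vec) : R :=
  (dot p (Cmx q *m p) - dot p (Cmx q *m q) ^+ 2 / dot q (Cmx q *m q)) / 2.

Definition veselova_T_sol (y : R -> vec * vec) : Prop :=
  forall t : R, let q := (y t).1 in let p := (y t).2 in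
  [/\ cotangent_sphere (y t),
      is_derive t (1 : R) (fun s => (y s).1)
        (Cmx q *m (p - (dot p (Cmx q *m q) / dot q (Cmx q *m q)) *: q)) &
      is_derive t (1 : R) (fun s => (y s).2) (- (2 * energy q p) *: q)].

(* Planes are row spaces: the span of the columns [a] and [b] is the row space
   of [(a^T + b^T)%MS], and eigenspaces are those of mathcomp's [eigenspace];
   row and column eigenvectors agree for the symmetric tensors used below. *)
Definition principal_plane (Pi : mat) : Prop :=
  \rank Pi = 2 /\ stablemx Pi J.

Definition moment_of_inertia (Pi : mat) (c : R) : Prop :=
  exists a b : R,
    char_poly (restrictmx Pi J) = ('X - a%:P) * ('X - b%:P) /\ c = a + b.

Definition pure_plane (Pi : mat) : Prop :=
  exists a : R, (Pi <= eigenspace J a)%MS.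

(* [a1] and [a2] stand for the two eigenvalues of [J]. *)
Definition mixed_plane (a1 a2 : R) (Pi : mat) : Prop :=
  exists u1 u2 : 'rV[R]_n.+1,
    [/\ u1 != 0, u2 != 0, (u1 <= eigenspace J a1)%MS,
        (u2 <= eigenspace J a2)%MS & (Pi :=: u1 + u2)%MS].

Definition steady_rotation_in (Pi : mat) (x : R -> mat * mat) : Prop :=
  [/\ veselova_D_sol x, principal_plane Pi &
      exists Om : mat,
        [/\ Om != 0, forall t, (x t).2 = Om &
            exists (c : R) (a b : vec),
              Om = c *: wedge a b /\ (Pi :=: a^T + b^T)%MS]].

End Veselova.

Section Dynamics.
Variables (R : realType) (X : topologicalType).

Definition is_equilibrium (x : R -> X) : Prop := forall t s, x t = x s.

(* [E] is the relation "lie on the same group orbit", so that curves modulo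
   [E] are curves in the quotient space. *)
Definition is_relative_equilibrium (E : X -> X -> Prop) (x : R -> X) : Prop :=
  forall t s, E (x t) (x s).

Definition is_relative_periodic (E : X -> X -> Prop) (x : R -> X) : Prop :=
  ~ is_relative_equilibrium E x /\
  exists T : R, 0 < T /\ forall t, E (x (t + T)) (x t).

(* The torus R^k / Z^k is handled through its universal cover: such a [phi] is
   the same thing as a continuous injection of the compact space R^k / Z^k,
   hence a homeomorphism onto its image, which is invariant and carries the
   linear flow of frequency vector [w]. *)
Definition quasi_periodic_torus (sol : (R -> X) -> Prop) (k : nat)
    (phi : 'rV[R]_k -> X) (w : 'rV[R]_k) : Prop :=
  [/\ continuous phi,
      forall a b, phi a = phi b <-> (forall i, a 0 i - b 0 i \is a Num.int) &
      forall a, sol (fun t => phi (a + t *: w))].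

Definition lies_on_torus (sol : (R -> X) -> Prop) (d : nat) (x : R -> X) : Prop :=
  exists (k : nat) (phi : 'rV[R]_k -> X) (w : 'rV[R]_k),
    [/\ (k <= d)%N, quasi_periodic_torus sol phi w &
        exists a, forall t, x t = phi (a + t *: w)].

Definition set_nbhd_in (M S U : set X) : Prop :=
  U `<=` M /\ forall y, S y -> within M (nbhs y) U.

Definition orbit_invariant (E : X -> X -> Prop) (U : set X) : Prop :=
  forall y z, E y z -> U y -> U z.

Definition orbit_Lyapunov_stable (M : set X) (sol : (R -> X) -> Prop)
    (E : X -> X -> Prop) (x : R -> X) : Prop :=
  let S := [set y | exists t, E (x t) y] in
  forall U : set X, set_nbhd_in M S U -> orbit_invariant E U ->
  exists V : set X,
    [/\ set_nbhd_in M S V, orbit_invariant E V &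
        forall z, sol z -> (exists t, V (z t)) -> forall t, U (z t)].

End Dynamics.

Section Cylindrical.
Variable R : realType.

Definition cyl_mass (J1 J2 : R) : 'M[R]_4 :=
  block_mx (J1%:M : 'M[R]_2) 0 0 (J2%:M : 'M[R]_2).

Definition axi_mass (a b : R) : 'M[R]_3 :=
  block_mx (a%:M : 'M[R]_1) 0 0 (b%:M : 'M[R]_2).

Definition GR : set 'M[R]_4 :=
  [set h | exists h1 h2 : 'M[R]_2,
     [/\ orthogonal_mx h1, orthogonal_mx h2 & h = block_mx h1 0 0 h2]].

Definition GL : set 'M[R]_4 :=
  [set A | orthogonal_mx A /\ A *m ebasis R 0 = ebasis R 0].

Definition orbit_T (y z : 'cV[R]_4 * 'cV[R]_4) : Prop :=
  exists2 h, GR h & z = (h *m y.1, h *m y.2).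

Definition orbit_D (x z : 'M[R]_4 * 'M[R]_4) : Prop :=
  exists A B, [/\ GL A, GR B & z = (A *m x.1 *m invmx B, B *m x.2 *m invmx B)].

Definition fst2 (a : 'cV[R]_4) : 'cV[R]_2 := usubmx (a : 'cV[R]_(2 + 2)).
Definition snd2 (a : 'cV[R]_4) : 'cV[R]_2 := dsubmx (a : 'cV[R]_(2 + 2)).

Definition dependent_nonzero (a b : 'cV[R]_2) : Prop :=
  ~~ free [:: a; b] /\ ~ (a = 0 /\ b = 0).

Definition independent (a b : 'cV[R]_2) : Prop := free [:: a; b].

Local Notation phase := ('cV[R]_4 * 'cV[R]_4)%type.

Definition S0 : set phase :=
  [set y | [/\ fst2 y.1 = 0, fst2 y.2 = 0 & snd2 y.2 = 0]].
Definition S0' : set phase :=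
  [set y | [/\ snd2 y.1 = 0, fst2 y.2 = 0 & snd2 y.2 = 0]].
Definition S1 : set phase :=
  [set y | [/\ fst2 y.1 = 0, fst2 y.2 = 0 & snd2 y.2 <> 0]].
Definition S1' : set phase :=
  [set y | [/\ snd2 y.1 = 0, snd2 y.2 = 0 & fst2 y.2 <> 0]].
Definition S2 : set phase :=
  [set y | dependent_nonzero (fst2 y.1) (fst2 y.2) /\
           dependent_nonzero (snd2 y.1) (snd2 y.2)].
Definition S3 : set phase :=
  [set y | dependent_nonzero (fst2 y.1) (fst2 y.2) /\
           independent (snd2 y.1) (snd2 y.2)].
Definition S3' : set phase :=
  [set y | dependent_nonzero (snd2 y.1) (snd2 y.2) /\
           independent (fst2 y.1) (fst2 y.2)].
Definition S4 : set phase :=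
  [set y | independent (fst2 y.1) (fst2 y.2) /\
           independent (snd2 y.1) (snd2 y.2)].

(* [B] is the change of orthonormal body basis and [A] that of space basis; the
   latter keeps e_1, which enters the constraint.  The first three vectors of
   the new body basis span the subspace in which the motion takes place. *)
Definition like_3D_T (J : 'M[R]_4) (a b : R) (y : R -> phase) : Prop :=
  exists (B : 'M[R]_4) (c : R) (z : R -> 'cV[R]_3 * 'cV[R]_3),
    [/\ orthogonal_mx B,
        B *m J *m B^T = block_mx (axi_mass a b) 0 0 (c%:M : 'M[R]_1),
        veselova_T_sol (axi_mass a b) z &
        forall t, B *m (y t).1 = col_mx (z t).1 (0 : 'cV[R]_1) /\
                  B *m (y t).2 = col_mx (z t).2 (0 : 'cV[R]_1)].

Definition like_3D_D (J : 'M[R]_4) (a b : R) (x : R -> 'M[R]_4 * 'M[R]_4) : Prop :=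
  exists (A B : 'M[R]_4) (c : R) (z : R -> 'M[R]_3 * 'M[R]_3),
    [/\ GL A /\ orthogonal_mx B,
        B *m J *m B^T = block_mx (axi_mass a b) 0 0 (c%:M : 'M[R]_1),
        veselova_D_sol (axi_mass a b) z &
        forall t,
          A *m (x t).1 *m B^T = block_mx (z t).1 0 0 (1%:M : 'M[R]_1) /\
          B *m (x t).2 *m B^T = block_mx (z t).2 0 0 (0 : 'M[R]_1)].

End Cylindrical.

(* Main.v *)
(** Write the reduced system in the two planar components q = (q_1, q_2),
    p = (p_1, p_2).  With S = J_1 + J_2 one has q.Cq = S c_1 c_2 for the two
    eigenvalues c_j of C, and each (q_j, p_j) obeys an autonomous planar
    equation with the energy as parameter.  In it c_j (q_j x p_j)^2 is conserved
    and |q_j|^2, q_j.p_j, |p_j|^2 obey a linear system with constant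
    coefficients, so on the reduced space every motion is a harmonic oscillation
    or a rest point.

    A period T of the reduced motion gives x(t + T) = rho x(t) with rho in a
    compact torus of symmetries, and by Floquet's argument x lies on a torus with
    one dimension more than that of the torus of symmetries.  On D this needs the
    space part A of the monodromy: two solutions over the same reduced motion
    differ by a constant left rotation, which fixes e_1 and the conserved space
    momentum g p, hence is a rotation about a known plane; in S_3 the normal to
    the three-dimensional subspace of the motion is fixed too, and A = 1.

    Stability holds because the amplitude of the oscillation and its center are
    continuous constants of motion, the amplitude vanishing exactly at the
    relative equilibria. *)

(* The planes decouple because of the constraints: |q| = 1 gives 1/c_j = S + d_j |q_j|^2 with d_2 =
   - d_1, and q_2.p_2 = - q_1.p_1 makes the multiple of q in the velocity a function of either half
   alone. The coupling that remains is the common energy, a constant along each motion. The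
   dimension of the torus depends on the choice of T. In S_3, and at the relative equilibria in S_4,
   T is a time at which the first half itself returns, so that no turn of the first plane is left
   over. In S_3 this is twice the radial period, as q_1 has changed sign when |q_1|^2 returns for
   the first time. Injectivity of the torus further asks that the symmetries act freely along the
   curve and that only multiples of T bring the curve back to its orbit. On D the monodromy is a
   rotation, not a reflection, since det g is continuous with values 1 and -1. For stability the
   obstacle is that conserved quantities live on the quotient while neighbourhoods are given
   upstairs; a continuous section of the quotient over S_4 turns nearby invariants into nearby
   points. *)
Require Import Defs.
From HB Require Import structures.
From mathcomp Require Import all_boot all_order all_algebra.
From mathcomp Require Import all_classical all_reals all_analysis.
From mathcomp Require Import ring lra.
Set Implicit Arguments.
Unset Strict Implicit.
Unset Printing Implicit Defensive.
Import Order.TTheory GRing.Theory Num.Theory.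
Import numFieldNormedType.Exports.
Local Open Scope classical_set_scope.
Local Open Scope ring_scope.

(** * Derivatives of matrix-valued curves *)

Section Calculus.
Variable R : realType.

Lemma is_derive_mxP m n (F : R -> 'M[R]_(m, n)) t dF :
  is_derive t (1 : R) F dF <->
  forall i j, is_derive t (1 : R) (fun s => F s i j) (dF i j).
Proof.
split=> [[Ft FE] i j|H].
  split; first by move/derivable_mxP: Ft => /(_ i j).
  by rewrite -FE derive_mx// mxE.
have Ft : derivable F t (1 : R).
  by apply/derivable_mxP => i j; case: (H i j).
split => //; rewrite derive_mx//; apply/matrixP => i j; rewrite mxE.
by case: (H i j).
Qed.

Lemma is_derive_shiftr (W : normedModType R) (f : R -> W) (t tau : R) (df : W) :
  is_derive (t + tau) (1 : R) f df -> is_derive t (1 : R) (fun s => f (s + tau)) df.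
Proof.
move=> [fd fE].
have E : (fun h : R => h^-1 *: ((fun s => f (s + tau)) (h *: 1 + t) - f (t + tau)))
       = (fun h : R => h^-1 *: (f (h *: 1 + (t + tau)) - f (t + tau))).
  by apply/funext => h; rewrite addrA.
by split; rewrite /derivable/= /derive/= E.
Qed.

(** From here to [is_derive1_id] the derivative rules are stated for functions in pointwise form,
    the shape in which [isd] meets them in a goal. *)
Lemma is_derive1D (W : normedModType R) (f g : R -> W) (t : R) df dg :
  is_derive t (1 : R) f df -> is_derive t (1 : R) g dg ->
  is_derive t (1 : R) (fun s => f s + g s) (df + dg).
Proof. exact: is_deriveD. Qed.

Lemma is_derive1N (W : normedModType R) (f : R -> W) (t : R) df :
  is_derive t (1 : R) f df -> is_derive t (1 : R) (fun s => - f s) (- df).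
Proof. exact: is_deriveN. Qed.

Lemma is_derive1B (W : normedModType R) (f g : R -> W) (t : R) df dg :
  is_derive t (1 : R) f df -> is_derive t (1 : R) g dg ->
  is_derive t (1 : R) (fun s => f s - g s) (df - dg).
Proof. exact: is_deriveB. Qed.

Lemma is_derive1c (W : normedModType R) (c : W) (t : R) :
  is_derive t (1 : R) (fun=> c) 0.
Proof. exact: is_derive_cst. Qed.

Lemma is_derive1M (f g : R -> R) (t df dg : R) :
  is_derive t (1 : R) f df -> is_derive t (1 : R) g dg ->
  is_derive t (1 : R) (fun s => f s * g s) (df * g t + f t * dg).
Proof.
move=> fd gd; apply: is_derive_eq (is_deriveM fd gd) _.
by rewrite /GRing.scale/= addrC [g t * _]mulrC.
Qed.

Lemma is_derive1V (f : R -> R) (t df : R) : f t != 0 ->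
  is_derive t (1 : R) f df ->
  is_derive t (1 : R) (fun s => (f s)^-1) (- df / f t ^+ 2).
Proof.
move=> f0 fd; apply: is_derive_eq (is_deriveV f0 fd) _.
by rewrite /GRing.scale/= !mulNr mulrC.
Qed.

Lemma is_derive1X (f : R -> R) n (t df : R) :
  is_derive t (1 : R) f df ->
  is_derive t (1 : R) (fun s => f s ^+ n) (n%:R * f t ^+ n.-1 * df).
Proof.
move=> fd; have -> : (fun s => f s ^+ n) = f ^+ n.
  by apply/funext => s; elim: n => [|n IH]; rewrite ?expr0// !exprS IH.
exact: is_deriveX.
Qed.

Lemma is_derive1_cos (f : R -> R) (t df : R) : is_derive t (1 : R) f df ->
  is_derive t (1 : R) (fun s => cos (f s)) (- sin (f t) * df).
Proof. by move=> fd; exact: is_derive1_comp. Qed.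

Lemma is_derive1_sin (f : R -> R) (t df : R) : is_derive t (1 : R) f df ->
  is_derive t (1 : R) (fun s => sin (f s)) (cos (f t) * df).
Proof. by move=> fd; exact: is_derive1_comp. Qed.

Lemma is_derive1_Sqrt (f : R -> R) (t df : R) : 0 < f t ->
  is_derive t (1 : R) f df ->
  is_derive t (1 : R) (fun s => Num.sqrt (f s)) (df / (2 * Num.sqrt (f t))).
Proof.
move=> f0 fd; rewrite mulrC.
by apply: is_derive1_comp; exact: is_derive1_sqrt.
Qed.

Lemma is_derive1_eq (f : R -> R) (t df df' : R) :
  is_derive t (1 : R) f df' -> df' = df -> is_derive t (1 : R) f df.
Proof. by move=> ? <-. Qed.

Lemma is_derive1_id (t : R) : is_derive t (1 : R) (fun s => s) 1.
Proof. exact: is_derive_id. Qed.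

Lemma is_derive1_sum (W : normedModType R) (I : Type) (r : seq I) (P : pred I)
    (F : I -> R -> W) (t : R) dF :
  (forall i, is_derive t (1 : R) (F i) (dF i)) ->
  is_derive t (1 : R) (fun s => \sum_(i <- r | P i) F i s)
    (\sum_(i <- r | P i) dF i).
Proof.
move=> H; elim: r => [|i r IH].
  under eq_fun do rewrite big_nil; rewrite big_nil; exact: is_derive_cst.
under eq_fun do rewrite big_cons; rewrite big_cons; case: (P i) => //.
exact: is_derive1D.
Qed.

Lemma is_derive_mulmx m n p (F : R -> 'M[R]_(m, n)) (G : R -> 'M[R]_(n, p))
    (t : R) dF dG :
  is_derive t (1 : R) F dF -> is_derive t (1 : R) G dG ->
  is_derive t (1 : R) (fun s => F s *m G s) (dF *m G t + F t *m dG).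
Proof.
move=> /is_derive_mxP HF /is_derive_mxP HG; apply/is_derive_mxP => i j.
under eq_fun do rewrite mxE.
apply: is_derive_eq.
  by exact: (is_derive1_sum _ _ (fun k => is_derive1M (HF i k) (HG k j))).
by rewrite !mxE -big_split.
Qed.

Lemma is_derive_mulmxl m n p (A : 'M[R]_(m, n)) (F : R -> 'M[R]_(n, p)) (t : R) dF :
  is_derive t (1 : R) F dF -> is_derive t (1 : R) (fun s => A *m F s) (A *m dF).
Proof.
move=> Fd; apply: is_derive_eq; first exact: (is_derive_mulmx (is_derive1c A t) Fd).
by rewrite mul0mx add0r.
Qed.

Lemma is_derive_mulmxr m n p (A : 'M[R]_(n, p)) (F : R -> 'M[R]_(m, n)) (t : R) dF :
  is_derive t (1 : R) F dF -> is_derive t (1 : R) (fun s => F s *m A) (dF *m A).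
Proof.
move=> Fd; apply: is_derive_eq; first exact: (is_derive_mulmx Fd (is_derive1c A t)).
by rewrite mulmx0 addr0.
Qed.

Lemma is_derive_trmx m n (F : R -> 'M[R]_(m, n)) (t : R) dF :
  is_derive t (1 : R) F dF -> is_derive t (1 : R) (fun s => (F s)^T) dF^T.
Proof.
move=> /is_derive_mxP H; apply/is_derive_mxP => i j.
by under eq_fun do rewrite mxE; rewrite mxE.
Qed.

Lemma is_derive0_cst (f : R -> R) :
  (forall t, is_derive t (1 : R) f 0) -> forall s t, f s = f t.
Proof. by move=> H s t; exact: is_derive_0_is_cst. Qed.

Lemma is_derive0_mx_cst m n (F : R -> 'M[R]_(m, n)) :
  (forall t, is_derive t (1 : R) F 0) -> forall s t, F s = F t.
Proof.
move=> H s t; apply/matrixP => i j.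
apply: (@is_derive0_cst (fun s => F s i j)) => u.
by have /is_derive_mxP/(_ i j) := H u; rewrite mxE.
Qed.

Lemma is_derive_unique (W : normedModType R) (f : R -> W) (t : R) d1 d2 :
  is_derive t (1 : R) f d1 -> is_derive t (1 : R) f d2 -> d1 = d2.
Proof. by move=> [_ <-] [_ <-]. Qed.

Lemma cvg_mx (T : Type) (F : set_system T) {FF : Filter F} m n
    (f : T -> 'M[R]_(m, n)) (M : 'M[R]_(m, n)) :
  (forall i j, (fun x => f x i j) @ F --> M i j) -> f @ F --> M.
Proof.
move=> H; apply/cvg_mx_entourageP => A entA.
have : \forall x \near F, forall i j, (M i j, f x i j) \in A.
  apply: filter_forall => i; apply: filter_forall => j.
  have := (cvg_app_entourageP _ FF _).1 (H i j) A entA.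
  by apply: (@filterS _ F) => x Ax; rewrite inE.
exact.
Qed.

Lemma cvg_to_pair (T : Type) (F : set_system T) {FF : Filter F}
    (U V : topologicalType) (f : T -> U) (g : T -> V) (u : U) (v : V) :
  f @ F --> u -> g @ F --> v -> (fun x => (f x, g x)) @ F --> (u, v).
Proof. by move=> fu gv; exact: cvg_pair. Qed.

Lemma mx_continuous (T : topologicalType) m n (f : T -> 'M[R]_(m, n)) (x : T) :
  (forall i j, f y i j @[y --> x] --> f x i j) -> f y @[y --> x] --> f x.
Proof. by move=> H; exact: (@cvg_mx _ (nbhs x) _ _ _ f (f x)). Qed.

Lemma pair_continuous (T U V : topologicalType) (f : T -> U) (g : T -> V) (x : T) :
  f y @[y --> x] --> f x -> g y @[y --> x] --> g x ->
  (f y, g y) @[y --> x] --> (f x, g x).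
Proof. by move=> fx gx; exact: (@cvg_to_pair _ (nbhs x) _ _ _ f g _ _ fx gx). Qed.

Lemma is_derive_continuous (f : R -> R) (t df : R) :
  is_derive t (1 : R) f df -> f s @[s --> t] --> f t.
Proof. by move=> [+ _] => /derivable1_diffP/differentiable_continuous. Qed.

Lemma is_derive_mx_continuous m n (f : R -> 'M[R]_(m, n)) (t : R) df :
  is_derive t (1 : R) f df -> f s @[s --> t] --> f t.
Proof.
move=> /is_derive_mxP H; apply: mx_continuous => i j; exact: is_derive_continuous.
Qed.

End Calculus.

(* [apply:] would let typeclass resolution pick the derivative instances of the
   library, whose functions are not in pointwise form. *)
Ltac isd := first
  [ match goal with H : _ |- _ => first [notypeclasses refine (H _) | exact H] end
  | notypeclasses refine (is_derive1c _ _)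
  | notypeclasses refine (is_derive1_id _)
  | notypeclasses refine (is_derive1D _ _); isd
  | notypeclasses refine (is_derive1B _ _); isd
  | notypeclasses refine (is_derive1N _); isd
  | notypeclasses refine (is_derive1M _ _); isd
  | notypeclasses refine (is_derive1X _ _); isd
  | notypeclasses refine (is_derive1V _ _); [ | isd]
  | notypeclasses refine (is_derive1_cos _); isd
  | notypeclasses refine (is_derive1_sin _); isd
  | notypeclasses refine (is_derive1_Sqrt _ _); [ | isd]
  ].
(** The last goal left is the identity between the computed and the expected derivative; side
    conditions such as nonzero denominators come before it. *)
Ltac derive_to := notypeclasses refine (is_derive1_eq _ _); [isd | rewrite /=].

(** * Planar rotations and invariant tori *)

Section Oscillator.
Variable R : realType.

(** Rotating [(u, v)] back through the angle [w * t] gives two constants of motion. Undoing the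
    rotation yields the formulas without any uniqueness theorem for differential equations. *)
Lemma oscillator (w : R) (u v : R -> R) :
  (forall t, is_derive t (1 : R) u (w * v t)) ->
  (forall t, is_derive t (1 : R) v (- (w * u t))) ->
  forall t, u t = cos (w * t) * u 0 + sin (w * t) * v 0 /\
            v t = cos (w * t) * v 0 - sin (w * t) * u 0.
Proof.
move=> Hu Hv t.
have H1 := @is_derive0_cst R (fun s => cos (w * s) * u s - sin (w * s) * v s).
have {}H1 : cos (w * t) * u t - sin (w * t) * v t = u 0.
  rewrite (H1 _ t 0) ?mulr0 ?cos0 ?sin0 ?mul1r ?mul0r ?subr0// => s.
  by derive_to; ring.
have H2 := @is_derive0_cst R (fun s => sin (w * s) * u s + cos (w * s) * v s).
have {}H2 : sin (w * t) * u t + cos (w * t) * v t = v 0.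
  rewrite (H2 _ t 0) ?mulr0 ?cos0 ?sin0 ?mul1r ?mul0r ?add0r// => s.
  by derive_to; ring.
have := cos2Dsin2 (w * t); rewrite -H1 -H2.
move: (cos _) (sin _) => c s cs; split.
  transitivity ((c ^+ 2 + s ^+ 2) * u t); first by rewrite cs mul1r.
  ring.
transitivity ((c ^+ 2 + s ^+ 2) * v t); first by rewrite cs mul1r.
ring.
Qed.

Lemma cos_sin_turns (k : int) :
  cos (2 * pi * k%:~R : R) = 1 /\ sin (2 * pi * k%:~R : R) = 0.
Proof.
have H (n : nat) : cos (2 * pi * n%:R : R) = 1 /\ sin (2 * pi * n%:R : R) = 0.
  elim: n => [|n [IHc IHs]]; first by rewrite mulr0 cos0 sin0.
  rewrite -(natr1 n) mulrDr mulr1 [2 * pi in X in _ + X]mulr_natl.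
  by rewrite (cosD2pi _) (sinD2pi _).
case: k => n; first exact: H.
by rewrite NegzE mulrNz mulrN cosN sinN; have [-> ->] := H n.+1; rewrite oppr0.
Qed.

(** The cosine is injective on [0, pi] only, so either the fractional part of [x] or its complement
    to 1 is compared with 0. *)
Lemma cos_eq1_turns (x : R) : cos (2 * pi * x) = 1 -> x \is a Num.int.
Proof.
move=> cx; have pi0 := @pi_gt0 R.
pose y := x - (Num.floor x)%:~R.
have cy : cos (2 * pi * y) = 1.
  have [ck sk] := cos_sin_turns (Num.floor x).
  by rewrite /y mulrBr cosB ck sk cx mulr0 mulr1 addr0.
have y0 : 0 <= y by rewrite subr_ge0 floor_le_tmp.
have y1 : y < 1 by rewrite ltrBlDl -intrD1 floorD1_gt.
suff: y = 0 by move/eqP; rewrite subr_eq0 => /eqP ->.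
have [yh|yh] := leP y (1 / 2).
  have : 2 * pi * y = 0.
    apply: (@cos_inj R); rewrite ?in_itv/= ?cos0//; last by rewrite lexx ltW.
    apply/andP; split; nra.
  nra.
have : 2 * pi * (1 - y) = 0.
  apply: (@cos_inj R); rewrite ?in_itv/= ?cos0//.
  - apply/andP; split; nra.
  - by rewrite lexx ltW.
  - have [ck sk] := cos_sin_turns 1.
    by rewrite mulrBr cosB ck sk cy mul0r addr0 mulr1.
nra.
Qed.

Lemma cos_sin_exists (c s : R) : c ^+ 2 + s ^+ 2 = 1 ->
  exists a, cos (2 * pi * a) = c /\ sin (2 * pi * a) = s.
Proof.
move=> cs1; have pi0 := @pi_gt0 R.
have c1 : -1 <= c <= 1 by apply/andP; split; nra.
have sE : Num.sqrt (1 - c ^+ 2) = `|s|.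
  by rewrite -sqrtr_sqr; congr Num.sqrt; lra.
have E (b : R) : 2 * pi * (b / (2 * pi)) = b.
  by rewrite mulrC divfK// mulf_neq0// gt_eqF.
have [s0|s0] := leP 0 s.
  exists (acos c / (2 * pi)); rewrite E acosK// sin_acos// sE.
  by rewrite ger0_norm.
exists (- (acos c / (2 * pi))); rewrite mulrN E cosN sinN acosK// sin_acos// sE.
by rewrite ltr0_norm// opprK.
Qed.

Lemma ord2P (P : 'I_2 -> Prop) : P 0 -> P 1 -> forall i, P i.
Proof.
move=> P0 P1 [[|[|//]]] i.
  by rewrite (_ : Ordinal i = 0)//; exact: val_inj.
by rewrite (_ : Ordinal i = 1)//; exact: val_inj.
Qed.

Lemma sum2E (V : nmodType) (F : 'I_2 -> V) : \sum_i F i = F 0 + F 1.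
Proof.
rewrite !big_ord_recl big_ord0 addr0.
by rewrite (_ : ord0 = 0)// (_ : lift 0 0 = 1)//; exact: val_inj.
Qed.

(* Angles are counted in turns. *)
Definition rot2 (a : R) : 'M[R]_2 :=
  \matrix_(i, j) if i == j then cos (2 * pi * a)
                 else (if i == 0 then - sin (2 * pi * a) else sin (2 * pi * a)).

Lemma rot2E a : [/\ rot2 a 0 0 = cos (2 * pi * a), rot2 a 0 1 = - sin (2 * pi * a),
  rot2 a 1 0 = sin (2 * pi * a) & rot2 a 1 1 = cos (2 * pi * a)].
Proof. by rewrite !mxE. Qed.

Lemma rot2D a b : rot2 (a + b) = rot2 a *m rot2 b.
Proof.
have [a00 a01 a10 a11] := rot2E a; have [b00 b01 b10 b11] := rot2E b.
have [c00 c01 c10 c11] := rot2E (a + b).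
move: c00 c01 c10 c11; rewrite mulrDr cosD sinD => c00 c01 c10 c11.
by apply/matrixP; apply: ord2P; apply: ord2P; rewrite [RHS]mxE sum2E
  ?(a00, a01, a10, a11, b00, b01, b10, b11, c00, c01, c10, c11); ring.
Qed.

Lemma rot2_int (a : R) : a \is a Num.int -> rot2 a = 1%:M.
Proof.
move=> /intrP[k ->]; have [ck sk] := cos_sin_turns k.
by apply/matrixP; apply: ord2P; apply: ord2P; rewrite !mxE ?ck ?sk ?oppr0.
Qed.

Lemma rot20 : rot2 0 = 1%:M. Proof. exact: rot2_int. Qed.

Lemma rot2T a : (rot2 a)^T = rot2 (- a).
Proof.
by apply/matrixP; apply: ord2P; apply: ord2P;
  rewrite !mxE/= ?mulrN ?cosN ?sinN ?opprK.
Qed.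

Lemma rot2_orthogonal a : orthogonal_mx (rot2 a).
Proof. by rewrite /orthogonal_mx rot2T -rot2D addNr rot20. Qed.

(** For a rotation r with cosine c, (r - 1)^T (r - 1) = 2 - 2 c, so a nonzero fixed vector forces c
    = 1. *)
Lemma rot2_fix (a : R) (v : 'cV[R]_2) : v != 0 -> rot2 a *m v = v -> a \is a Num.int.
Proof.
move=> v0 E; apply: cos_eq1_turns.
have [r00 r01 r10 r11] := rot2E a.
have := congr1 (fun M : 'cV_2 => M 0 0) E; rewrite mxE sum2E r00 r01.
have := congr1 (fun M : 'cV_2 => M 1 0) E; rewrite mxE sum2E r10 r11.
have := cos2Dsin2 (2 * pi * a); move: (cos _) (sin _) => c s cs E1 E0.
apply/eqP/negPn/negP => c1; move/eqP: v0; apply.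
have : (2 - 2 * c) * v 0 0 = 0.
  have -> : (2 - 2 * c) * v 0 0 = (c ^+ 2 + s ^+ 2 + 1 - 2 * c) * v 0 0.
    by rewrite cs; ring.
  transitivity (c * (c * v 0 0 - s * v 1 0) + s * (s * v 0 0 + c * v 1 0) + v 0 0 - 2 * c * v 0 0); first ring.
  have -> : c * v 0 0 - s * v 1 0 = v 0 0 by lra.
  have -> : s * v 0 0 + c * v 1 0 = v 1 0 by lra.
  lra.
have : (2 - 2 * c) * v 1 0 = 0.
  have -> : (2 - 2 * c) * v 1 0 = (c ^+ 2 + s ^+ 2 + 1 - 2 * c) * v 1 0.
    by rewrite cs; ring.
  transitivity (- s * (c * v 0 0 - s * v 1 0) + c * (s * v 0 0 + c * v 1 0) + v 1 0 - 2 * c * v 1 0); first ring.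
  have -> : c * v 0 0 - s * v 1 0 = v 0 0 by lra.
  have -> : s * v 0 0 + c * v 1 0 = v 1 0 by lra.
  lra.
have c2 : 2 - 2 * c != 0 by apply: contra c1 => /eqP ?; apply/eqP; lra.
move=> /eqP; rewrite mulf_eq0 (negPf c2)/= => /eqP v1.
move=> /eqP; rewrite mulf_eq0 (negPf c2)/= => /eqP v0.
by apply/matrixP => i j; rewrite ord1 [RHS]mxE; move: i; apply: ord2P.
Qed.

Lemma rot2_eq1 (a : R) : rot2 a = 1%:M -> a \is a Num.int.
Proof.
move=> E; apply: (@rot2_fix _ (const_mx 1)); last by rewrite E mul1mx.
by apply/eqP => /matrixP/(_ 0 0)/eqP; rewrite !mxE oner_eq0.
Qed.

Lemma rot2P (c s : R) : c ^+ 2 + s ^+ 2 = 1 -> exists a, [/\ rot2 a 0 0 = c,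
  rot2 a 0 1 = - s, rot2 a 1 0 = s & rot2 a 1 1 = c].
Proof.
by move=> /cos_sin_exists[a [ca sa]]; exists a; rewrite !mxE ca sa.
Qed.

Lemma rot2_continuous : continuous rot2.
Proof.
move=> a; apply: mx_continuous => i j.
have ch : 2 * pi * x @[x --> a] --> 2 * pi * a by apply: cvgMl_tmp; exact: cvg_id.
have cc : cos (2 * pi * x) @[x --> a] --> cos (2 * pi * a).
  by apply: continuous_comp => //; exact: continuous_cos.
have cs : sin (2 * pi * x) @[x --> a] --> sin (2 * pi * a).
  by apply: continuous_comp => //; exact: continuous_sin.
under eq_fun do rewrite mxE; rewrite mxE.
by case: (i == j) => //; case: (i == 0) => //; exact: (cvgN cs).
Qed.

End Oscillator.

(** * Floquet's argument for an action of a torus *)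

Section Torus.
Variables (R : realType) (X : topologicalType) (sol : (R -> X) -> Prop).

(** The new torus is the suspension of [rho w]: the m-torus sweeps the curve over one period and is
    glued to itself by the monodromy. The hypotheses [phase] and [free] separate points in the time
    direction and in the symmetry directions. *)
Lemma floquet_torus (m d : nat) (rho : 'rV[R]_m -> X -> X) (x : R -> X) (T : R)
    (w : 'rV[R]_m) :
  0 < T -> (m < d)%N ->
  continuous (fun au : 'rV[R]_m * R => rho au.1 (x au.2)) ->
  (forall a b u, rho (a + b) u = rho a (rho b u)) ->
  (forall (a : 'rV[R]_m) u, (forall i, a 0 i \is a Num.int) -> rho a u = u) ->
  (forall t, x (t + T) = rho w (x t)) ->
  (forall a tau, sol (fun t => rho a (x (t + tau)))) ->
  (forall a t t', x t' = rho a (x t) -> exists k : int, t' = t + k%:~R * T) ->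
  (forall (a : 'rV[R]_m) t, rho a (x t) = x t -> forall i, a 0 i \is a Num.int) ->
  lies_on_torus sol d x.
Proof.
move=> T0 md rho_cont rhoD rhoZ xT sol_rho phase free.
have rho0 u : rho 0 u = u by apply: rhoZ => i; rewrite mxE rpred0.
have rhoNK a u : rho (- a) (rho a u) = u by rewrite -rhoD addNr rho0.
have xTn (n : nat) t : x (t + n%:R * T) = rho (n%:R *: w) (x t).
  elim: n t => [|n IH] t; first by rewrite mul0r addr0 scale0r rho0.
  rewrite -(natr1 n) mulrDl mul1r addrA xT IH -rhoD.
  by rewrite scalerDl scale1r addrC.
have xTk (k : int) t : x (t + k%:~R * T) = rho (k%:~R *: w) (x t).
  case: k => n; first exact: xTn.
  rewrite NegzE mulrNz mulNr scaleNr.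
  have := xTn n.+1 (t - n.+1%:R * T); rewrite subrK => ->.
  by rewrite rhoNK.
pose tl (a : 'rV[R]_m.+1) : 'rV[R]_m := \row_i a 0 (lift ord0 i).
(* Coordinate 0 is time in units of T. The twist by [- a 0 0 *: w] cancels the monodromy and makes
   [phi] 1-periodic in that coordinate too. Along [freq] the twist is cancelled in turn, so that
   [phi] runs through a time shift of [x] under one fixed symmetry. *)
pose phi (a : 'rV[R]_m.+1) := rho (tl a - a 0 0 *: w) (x (T * a 0 0)).
pose freq : 'rV[R]_m.+1 := \row_j (T^-1 * (if unlift ord0 j is Some i then w 0 i else 1)).
have phiE a t : phi (a + t *: freq) = rho (tl a - a 0 0 *: w) (x (t + T * a 0 0)).
  rewrite /phi; congr (rho _ (x _)).
    apply/rowP => i; rewrite !mxE liftK unlift_none; ring.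
  by rewrite !mxE unlift_none; field; rewrite gt_eqF//.
exists m.+1, phi, freq; split => //; last first.
  exists 0 => t; rewrite phiE mxE mulr0 addr0 scale0r subr0.
  by rewrite rhoZ// => i; rewrite !mxE rpred0.
split.
- have c0 : continuous (fun a : 'rV[R]_m.+1 => a 0 0) by exact: coord_continuous.
  have c1 : continuous (fun a : 'rV[R]_m.+1 => tl a - a 0 0 *: w).
    have ctl : continuous tl.
      move=> a; apply: mx_continuous => i j; under eq_fun do rewrite mxE.
      rewrite mxE; exact: coord_continuous.
    by move=> a; exact: (cvgB (ctl a) (cvgZr_tmp (c0 a))).
  have c2 : continuous (fun a : 'rV[R]_m.+1 => T * a 0 0).
    by move=> a; exact: cvgMl_tmp (c0 a).
  move=> a; pose g (a : 'rV[R]_m.+1) := (tl a - a 0 0 *: w, T * a 0 0).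
  apply: (@continuous_comp _ _ _ g (fun au : 'rV[R]_m * R => rho au.1 (x au.2))).
    exact: pair_continuous (c1 a) (c2 a).
  exact: rho_cont.
- move=> a b; split.
    move=> /(congr1 (rho (- (tl b - b 0 0 *: w)))); rewrite rhoNK -rhoD => E.
    have [k Ek] := phase _ _ _ (esym E).
    have {}Ek : b 0 0 = a 0 0 + k%:~R.
      apply: (@mulfI _ T); first by rewrite gt_eqF//.
      by rewrite Ek mulrDr [_ * T]mulrC.
    have : x (T * b 0 0) = rho (k%:~R *: w) (x (T * a 0 0)).
      by rewrite -xTk Ek mulrDr [T * k%:~R]mulrC.
    rewrite -E => /(congr1 (rho (- (k%:~R *: w)))); rewrite rhoNK -rhoD.
    move=> /free H i; case: (unliftP ord0 i) => [j|] ->; last first.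
      by rewrite Ek opprD addNKr rpredN intr_int.
    have := H j; rewrite Ek !mxE.
    by congr (is_true (_ \is a Num.int)); ring.
  move=> H; have [k Ek] : exists k : int, a 0 0 = b 0 0 + k%:~R.
    by have /intrP[k Ek] := H 0; exists k; rewrite -Ek addrC subrK.
  rewrite /phi Ek mulrDr [T * k%:~R]mulrC xTk -rhoD.
  rewrite -[RHS](rhoZ (tl a - tl b)); last first.
    by move=> i; rewrite !mxE; exact: H.
  rewrite -rhoD; congr (rho _ _).
  by apply/rowP => i; rewrite !mxE; ring.
- by move=> a; under eq_fun do rewrite phiE; exact: sol_rho.
Qed.

End Torus.

(** * The planar components of the reduced system *)

Section Planar.
Variable R : realType.
Implicit Types (S d : R) (h x y u v : R -> R).

(* One of the two planar components q = (x, y), p = (u, v) of the reduced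
   system.  With s = |q|^2 and l = x v - y u, the identity
   s p = (q.p) q + l (-y, x) turns the equation of motion into
   q' = (p - d l / (S + d s) (-y, x)) / S. *)
Definition planar S d h x y u v := forall t : R,
  let l := x t * v t - y t * u t in
  let D := S + d * (x t ^+ 2 + y t ^+ 2) in
  [/\ 0 < D,
      is_derive t (1 : R) x ((u t + d * l / D * y t) / S),
      is_derive t (1 : R) y ((v t - d * l / D * x t) / S),
      is_derive t (1 : R) u (- (h t * x t)) &
      is_derive t (1 : R) v (- (h t * y t))].

Variables (S d : R) (h x y u v : R -> R).
Hypotheses (S_gt0 : 0 < S) (sol : planar S d h x y u v).

Let D_gt0 t : 0 < S + d * (x t ^+ 2 + y t ^+ 2). Proof. by have [] := sol t. Qed.
Let D_neq0 t : S + d * (x t ^+ 2 + y t ^+ 2) != 0. Proof. by rewrite gt_eqF. Qed.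
Let S_neq0 : S != 0. Proof. by rewrite gt_eqF. Qed.
Let dx t : is_derive t (1 : R) x ((u t + d * (x t * v t - y t * u t) /
  (S + d * (x t ^+ 2 + y t ^+ 2)) * y t) / S). Proof. by have [] := sol t. Qed.
Let dy t : is_derive t (1 : R) y ((v t - d * (x t * v t - y t * u t) /
  (S + d * (x t ^+ 2 + y t ^+ 2)) * x t) / S). Proof. by have [] := sol t. Qed.
Let du t : is_derive t (1 : R) u (- (h t * x t)). Proof. by have [] := sol t. Qed.
Let dv t : is_derive t (1 : R) v (- (h t * y t)). Proof. by have [] := sol t. Qed.

Lemma planar_norm_q t : is_derive t (1 : R) (fun t => x t ^+ 2 + y t ^+ 2)
  (2 * (x t * u t + y t * v t) / S).
Proof. by derive_to; field; rewrite ?S_neq0 ?D_neq0. Qed.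

Lemma planar_norm_p t : is_derive t (1 : R) (fun t => u t ^+ 2 + v t ^+ 2)
  (- 2 * h t * (x t * u t + y t * v t)).
Proof. by derive_to; ring. Qed.

(** This is c_j (q_j x p_j)^2, the eigenvalue c_j of C being the reciprocal of [D] in [planar]. *)
Definition area_integral := fun t =>
  (x t * v t - y t * u t) ^+ 2 / (S + d * (x t ^+ 2 + y t ^+ 2)).

Lemma planar_area s t : area_integral s = area_integral t.
Proof.
by apply: is_derive0_cst => {s}t; derive_to => //; field; rewrite ?S_neq0 ?D_neq0.
Qed.

(** The root of [area_integral] is conserved with its sign: where |q| returns, so does the area
    itself, and an area that vanishes once vanishes always. *)
Lemma planar_signed_area s t :
  (x s * v s - y s * u s) / Num.sqrt (S + d * (x s ^+ 2 + y s ^+ 2)) =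
  (x t * v t - y t * u t) / Num.sqrt (S + d * (x t ^+ 2 + y t ^+ 2)).
Proof.
apply: (@is_derive0_cst _ (fun t => (x t * v t - y t * u t) /
  Num.sqrt (S + d * (x t ^+ 2 + y t ^+ 2)))) => {s}t.
have r0 : Num.sqrt (S + d * (x t ^+ 2 + y t ^+ 2)) != 0.
  by rewrite gt_eqF// sqrtr_gt0.
derive_to => //.
have := sqr_sqrtr (ltW (D_gt0 t)); move: (Num.sqrt _) r0 => r r0 rE.
rewrite -rE.
by field; rewrite ?r0 ?S_neq0.
Qed.

(* [s p = (q.p) q + l (-y, x)] recovers p from q, so that q and its translate
   solve the same linear equation, with coefficients commuting with rotations. *)
Lemma planar_floquet T :
  (forall t, x t * v t - y t * u t != 0) ->
  (forall t, x (t + T) ^+ 2 + y (t + T) ^+ 2 = x t ^+ 2 + y t ^+ 2) ->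
  (forall t, x (t + T) * u (t + T) + y (t + T) * v (t + T) = x t * u t + y t * v t) ->
  exists a, forall t,
   [/\ x (t + T) = rot2 a 0 0 * x t + rot2 a 0 1 * y t,
       y (t + T) = rot2 a 1 0 * x t + rot2 a 1 1 * y t,
       u (t + T) = rot2 a 0 0 * u t + rot2 a 0 1 * v t &
       v (t + T) = rot2 a 1 0 * u t + rot2 a 1 1 * v t].
Proof.
move=> l0 sT sgT.
have lT t : x (t + T) * v (t + T) - y (t + T) * u (t + T) = x t * v t - y t * u t.
  have := planar_signed_area (t + T) t; rewrite sT => /divIf; apply.
  by rewrite gt_eqF// sqrtr_gt0.
have s0 t : x t ^+ 2 + y t ^+ 2 != 0.
  apply: contra (l0 t); rewrite paddr_eq0 ?sqr_ge0// !sqrf_eq0.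
  by move=> /andP[/eqP-> /eqP->]; rewrite !mul0r subrr.
have pE (X Y U V : R) : X ^+ 2 + Y ^+ 2 != 0 ->
    (U = ((X * U + Y * V) * X - (X * V - Y * U) * Y) / (X ^+ 2 + Y ^+ 2)) /\
    (V = ((X * U + Y * V) * Y + (X * V - Y * U) * X) / (X ^+ 2 + Y ^+ 2)).
  by move=> XY0; split; field; rewrite XY0.
have uTE t : u (t + T) = ((x t * u t + y t * v t) * x (t + T) -
    (x t * v t - y t * u t) * y (t + T)) / (x t ^+ 2 + y t ^+ 2).
  by rewrite -sgT -lT -sT; apply: (pE _ _ _ _ _).1; rewrite sT.
have vTE t : v (t + T) = ((x t * u t + y t * v t) * y (t + T) +
    (x t * v t - y t * u t) * x (t + T)) / (x t ^+ 2 + y t ^+ 2).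
  by rewrite -sgT -lT -sT; apply: (pE _ _ _ _ _).2; rewrite sT.
pose X t := x (t + T); pose Y t := y (t + T).
have dX t : is_derive t (1 : R) X ((u (t + T) + d * (x t * v t - y t * u t) /
    (S + d * (x t ^+ 2 + y t ^+ 2)) * Y t) / S).
  by rewrite -lT -sT; apply: is_derive_shiftr.
have dY t : is_derive t (1 : R) Y ((v (t + T) - d * (x t * v t - y t * u t) /
    (S + d * (x t ^+ 2 + y t ^+ 2)) * X t) / S).
  by rewrite -lT -sT; apply: is_derive_shiftr.
(* [c] and [n] are the cosine and sine of the angle from q(t) to q(t + T). That they are constant
   means that one fixed rotation serves all times. *)
pose c t := (x t * X t + y t * Y t) / (x t ^+ 2 + y t ^+ 2).
pose n t := (x t * Y t - y t * X t) / (x t ^+ 2 + y t ^+ 2).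
have cC : forall s t, c s = c t.
  apply: is_derive0_cst => t; derive_to => //; rewrite uTE vTE -/(X t) -/(Y t).
  by field; rewrite ?s0 ?S_neq0 ?D_neq0.
have nC : forall s t, n s = n t.
  apply: is_derive0_cst => t; derive_to => //; rewrite uTE vTE -/(X t) -/(Y t).
  by field; rewrite ?s0 ?S_neq0 ?D_neq0.
have cn : c 0 ^+ 2 + n 0 ^+ 2 = 1.
  have -> : c 0 ^+ 2 + n 0 ^+ 2 = (X 0 ^+ 2 + Y 0 ^+ 2) / (x 0 ^+ 2 + y 0 ^+ 2).
    by rewrite /c /n; field; rewrite s0.
  by rewrite sT divff.
have [a [a00 a01 a10 a11]] := rot2P cn; exists a => t.
rewrite a00 a01 a10 a11 (cC 0 t) (nC 0 t) uTE vTE /c /n -/(X t) -/(Y t).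
by split; field; rewrite s0.
Qed.

Lemma planar_area0 t0 t : x t0 * v t0 - y t0 * u t0 = 0 ->
  x t * v t - y t * u t = 0.
Proof.
move=> l0; have /eqP := planar_signed_area t t0; rewrite l0 mul0r.
rewrite mulf_eq0 invr_eq0 => /orP[/eqP//|].
by rewrite gt_eqF// sqrtr_gt0.
Qed.

Lemma planar_rectilinear : (forall t, x t * v t - y t * u t = 0) -> forall t,
  is_derive t (1 : R) x (u t / S) /\ is_derive t (1 : R) y (v t / S).
Proof.
move=> l0 t; have := dx t; have := dy t.
by rewrite l0 mulr0 !mul0r subr0 addr0.
Qed.

Section Energy.
Variable H : R.
Hypotheses (H_gt0 : 0 < H) (hE : forall t, h t = H).

(** The derivative of q.p. Since [area_integral] is constant, it involves only |q|^2 and |p|^2,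
    whose derivatives are multiples of q.p; this closes the linear system. *)
Definition radial_force := fun t =>
  (u t ^+ 2 + v t ^+ 2 - d * area_integral t) / S - H * (x t ^+ 2 + y t ^+ 2).

Lemma planar_radial t : is_derive t (1 : R) (fun t => x t * u t + y t * v t)
  (radial_force t).
Proof.
derive_to; rewrite hE /radial_force /area_integral.
by field; rewrite ?S_neq0 ?D_neq0.
Qed.

Lemma planar_radial_force t : is_derive t (1 : R) radial_force
  (- (4 * H / S * (x t * u t + y t * v t))).
Proof.
have aC := planar_area^~ 0.
have -> : radial_force = fun t => (u t ^+ 2 + v t ^+ 2 - d * area_integral 0) / S
    - H * (x t ^+ 2 + y t ^+ 2).
  by apply/funext => r; rewrite /radial_force aC.
have pi' := planar_norm_p; have s' := planar_norm_q.
by derive_to; rewrite ?hE; field.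
Qed.

(** The constant is 2 H times the value of |q|^2 at which the force vanishes, the center of the
    oscillation. It also recovers |q|^2 from the force. *)
Lemma planar_radial_integral s t :
  radial_force s + 2 * H * (x s ^+ 2 + y s ^+ 2) =
  radial_force t + 2 * H * (x t ^+ 2 + y t ^+ 2).
Proof.
apply: (@is_derive0_cst _ (fun t => radial_force t + 2 * H * (x t ^+ 2 + y t ^+ 2))).
move=> {s}t; have f' := planar_radial_force; have s' := planar_norm_q.
by derive_to; field.
Qed.

Let w := Num.sqrt (4 * H / S).
Let w_gt0 : 0 < w. Proof. by rewrite sqrtr_gt0 divr_gt0// mulr_gt0. Qed.
Let w2 : w ^+ 2 = 4 * H / S.
Proof. by rewrite sqr_sqrtr// divr_ge0 ?mulr_ge0// ltW. Qed.

Lemma planar_radial_solution t :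
  w * (x t * u t + y t * v t) = cos (w * t) * (w * (x 0 * u 0 + y 0 * v 0)) +
    sin (w * t) * radial_force 0 /\
  radial_force t = cos (w * t) * radial_force 0 -
    sin (w * t) * (w * (x 0 * u 0 + y 0 * v 0)).
Proof.
apply: (@oscillator _ w (fun t => w * (x t * u t + y t * v t)) radial_force) => {}t.
  by have sg' := planar_radial; derive_to; ring.
have f' := planar_radial_force; derive_to.
by rewrite -w2; ring.
Qed.

Lemma planar_radial_conserved s t :
  radial_force s ^+ 2 + 4 * H / S * (x s * u s + y s * v s) ^+ 2 =
  radial_force t ^+ 2 + 4 * H / S * (x t * u t + y t * v t) ^+ 2.
Proof.
apply: (@is_derive0_cst _ (fun t =>
  radial_force t ^+ 2 + 4 * H / S * (x t * u t + y t * v t) ^+ 2)) => {s}t.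
have f' := planar_radial_force; have sg' := planar_radial.
by derive_to; field.
Qed.

End Energy.

(** With q.p = 0 the radius is constant, hence so is the area, and |q|^2 p = l (-y, x) makes p a
    constant multiple of q turned by a right angle. The equation for q becomes a uniform
    rotation. *)
Lemma planar_circular : (forall t, x t * v t - y t * u t != 0) ->
  (forall t, x t * u t + y t * v t = 0) ->
  exists2 w, w != 0 & forall t,
  [/\ x t = cos (w * t) * x 0 - sin (w * t) * y 0,
      y t = sin (w * t) * x 0 + cos (w * t) * y 0,
      u t = cos (w * t) * u 0 - sin (w * t) * v 0 &
      v t = sin (w * t) * u 0 + cos (w * t) * v 0].
Proof.
move=> l0 sg0.
have s0 t : x t ^+ 2 + y t ^+ 2 != 0.
  apply: contra (l0 t); rewrite paddr_eq0 ?sqr_ge0// !sqrf_eq0.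
  by move=> /andP[/eqP-> /eqP->]; rewrite !mul0r subrr.
have sC t : x t ^+ 2 + y t ^+ 2 = x 0 ^+ 2 + y 0 ^+ 2.
  apply: (@is_derive0_cst _ (fun t => x t ^+ 2 + y t ^+ 2)) => {}t.
  by have := planar_norm_q t; rewrite sg0 mulr0 mul0r.
have lC t : x t * v t - y t * u t = x 0 * v 0 - y 0 * u 0.
  have := planar_signed_area t 0; rewrite sC => /divIf; apply.
  by rewrite gt_eqF// sqrtr_gt0.
have uE t : u t = - ((x 0 * v 0 - y 0 * u 0) / (x 0 ^+ 2 + y 0 ^+ 2) * y t).
  transitivity (((x t * u t + y t * v t) * x t - (x t * v t - y t * u t) * y t)
    / (x t ^+ 2 + y t ^+ 2)); first by field; rewrite s0.
  by rewrite sg0 lC sC mul0r sub0r; ring.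
have vE t : v t = (x 0 * v 0 - y 0 * u 0) / (x 0 ^+ 2 + y 0 ^+ 2) * x t.
  transitivity (((x t * u t + y t * v t) * y t + (x t * v t - y t * u t) * x t)
    / (x t ^+ 2 + y t ^+ 2)); first by field; rewrite s0.
  by rewrite sg0 lC sC mul0r add0r; ring.
(* Substituting p gives the speed l (D - d s) / (s D S), with s = |q|^2, and D - d s = S. *)
pose w := (x 0 * v 0 - y 0 * u 0) / ((x 0 ^+ 2 + y 0 ^+ 2) *
  (S + d * (x 0 ^+ 2 + y 0 ^+ 2))).
have x' t : is_derive t (1 : R) x (- (w * y t)).
  move: (dx t); rewrite lC sC uE => /is_derive1_eq; apply.
  by rewrite /w; field; rewrite ?S_neq0 ?D_neq0 ?s0.
have y' t : is_derive t (1 : R) y (w * x t).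
  move: (dy t); rewrite lC sC vE => /is_derive1_eq; apply.
  by rewrite /w; field; rewrite ?S_neq0 ?D_neq0 ?s0.
exists w; first by rewrite mulf_neq0// invr_neq0// mulf_neq0.
move=> t; have [yE xE] := oscillator y' x' t.
move: uE vE; move: (_ / (x 0 ^+ 2 + y 0 ^+ 2)) => k uE vE.
rewrite (uE t) (vE t) (uE 0) (vE 0) xE yE.
by split; ring.
Qed.

End Planar.

(** * Reduction of the Veselova system *)

Section Euclidean.
Variables (R : realType) (n : nat).
Local Notation vec := 'cV[R]_n.+1.
Local Notation mat := 'M[R]_n.+1.
Implicit Types (a b c : vec) (A B M g : mat).

Lemma dot_mx a b : a^T *m b = (dot a b)%:M.
Proof. by rewrite [LHS]mx11_scalar. Qed.

Lemma dotE a b : dot a b = \sum_i a i 0 * b i 0.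
Proof. by rewrite /dot mxE; apply: eq_bigr => i _; rewrite mxE. Qed.

Lemma dotC a b : dot a b = dot b a.
Proof. by rewrite !dotE; apply: eq_bigr => i _; rewrite mulrC. Qed.

Lemma dotDr a b c : dot a (b + c) = dot a b + dot a c.
Proof. by rewrite /dot mulmxDr mxE. Qed.

Lemma dotBr a b c : dot a (b - c) = dot a b - dot a c.
Proof. by rewrite /dot mulmxBr !mxE. Qed.

Lemma dotNr a b : dot a (- b) = - dot a b.
Proof. by rewrite /dot mulmxN mxE. Qed.

Lemma dotZr k a b : dot a (k *: b) = k * dot a b.
Proof. by rewrite /dot -scalemxAr mxE. Qed.

Lemma dotDl a b c : dot (a + b) c = dot a c + dot b c.
Proof. by rewrite dotC dotDr !(dotC c). Qed.

Lemma dotBl a b c : dot (a - b) c = dot a c - dot b c.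
Proof. by rewrite dotC dotBr !(dotC c). Qed.

Lemma dotNl a b : dot (- a) b = - dot a b.
Proof. by rewrite dotC dotNr dotC. Qed.

Lemma dotZl k a b : dot (k *: a) b = k * dot a b.
Proof. by rewrite dotC dotZr dotC. Qed.

Lemma dot_mulmx M a b : dot a (M *m b) = dot (M^T *m a) b.
Proof. by rewrite /dot trmx_mul trmxK mulmxA. Qed.

Lemma dot_ge0 a : 0 <= dot a a.
Proof. by rewrite dotE sumr_ge0// => i _; rewrite -expr2 sqr_ge0. Qed.

Lemma dot_eq0 a : dot a a = 0 -> a = 0.
Proof.
rewrite dotE => H; apply/matrixP => i j; rewrite ord1 mxE; apply/eqP.
rewrite -sqrf_eq0 expr2.
have Hp k : true -> 0 <= a k 0 * a k 0 by rewrite -expr2 sqr_ge0.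
by apply/eqP; exact: (psumr_eq0P Hp H).
Qed.

Lemma dot_gt0 a : a != 0 -> 0 < dot a a.
Proof.
by move=> a0; rewrite lt_neqAle dot_ge0 eq_sym andbT; apply: contra a0 => /eqP/dot_eq0->.
Qed.

Lemma wedge_mulmx a b c : wedge a b *m c = dot b c *: a - dot a c *: b.
Proof.
by rewrite /wedge mulmxBl -!mulmxA !dot_mx !mul_mx_scalar.
Qed.

Lemma wedge_tr a b : (wedge a b)^T = - wedge a b.
Proof. by rewrite /wedge linearB /= !trmx_mul !trmxK opprB. Qed.

Lemma wedge_self a : wedge a a = 0. Proof. exact: subrr. Qed.

Lemma wedgeBr a b c : wedge a (b - c) = wedge a b - wedge a c.
Proof.
rewrite /wedge linearB /= mulmxBr mulmxBl !opprB addrACA [RHS]addrACA.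
by congr (_ + _); exact: addrC.
Qed.

Lemma wedgeZr k a b : wedge a (k *: b) = k *: wedge a b.
Proof. by rewrite /wedge linearZ/= -scalemxAr -scalemxAl scalerBr. Qed.

Lemma wedge_conj M a b : wedge (M *m a) (M *m b) = M *m wedge a b *m M^T.
Proof. by rewrite /wedge !trmx_mul mulmxBr mulmxBl !mulmxA. Qed.

Lemma orthogonal_mxC g : orthogonal_mx g -> g *m g^T = 1%:M.
Proof. exact: mulmx1C. Qed.

Lemma orthogonal_unit g : orthogonal_mx g -> g \in unitmx.
Proof. by move=> /mulmx1_unit[]. Qed.

Lemma orthogonal_inv g : orthogonal_mx g -> invmx g = g^T.
Proof.
by move=> og; rewrite -[LHS]mul1mx -og mulmxK ?orthogonal_unit.
Qed.

Lemma orthogonalM g g' : orthogonal_mx g -> orthogonal_mx g' -> orthogonal_mx (g *m g').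
Proof.
by move=> og og'; rewrite /orthogonal_mx trmx_mul mulmxA -(mulmxA g'^T) og mulmx1.
Qed.

Lemma orthogonalT g : orthogonal_mx g -> orthogonal_mx g^T.
Proof. by move=> og; rewrite /orthogonal_mx trmxK orthogonal_mxC. Qed.

Lemma orthogonal1 : orthogonal_mx (1%:M : mat).
Proof. by rewrite /orthogonal_mx trmx1 mul1mx. Qed.

Lemma orthogonal_dot g a b : orthogonal_mx g -> dot (g *m a) (g *m b) = dot a b.
Proof. by move=> og; rewrite dot_mulmx mulmxA og mul1mx. Qed.

Lemma orthogonalK g a : orthogonal_mx g -> g^T *m (g *m a) = a.
Proof. by move=> og; rewrite mulmxA og mul1mx. Qed.

Lemma orthogonalKV g a : orthogonal_mx g -> g *m (g^T *m a) = a.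
Proof. by move=> og; rewrite mulmxA orthogonal_mxC ?mul1mx. Qed.

Lemma poissonE g r : orthogonal_mx g -> poisson r g = g^T *m ebasis R r.
Proof. by move=> og; rewrite /poisson orthogonal_inv. Qed.

Lemma dot_ebasis (r s : 'I_n.+1) : dot (ebasis R r) (ebasis R s) = (r == s)%:R.
Proof.
rewrite dotE (bigD1 r)//= big1 ?addr0 => [|i ir].
  by rewrite !mxE !eqxx ?andbT/= mulr1n mul1r.
by rewrite !mxE (negPf ir) mul0r.
Qed.

Lemma dot_poisson g r s : orthogonal_mx g ->
  dot (poisson r g) (poisson s g) = (r == s)%:R.
Proof.
by move=> og; rewrite !poissonE// orthogonal_dot ?dot_ebasis//; exact: orthogonalT.
Qed.

Lemma posdef_unit M : M^T = M -> (forall a, a != 0 -> dot a (M *m a) != 0) ->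
  M \in unitmx.
Proof.
move=> MT Mpos; rewrite -row_free_unit -kermx_eq0; apply/negPn/negP => /rowV0Pn[w].
move=> /sub_kermxP wM w0; have /Mpos/eqP : w^T != 0 by rewrite trmx_eq0.
by apply; rewrite -MT -trmx_mul wM trmx0 /dot mulmx0 mxE.
Qed.

(** The reflection exchanging the two unit vectors, in the hyperplane normal to [a - b]. The last
    clause lets one vector be moved while e_1 stays in place. *)
Lemma householder a b : dot a a = 1 -> dot b b = 1 ->
  exists Q, [/\ orthogonal_mx Q, Q *m a = b &
    forall c, dot a c = 0 -> dot b c = 0 -> Q *m c = c].
Proof.
move=> aa bb; have [->|ab] := eqVneq a b.
  by exists 1%:M; split=> [||c _ _]; rewrite ?mul1mx//; exact: orthogonal1.
pose w := a - b; have w0 : dot w w != 0.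
  by apply: contra ab => /eqP/dot_eq0/eqP; rewrite subr_eq0.
have wE : dot w w = 2 * dot w a.
  by rewrite /w !dotBl !dotBr aa bb (dotC b a); ring.
pose Q : mat := 1%:M - (2 / dot w w) *: (w *m w^T).
have QE c : Q *m c = c - (2 / dot w w * dot w c) *: w.
  rewrite mulmxBl mul1mx -scalemxAl -mulmxA dot_mx mul_mx_scalar scalerA.
  by [].
have QT : Q^T = Q.
  by rewrite /Q linearB/= trmx1 linearZ/= trmx_mul trmxK.
exists Q; split.
- have Qw : Q *m w = - w.
    by rewrite QE mulfVK// scaler_nat mulr2n opprD addNKr.
  rewrite /orthogonal_mx QT {2}/Q mulmxBr mulmx1 -scalemxAr mulmxA Qw.
  by rewrite mulNmx scalerN opprK /Q subrK.
- rewrite QE (_ : _ * dot w a = 1); first by rewrite scale1r /w opprB addrC subrK.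
  by rewrite wE; field; move: w0; rewrite wE mulf_eq0 negb_or => /andP[].
- move=> c ac bc; rewrite QE (_ : dot w c = 0) ?mulr0 ?scale0r ?subr0//.
  by rewrite /w dotBl ac bc subrr.
Qed.

End Euclidean.

(** * Elimination of the multipliers *)

Section Multipliers.
Variables (R : realType) (n : nat).
Local Notation mat := 'M[R]_n.+1.
Implicit Types (g N M : mat).

Lemma sum_ord_pairs_delta (F : 'I_n.+1 -> 'I_n.+1 -> R) (i j : 'I_n.+1) :
  \sum_(r < n.+1 | (0 < r)%N) \sum_(s < n.+1 | (r < s)%N)
    F r s * ((i == r) && (j == s))%:R =
  if ((0 < i) && (i < j))%N then F i j else 0.
Proof.
rewrite big_mkcond (bigD1 i)//= [X in _ + X]big1 ?addr0 => [|r ri]; last first.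
  case: ifP => // _; rewrite big1// => s _.
  by rewrite eq_sym (negPf ri) mulr0.
case: ifP => //= i0.
rewrite big_mkcond (bigD1 j)//= [X in _ + X]big1 ?addr0 => [|s sj]; last first.
  by rewrite [j == s]eq_sym (negPf sj) andbF mulr0 if_same.
by case: ifP => // _; rewrite !eqxx mulr1.
Qed.

Lemma antisym_diag M i : M^T = - M -> M i i = 0.
Proof. by move=> /matrixP/(_ i i); rewrite !mxE; lra. Qed.

Lemma mulmx_ebasis M (r i : 'I_n.+1) : (M *m ebasis R r) i 0 = M i r.
Proof.
rewrite mxE (bigD1 r)//= [X in _ + X]big1 ?addr0 => [|j jr].
  by rewrite mxE !eqxx mulr1.
by rewrite mxE (negPf jr) mulr0.
Qed.

Lemma multipliers_conj g (lam : 'I_n.+1 -> 'I_n.+1 -> R) : orthogonal_mx g ->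
  \sum_(r < n.+1 | (0 < r)%N) \sum_(s < n.+1 | (r < s)%N)
     lam r s *: wedge (poisson r g) (poisson s g) =
  g^T *m (\sum_(r < n.+1 | (0 < r)%N) \sum_(s < n.+1 | (r < s)%N)
     lam r s *: wedge (ebasis R r) (ebasis R s)) *m g.
Proof.
move=> og; rewrite mulmx_sumr mulmx_suml; apply: eq_bigr => r _.
rewrite mulmx_sumr mulmx_suml; apply: eq_bigr => s _.
by rewrite !poissonE// wedge_conj trmxK -scalemxAr -scalemxAl.
Qed.

(** Conjugation by [g] replaces the E_r by the standard basis, where the wedges of basis vectors
    other than e_1 span the antisymmetric matrices that kill e_1. *)
Lemma multipliersP g N : orthogonal_mx g ->
  (exists lam : 'I_n.+1 -> 'I_n.+1 -> R,
     N = \sum_(r < n.+1 | (0 < r)%N) \sum_(s < n.+1 | (r < s)%N)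
           lam r s *: wedge (poisson r g) (poisson s g)) <->
  N^T = - N /\ N *m poisson 0 g = 0.
Proof.
move=> og; split=> [[lam ->]|[NT Nq]].
  split.
    rewrite linear_sum/= -sumrN; apply: eq_bigr => r _.
    rewrite linear_sum/= -sumrN; apply: eq_bigr => s _.
    by rewrite linearZ/= wedge_tr scalerN.
  rewrite mulmx_suml big1// => r r0; rewrite mulmx_suml big1// => s rs.
  rewrite -scalemxAl wedge_mulmx !dot_poisson//.
  have -> : (s == 0) = false by apply/negbTE; rewrite -lt0n (leq_trans _ rs).
  by rewrite -[r == 0]negbK -lt0n r0 !scale0r subrr scaler0.
have [M [MT M0 NE]] : exists M, [/\ M^T = - M, M *m ebasis R 0 = 0 &
    N = g^T *m M *m g].
  exists (g *m N *m g^T); split.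
  - by rewrite !trmx_mul trmxK NT mulNmx mulmxN mulmxA.
  - by rewrite -mulmxA -poissonE// -mulmxA Nq mulmx0.
  - by rewrite !mulmxA og mul1mx -mulmxA og mulmx1.
have Mi0 i : M i 0 = 0.
  by rewrite -mulmx_ebasis M0 mxE.
have M0i i : M 0 i = 0.
  have /matrixP/(_ 0 i) := MT; rewrite !mxE Mi0 => /esym/eqP.
  by rewrite oppr_eq0 => /eqP.
(* The multipliers are the entries of the conjugated matrix; its row and column 0 vanish, so the sum
   over 0 < r < s recovers all of it. *)
exists M; rewrite multipliers_conj//.
have -> : \sum_(r < n.+1 | (0 < r)%N) \sum_(s < n.+1 | (r < s)%N)
    M r s *: wedge (ebasis R r) (ebasis R s) = M.
  apply/matrixP => i j; rewrite summxE.
  under eq_bigr => r _ do rewrite summxE.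
  have E r s : (M r s *: wedge (ebasis R r) (ebasis R s)) i j =
      M r s * ((i == r) && (j == s))%:R - M r s * ((j == r) && (i == s))%:R.
    rewrite !mxE mulrBr !big_ord_recl !big_ord0 !mxE !addr0.
    by rewrite !eqxx !andbT -!natrM !mulnb [(i == s) && _]andbC.
  under eq_bigr => r _ do under eq_bigr => s _ do rewrite E.
  under eq_bigr => r _ do rewrite sumrB.
  rewrite sumrB !sum_ord_pairs_delta.
  have Mji : M j i = - M i j.
    by have /matrixP/(_ i j) := MT; rewrite !mxE.
  have [ij|ji|/val_inj ->] := ltngtP i j; rewrite ?andbT ?andbF ?subr0 ?sub0r.
  - by case: (posnP i) => // i0; rewrite (_ : i = 0) ?M0i//; exact: val_inj.
  - case: (posnP j) => [j0|_]; last by rewrite Mji opprK.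
    by rewrite (_ : j = 0) ?Mi0 ?oppr0//; exact: val_inj.
  - by rewrite antisym_diag.
exact: NE.
Qed.

End Multipliers.

(** * Projection of solutions and recovery of the angular velocity *)

Section Reduction.
Variables (R : realType) (n : nat).
Local Notation vec := 'cV[R]_n.+1.
Local Notation mat := 'M[R]_n.+1.
Implicit Types (J g A B : mat) (q p : vec) (x : R -> mat * mat).

Definition velocity J q p : vec :=
  Cmx J q *m (p - (dot p (Cmx J q *m q) / dot q (Cmx J q *m q)) *: q).

Definition symposdef J := J^T = J /\ forall a : vec, a != 0 -> 0 < dot a (J *m a).

(** In this form, free of multipliers, the equation passes directly to conjugates by orthogonal
    matrices and to blocks. *)
Lemma veselova_D_solP J x : veselova_D_sol J x <->
  forall t, [/\ veselova_D (x t),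
    is_derive t (1 : R) (fun s => (x s).1) ((x t).1 *m (x t).2) &
    exists dI, is_derive t (1 : R) (fun s => inertia_op J (x s).2) dI /\
      let N := dI - (inertia_op J (x t).2 *m (x t).2 - (x t).2 *m inertia_op J (x t).2) in
      N^T = - N /\ N *m poisson 0 (x t).1 = 0].
Proof.
split=> H t; have [Dt gt] := H t; have [og _ _] := Dt.
  case=> lam lamE; split => //; eexists; split; first exact: lamE.
  by apply/(multipliersP _ og); exists lam; rewrite addrAC subrr add0r.
case=> dI [dIE]; cbv zeta => /(multipliersP _ og)[lam NE]; split => //; exists lam.
by rewrite -NE addrC subrK.
Qed.

Lemma inertia_tr J (Om : mat) : J^T = J -> Om^T = - Om ->
  (inertia_op J Om)^T = - inertia_op J Om.
Proof.
move=> JT OT; rewrite /inertia_op linearD/= !trmx_mul JT OT mulNmx mulmxN.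
by rewrite -opprD addrC.
Qed.

Lemma dot_antisym (M : mat) a : M^T = - M -> dot a (M *m a) = 0.
Proof.
move=> MT; have := dot_mulmx M a a; rewrite MT mulNmx dotNl dotC.
by rewrite dotC; lra.
Qed.

Section Metric.
Variables (J : mat) (Jpos : symposdef J).

Lemma metric_pos q a : q != 0 -> a != 0 ->
  0 < dot a ((J + (dot q (J *m q))%:M) *m a).
Proof.
move=> q0 a0; rewrite mulmxDl dotDr mul_scalar_mx dotZr.
by rewrite addr_gt0 ?mulr_gt0 ?Jpos.2 ?dot_gt0.
Qed.

Lemma metric_tr q : (J + (dot q (J *m q))%:M)^T = J + (dot q (J *m q))%:M.
Proof. by rewrite linearD/= tr_scalar_mx Jpos.1. Qed.

Lemma metric_unit q : q != 0 -> J + (dot q (J *m q))%:M \in unitmx.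
Proof.
move=> q0; apply: posdef_unit (metric_tr q) _ => a a0.
by rewrite gt_eqF// metric_pos.
Qed.

Lemma Cmx_tr q : (Cmx J q)^T = Cmx J q.
Proof. by rewrite /Cmx trmx_inv metric_tr. Qed.

Lemma Cmx_pos q a : q != 0 -> a != 0 -> 0 < dot a (Cmx J q *m a).
Proof.
move=> q0 a0; have Mu := metric_unit q0.
have Ca0 : Cmx J q *m a != 0.
  by apply: contra a0 => /eqP C0; rewrite -(mulKVmx Mu a) -/(Cmx J q) C0 mulmx0.
rewrite -{1}(mulKVmx Mu a) -/(Cmx J q) dotC; exact: metric_pos.
Qed.

Lemma velocity_tangent q p : q != 0 -> dot q (velocity J q p) = 0.
Proof.
move=> q0; rewrite /velocity mulmxBr dotBr -scalemxAr dotZr divfK.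
  by rewrite dot_mulmx Cmx_tr dotC subrr.
by rewrite gt_eqF// Cmx_pos.
Qed.

Lemma energyE q p : q != 0 -> 2 * energy J q p = dot p (velocity J q p).
Proof.
move=> q0; rewrite /energy /velocity mulmxBr dotBr -scalemxAr dotZr.
by field; rewrite gt_eqF// Cmx_pos.
Qed.

(** Inverts the Legendre transformation: p is (J + q.Jq) v up to a multiple of q, and q.v = 0
    determines that multiple. *)
Lemma velocityP q p v : dot q q = 1 -> dot q v = 0 -> dot q p = 0 ->
  p = - (inertia_op J (wedge q v) *m q) -> v = velocity J q p.
Proof.
move=> qq qv qp pE.
have q0 : q != 0.
  by apply/eqP => q0; move/eqP: qq; rewrite q0 /dot mulmx0 mxE eq_sym oner_eq0.
have Mu := metric_unit q0.
have Oq : wedge q v *m q = - v by rewrite wedge_mulmx dotC qv qq scale0r scale1r sub0r.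
have {}pE : p = (J + (dot q (J *m q))%:M) *m v - dot v (J *m q) *: q.
  rewrite pE /inertia_op mulmxDl -!mulmxA Oq wedge_mulmx mulmxN mulmxDl mul_scalar_mx.
  by rewrite opprD opprK opprB addrA.
have vE : v = Cmx J q *m (p + dot v (J *m q) *: q).
  by rewrite pE subrK mulKmx.
have qCq := Cmx_pos q0 q0.
rewrite vE /velocity; congr (_ *m (_ + _)); rewrite -scaleNr; congr (_ *: _).
move: qv; rewrite {1}vE mulmxDr dotDr -scalemxAr dotZr dot_mulmx Cmx_tr dotC => E.
apply: (mulIf (lt0r_neq0 qCq)); rewrite mulNr divfK ?gt_eqF//; lra.
Qed.

Section Solution.
Variables (x : R -> mat * mat) (solx : veselova_D_sol J x).
Let q t := (veselova_proj J (x t)).1.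
Let p t := (veselova_proj J (x t)).2.

Lemma D_orth t : orthogonal_mx (x t).1.
Proof. by have [[]] := solx t. Qed.

Lemma D_q t : q t = (x t).1^T *m ebasis R 0.
Proof. exact: poissonE (D_orth t). Qed.

Lemma D_q1 t : dot (q t) (q t) = 1.
Proof. by rewrite dot_poisson ?eqxx//; exact: D_orth. Qed.

Lemma D_q0 t : q t != 0.
Proof.
apply/eqP => q0; have /eqP := D_q1 t.
by rewrite q0 /dot mulmx0 mxE eq_sym oner_eq0.
Qed.

Lemma D_Om_tr t : (x t).2^T = - (x t).2.
Proof. by have [[]] := solx t. Qed.

Lemma D_qp t : dot (q t) (p t) = 0.
Proof.
rewrite /p /veselova_proj/= dotNr dot_antisym ?oppr0//.
exact: inertia_tr Jpos.1 (D_Om_tr t).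
Qed.

(** The vector v of the constraint is free up to multiples of q; [- (Om q)] is its component
    orthogonal to q. *)
Lemma D_Om_wedge t : (x t).2 = wedge (q t) (- ((x t).2 *m q t)).
Proof.
have [[_ _ [v vE]] _ _] := solx t; rewrite {2}vE wedge_mulmx.
rewrite -/(q t) D_q1 scale1r opprB wedgeBr wedgeZr wedge_self scaler0 subr0.
exact: vE.
Qed.

Lemma D_qOq t : dot (q t) (- ((x t).2 *m q t)) = 0.
Proof. by rewrite dotNr dot_antisym ?oppr0//; exact: D_Om_tr. Qed.

Lemma D_velocity t : - ((x t).2 *m q t) = velocity J (q t) (p t).
Proof.
apply: velocityP; [exact: D_q1|exact: D_qOq|exact: D_qp|].
by rewrite -D_Om_wedge.
Qed.

Lemma D_Om t : (x t).2 = wedge (q t) (velocity J (q t) (p t)).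
Proof. by rewrite -D_velocity -D_Om_wedge. Qed.

Lemma D_dq t : is_derive t (1 : R) q (velocity J (q t) (p t)).
Proof.
have [_ dg _] := solx t; rewrite -D_velocity.
have -> : is_derive t (1 : R) q = is_derive t (1 : R) (fun s => (x s).1^T *m ebasis R 0).
  by congr is_derive; apply/funext => s; exact: D_q.
apply: is_derive_eq; first exact: (is_derive_mulmxr (ebasis R 0) (is_derive_trmx dg)).
by rewrite trmx_mul -mulmxA -D_q D_Om_tr mulNmx.
Qed.

(** The reaction kills q, so only the commutator acts on it, and its term I Om q cancels against I
    q'. The outcome says that g p is at rest in space. *)
Lemma D_dp' t : is_derive t (1 : R) p (- ((x t).2 *m p t)).
Proof.
have /veselova_D_solP/(_ t)[_ _ [dI [dIE [NT Nq]]]] := solx.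
apply: is_derive_eq.
  exact: (is_derive1N (is_derive_mulmx dIE (D_dq t))).
move: Nq; rewrite mulmxBl -/(q t) => /eqP; rewrite subr_eq0 => /eqP ->.
rewrite -D_velocity mulmxBl mulmxN !mulmxA addrAC subrr sub0r.
by rewrite opprK /p /veselova_proj /poisson/= mulmxN opprK !mulmxA.
Qed.

Lemma D_dp t : is_derive t (1 : R) p (- (2 * energy J (q t) (p t)) *: q t).
Proof.
have := D_dp' t; rewrite energyE ?D_q0//; congr is_derive.
rewrite {1}D_Om wedge_mulmx (dotC (q t)) (dotC (p t) (q t)) D_qp.
by rewrite scale0r subr0 scaleNr dotC.
Qed.

Lemma D_proj_sol : veselova_T_sol J (fun t => veselova_proj J (x t)).
Proof.
move=> t; split; [by split; [exact: D_q1|exact: D_qp]|exact: D_dq|exact: D_dp].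
Qed.

Lemma D_momentum s t : (x s).1 *m p s = (x t).1 *m p t.
Proof.
apply: (@is_derive0_mx_cst _ _ _ (fun t => (x t).1 *m p t)) => {s}t.
have [_ dg _] := solx t.
apply: is_derive_eq; first exact: (is_derive_mulmx dg (D_dp' t)).
have H a : (x t).1 *m (x t).2 *m a + (x t).1 *m - ((x t).2 *m a) = 0.
  by rewrite mulmxN mulmxA subrr.
exact: H.
Qed.

End Solution.

(* The rows of [g] other than q form a parallel frame along q(t). *)
Lemma D_same_projection x x' : veselova_D_sol J x -> veselova_D_sol J x' ->
  (forall t, veselova_proj J (x' t) = veselova_proj J (x t)) ->
  (forall t, (x' t).2 = (x t).2) /\
  exists A, [/\ orthogonal_mx A, A *m ebasis R 0 = ebasis R 0 &
    forall t, (x' t).1 = A *m (x t).1].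
Proof.
move=> sol sol' E.
have OmE t : (x' t).2 = (x t).2 by rewrite (D_Om sol) (D_Om sol') E.
split=> //; exists ((x' 0).1 *m (x 0).1^T).
have o := D_orth sol; have o' := D_orth sol'.
have C t : (x' t).1 *m (x t).1^T = (x' 0).1 *m (x 0).1^T.
  apply: (@is_derive0_mx_cst _ _ _ (fun t => (x' t).1 *m (x t).1^T)) => {}t.
  have [_ dg _] := sol t; have [_ dg' _] := sol' t.
  apply: is_derive_eq; first exact: (is_derive_mulmx dg' (is_derive_trmx dg)).
  by rewrite trmx_mul (D_Om_tr sol) OmE mulNmx mulmxN mulmxA subrr.
split.
- by apply: orthogonalM => //; exact: orthogonalT.
- rewrite -mulmxA -(D_q sol) -E (D_q sol') orthogonalKV//.
- by move=> t; rewrite -(C t) -mulmxA o mulmx1.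
Qed.

End Metric.
End Reduction.

(** * Changes of orthonormal bases and time shifts *)

Section Conjugation.
Variables (R : realType) (n : nat).
Local Notation vec := 'cV[R]_n.+1.
Local Notation mat := 'M[R]_n.+1.
Implicit Types (J g A B M : mat) (q p : vec).

Lemma inertia_op_conj J B M : orthogonal_mx B ->
  inertia_op (B *m J *m B^T) (B *m M *m B^T) = B *m inertia_op J M *m B^T.
Proof.
move=> oB; rewrite /inertia_op mulmxDr mulmxDl; congr (_ + _).
  by rewrite !mulmxA -[B *m J *m B^T *m B]mulmxA oB mulmx1.
by rewrite !mulmxA -[B *m M *m B^T *m B]mulmxA oB mulmx1.
Qed.

Lemma invmx_uniq M A : A *m M = 1%:M -> invmx M = A.
Proof. by move=> AM; have [_ Mu] := mulmx1_unit AM; rewrite -[LHS]mul1mx -AM mulmxK. Qed.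

Section Fixed.
Variables (J : mat) (Jpos : symposdef J) (B : mat) (oB : orthogonal_mx B).

Lemma symposdef_conj : symposdef (B *m J *m B^T).
Proof.
split; first by rewrite !trmx_mul trmxK Jpos.1 mulmxA.
move=> a a0; rewrite -!mulmxA dot_mulmx; apply: Jpos.2.
by apply: contra a0 => /eqP E; rewrite -(orthogonalKV a oB) E mulmx0.
Qed.

Lemma Cmx_conj q : q != 0 -> Cmx (B *m J *m B^T) (B *m q) = B *m Cmx J q *m B^T.
Proof.
move=> q0; rewrite /Cmx.
have -> : dot (B *m q) (B *m J *m B^T *m (B *m q)) = dot q (J *m q).
  by rewrite -!mulmxA orthogonalK// orthogonal_dot.
have Mu := metric_unit Jpos q0; set k := dot q _ in Mu *.
apply: invmx_uniq.
have -> : B *m J *m B^T + k%:M = B *m (J + k%:M) *m B^T.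
  rewrite mulmxDr mulmxDl; congr (_ + _).
  by rewrite scalar_mxC -mulmxA orthogonal_mxC// mulmx1.
rewrite !mulmxA -[_ *m B^T *m B]mulmxA oB mulmx1 -[_ *m (J + _)]mulmxA mulVmx//.
by rewrite mulmx1 orthogonal_mxC.
Qed.

Let conjK M (a : vec) : B *m M *m B^T *m (B *m a) = B *m (M *m a).
Proof. by rewrite -!mulmxA orthogonalK. Qed.

Lemma velocity_conj q p : q != 0 ->
  velocity (B *m J *m B^T) (B *m q) (B *m p) = B *m velocity J q p.
Proof.
move=> q0; rewrite /velocity Cmx_conj// !conjK// !orthogonal_dot//.
by rewrite scalemxAr -mulmxBr conjK.
Qed.

Lemma energy_conj q p : q != 0 ->
  energy (B *m J *m B^T) (B *m q) (B *m p) = energy J q p.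
Proof. by move=> q0; rewrite /energy Cmx_conj// !conjK// !orthogonal_dot. Qed.

Lemma T_sol_conj (y : R -> vec * vec) : veselova_T_sol J y ->
  veselova_T_sol (B *m J *m B^T) (fun t => (B *m (y t).1, B *m (y t).2)).
Proof.
move=> soly t; have [[qq qp] dq dp] := soly t.
have q0 : (y t).1 != 0.
  by apply/eqP => q0; move/eqP: qq; rewrite q0 /dot mulmx0 mxE eq_sym oner_eq0.
split=> /=; first by split=> /=; rewrite orthogonal_dot.
  rewrite -/(velocity _ _ _) velocity_conj//; exact: is_derive_mulmxl dq.
rewrite energy_conj// scalemxAr; exact: is_derive_mulmxl dp.
Qed.

Lemma poisson_conj A g : orthogonal_mx A -> orthogonal_mx g ->
  A *m ebasis R 0 = ebasis R 0 -> poisson 0 (A *m g *m B^T) = B *m poisson 0 g.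
Proof.
move=> oA og A0; rewrite !poissonE//; last first.
  by apply: orthogonalM; [exact: orthogonalM|exact: orthogonalT].
by rewrite !trmx_mul trmxK -!mulmxA -{1}A0 orthogonalK.
Qed.

(** Conjugation by [B] carries an antisymmetric matrix that kills q to one that kills B q, so the
    reaction stays admissible. [A] has to fix e_1, which enters the constraint. *)
Lemma D_sol_conj A (x : R -> mat * mat) : orthogonal_mx A ->
  A *m ebasis R 0 = ebasis R 0 -> veselova_D_sol J x ->
  veselova_D_sol (B *m J *m B^T)
    (fun t => (A *m (x t).1 *m B^T, B *m (x t).2 *m B^T)).
Proof.
move=> oA A0 /veselova_D_solP sol; apply/veselova_D_solP => t.
have [[og OT [v vE]] dg [dI [dIE]]] := sol t; cbv zeta => -[NT Nq].
split.
- split=> /=.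
  + by apply: orthogonalM; [exact: orthogonalM|exact: orthogonalT].
  + by rewrite !trmx_mul trmxK OT mulNmx mulmxN mulmxA.
  + by exists (B *m v); rewrite poisson_conj// wedge_conj -vE.
- apply: is_derive_eq; first exact: (is_derive_mulmxr B^T (is_derive_mulmxl A dg)).
  by rewrite /= !mulmxA -[_ *m B^T *m B]mulmxA oB mulmx1.
- exists (B *m dI *m B^T); split.
    under eq_fun do rewrite inertia_op_conj//.
    exact: (is_derive_mulmxr B^T (is_derive_mulmxl B dIE)).
  rewrite /= inertia_op_conj//; set I := inertia_op _ _ in NT Nq *.
  have -> : B *m dI *m B^T - (B *m I *m B^T *m (B *m (x t).2 *m B^T) -
      B *m (x t).2 *m B^T *m (B *m I *m B^T)) =
      B *m (dI - (I *m (x t).2 - (x t).2 *m I)) *m B^T.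
    rewrite !mulmxA -![_ *m B^T *m B]mulmxA oB !mulmx1.
    by rewrite !mulmxBr !mulmxBl !mulmxA.
  split; first by rewrite !trmx_mul trmxK NT mulNmx mulmxN mulmxA.
  by rewrite poisson_conj// conjK Nq mulmx0.
Qed.

Lemma veselova_proj_conj A (z : mat * mat) : orthogonal_mx A ->
  A *m ebasis R 0 = ebasis R 0 -> orthogonal_mx z.1 ->
  veselova_proj (B *m J *m B^T) (A *m z.1 *m B^T, B *m z.2 *m B^T) =
  (B *m (veselova_proj J z).1, B *m (veselova_proj J z).2).
Proof.
move=> oA A0 og; rewrite /veselova_proj/= poisson_conj// inertia_op_conj//.
by rewrite conjK mulmxN.
Qed.

End Fixed.

Lemma T_sol_shift J (y : R -> vec * vec) tau : veselova_T_sol J y ->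
  veselova_T_sol J (fun t => y (t + tau)).
Proof.
move=> sol t; have [yt dq dp] := sol (t + tau).
by split; [exact: yt|exact: is_derive_shiftr|exact: is_derive_shiftr].
Qed.

Lemma D_sol_shift J (x : R -> mat * mat) tau : veselova_D_sol J x ->
  veselova_D_sol J (fun t => x (t + tau)).
Proof.
move=> sol t; have [xt dg [lam dI]] := sol (t + tau).
by split; [exact: xt|exact: is_derive_shiftr|exists lam; exact: is_derive_shiftr].
Qed.

End Conjugation.

(** * The cylindrical top on the cotangent bundle of the sphere *)

Section Halves.
Variable R : realType.
Implicit Types (a b v w : 'cV[R]_4) (c : bool).

(** The boolean index lets both planes share one argument; [false] is the half on which J is J_1. *)
Definition part c (v : 'cV[R]_4) : 'cV[R]_2 := if c then snd2 v else fst2 v.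

Lemma part_block c (A D : 'M[R]_2) v :
  part c ((block_mx A 0 0 D : 'M[R]_4) *m v) = (if c then D else A) *m part c v.
Proof.
rewrite -[v in LHS](@vsubmxK _ 2 2 1) /part /fst2 /snd2.
rewrite (@mul_block_col _ 2 2 2 2 1).
by rewrite !mul0mx addr0 add0r (@col_mxKu _ 2 2) (@col_mxKd _ 2 2); case: c.
Qed.

Lemma part_inj v w : (forall c, part c v = part c w) -> v = w.
Proof.
move=> H; have := H false; have := H true; rewrite /part /fst2 /snd2 => H2 H1.
by rewrite -[v](@vsubmxK _ 2 2 1) H1 H2 vsubmxK.
Qed.

Lemma part_col c (a b : 'cV[R]_2) :
  part c (col_mx a b : 'cV[R]_4) = if c then b else a.
Proof. by rewrite /part /fst2 /snd2 (@col_mxKu _ 2 2) (@col_mxKd _ 2 2). Qed.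

Lemma partD c v w : part c (v + w) = part c v + part c w.
Proof. by case: c; rewrite /part /fst2 /snd2 linearD. Qed.

Lemma partN c v : part c (- v) = - part c v.
Proof. by case: c; rewrite /part /fst2 /snd2 linearN. Qed.

Lemma partZ c (k : R) v : part c (k *: v) = k *: part c v.
Proof. by case: c; rewrite /part /fst2 /snd2 linearZ. Qed.

Lemma part0 c : part c 0 = 0.
Proof. by case: c; rewrite /part /fst2 /snd2 linear0. Qed.

Lemma dot_part v w : dot v w = dot (part false v) (part false w) +
  dot (part true v) (part true w).
Proof.
rewrite !dotE [LHS](@big_split_ord _ _ _ 2 2) /part /fst2 /snd2 /=.
by congr (_ + _); apply: eq_bigr => i _; rewrite !mxE.
Qed.

Lemma dot2E (a b : 'cV[R]_2) : dot a b = a 0 0 * b 0 0 + a 1 0 * b 1 0.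
Proof. by rewrite dotE sum2E. Qed.

Lemma col2P (a b : 'cV[R]_2) : a 0 0 = b 0 0 -> a 1 0 = b 1 0 -> a = b.
Proof.
by move=> E0 E1; apply/matrixP => i j; rewrite ord1; move: i; apply: ord2P.
Qed.

Definition cross (a b : 'cV[R]_2) : R := a 0 0 * b 1 0 - a 1 0 * b 0 0.

Lemma free2 (a b : 'cV[R]_2) : free [:: a; b] = (cross a b != 0).
Proof.
rewrite free_cons span_seq1 seq1_free; have [->|b0] := eqVneq b 0.
  by rewrite andbF /cross !mxE !mulr0 subrr eqxx.
rewrite andbT; congr negb; apply/vlineP/eqP => [[k ->]|ab].
  by rewrite /cross !mxE; ring.
have bb : dot b b != 0 by rewrite gt_eqF// dot_gt0.
exists (dot a b / dot b b); move: ab bb; rewrite /cross !dot2E => ab bb.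
apply: col2P; rewrite !mxE; apply: (mulIf bb); rewrite mulrAC divfK//.
  transitivity (a 0 0 * (b 0 0 * b 0 0 + b 1 0 * b 1 0) - (a 0 0 * b 1 0 - a 1 0 * b 0 0) * b 1 0).
    by rewrite ab; ring.
  ring.
transitivity (a 1 0 * (b 0 0 * b 0 0 + b 1 0 * b 1 0) + (a 0 0 * b 1 0 - a 1 0 * b 0 0) * b 0 0).
  by rewrite ab; ring.
ring.
Qed.

End Halves.

(** * Decoupling of the two planes *)

Section Cylinder.
Variables (R : realType) (J1 J2 : R).
Hypotheses (J1_gt0 : 0 < J1) (J2_gt0 : 0 < J2).
Local Notation J := (cyl_mass J1 J2).
Local Notation phase := ('cV[R]_4 * 'cV[R]_4)%type.
Implicit Types (z : phase) (c : bool).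

(** [gap] plays the part of d in [planar], and [den] below that of D; on the unit sphere [den c] is
    the reciprocal of the eigenvalue of C on that half. *)
Definition gap (c : bool) : R := if c then J2 - J1 else J1 - J2.
Definition qsq c z : R := part c z.1 0 0 ^+ 2 + part c z.1 1 0 ^+ 2.
Definition psq c z : R := part c z.2 0 0 ^+ 2 + part c z.2 1 0 ^+ 2.
Definition qdotp c z : R := part c z.1 0 0 * part c z.2 0 0 + part c z.1 1 0 * part c z.2 1 0.
Definition area c z : R := part c z.1 0 0 * part c z.2 1 0 - part c z.1 1 0 * part c z.2 0 0.
Definition den c z : R := J1 + J2 + gap c * qsq c z.
Definition integral_area c z : R := area c z ^+ 2 / den c z.

Lemma cyl_symposdef : symposdef J.
Proof.
split=> [|a a0].
  by rewrite /cyl_mass (@tr_block_mx _ 2 2 2 2) !tr_scalar_mx !trmx0.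
rewrite dot_part !part_block !mul_scalar_mx !dotZr.
have := dot_gt0 a0; rewrite dot_part.
have := dot_ge0 (part false a); have := dot_ge0 (part true a).
move: (dot (part false a) _) (dot (part true a) _) => r s s0 r0 rs.
have [r1|r1] := ltP 0 r; first by rewrite ltr_pwDl// ?mulr_gt0// mulr_ge0// ltW.
have s1 : 0 < s by lra.
by rewrite ltr_wpDl// ?mulr_gt0// mulr_ge0// ltW.
Qed.

Lemma qsq_dot c z : dot (part c z.1) (part c z.1) = qsq c z.
Proof. by rewrite dot2E /qsq !expr2. Qed.

Lemma psq_dot c z : dot (part c z.2) (part c z.2) = psq c z.
Proof. by rewrite dot2E /psq !expr2. Qed.

Lemma qdotp_dot c z : dot (part c z.1) (part c z.2) = qdotp c z.
Proof. by rewrite dot2E. Qed.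

Lemma cotangentP z : cotangent_sphere z <->
  qsq false z + qsq true z = 1 /\ qdotp false z + qdotp true z = 0.
Proof. by rewrite /cotangent_sphere/= !dot_part !qsq_dot !qdotp_dot. Qed.

Lemma qsq_ge0 c z : 0 <= qsq c z.
Proof. by rewrite addr_ge0// sqr_ge0. Qed.

Lemma lagrange_identity c z : qdotp c z ^+ 2 + area c z ^+ 2 = qsq c z * psq c z.
Proof. by rewrite /qdotp /area /qsq /psq; ring. Qed.

(** On the unit sphere [den c] is q.Jq plus the eigenvalue of J on the half [c]. *)
Lemma den_gt0 c z : cotangent_sphere z -> 0 < den c z.
Proof.
move=> /cotangentP[s1 _]; have := qsq_ge0 false z; have := qsq_ge0 true z.
move: s1; rewrite /den /gap; case: c.
  move: (qsq false z) (qsq true z) => f s fs s0 f0.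
  have -> : J1 + J2 + (J2 - J1) * s = J1 * f + J2 * s + J2.
    by rewrite (_ : f = 1 - s); [ring|lra].
  by rewrite ltr_wpDl// addr_ge0// mulr_ge0// ltW.
move: (qsq false z) (qsq true z) => f s fs s0 f0.
have -> : J1 + J2 + (J1 - J2) * f = J1 * f + J2 * s + J1.
  by rewrite (_ : s = 1 - f); [ring|lra].
by rewrite ltr_wpDl// addr_ge0// mulr_ge0// ltW.
Qed.

Lemma cyl_Cmx z : cotangent_sphere z -> Cmx J z.1 =
  block_mx ((den false z)^-1%:M : 'M[R]_2) 0 0 ((den true z)^-1%:M : 'M[R]_2).
Proof.
move=> Mz; have D1 := den_gt0 false Mz; have D2 := den_gt0 true Mz.
move/cotangentP : Mz => [s1 _]; rewrite /Cmx.
have -> : dot z.1 (J *m z.1) = J1 * qsq false z + J2 * qsq true z.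
  by rewrite dot_part !part_block !mul_scalar_mx !dotZr !qsq_dot.
apply: invmx_uniq; rewrite /cyl_mass (@scalar_mx_block _ 2 2).
rewrite (@add_block_mx _ 2 2 2 2) !addr0 -!raddfD/=.
rewrite [LHS](@mulmx_block _ 2 2 2 2 2 2) !mul0mx !mulmx0 !addr0 !add0r.
rewrite -!scalar_mxM (_ : _ * _ = 1); last first.
  have -> : J1 + (J1 * qsq false z + J2 * qsq true z) = den false z.
    by rewrite /den/=; rewrite (_ : qsq true z = 1 - qsq false z); [ring|lra].
  by rewrite mulVf ?gt_eqF.
rewrite (_ : _ * _ = 1); last first.
  have -> : J2 + (J1 * qsq false z + J2 * qsq true z) = den true z.
    by rewrite /den/=; rewrite (_ : qsq false z = 1 - qsq true z); [ring|lra].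
  by rewrite mulVf ?gt_eqF.
by rewrite -scalar_mx_block.
Qed.

(** By q.Cq = S c_1 c_2 and q_2.p_2 = - q_1.p_1 the coefficient of q in [velocity] is - d_j
    (q_j.p_j) / S for either j. This is what removes the other half from the equation. *)
Lemma part_velocity c z : cotangent_sphere z ->
  part c (velocity J z.1 z.2) = (J1 + J2)^-1 *:
    \col_i (part c z.2 i 0 + gap c * area c z / den c z *
      (if i == 0 then part c z.1 1 0 else - part c z.1 0 0)).
Proof.
move=> Mz; have D0 c' : den c' z != 0 by rewrite gt_eqF// den_gt0.
have S0 : J1 + J2 != 0 by rewrite gt_eqF// addr_gt0.
rewrite /velocity cyl_Cmx//; have [s1 r1] := (cotangentP z).1 Mz.
have Edot w : dot w (block_mx ((den false z)^-1%:M : 'M[R]_2) 0 0 ((den true z)^-1%:M : 'M[R]_2) *m z.1)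
   = dot (part false z.1) (part false w) / den false z + dot (part true z.1) (part true w) / den true z.
  rewrite dot_part !part_block !mul_scalar_mx !dotZr.
  by rewrite (dotC (part false w)) (dotC (part true w)) ![_^-1 * _]mulrC.
rewrite !Edot !qsq_dot !qdotp_dot part_block partD partN partZ.
have E1 : qdotp true z = - qdotp false z by lra.
have E2 : qsq false z / den false z + qsq true z / den true z =
    (J1 + J2) / (den false z * den true z).
  have -> : J1 + J2 = qsq false z * den true z + qsq true z * den false z.
    rewrite /den/=; rewrite (_ : qsq true z = 1 - qsq false z); [ring|lra].
  by field; rewrite !D0.
rewrite E2 E1.
have -> : (qdotp false z / den false z + - qdotp false z / den true z) /
   ((J1 + J2) / (den false z * den true z)) = - (J1 - J2) * qdotp false z / (J1 + J2).
  have -> : J1 - J2 = den false z - den true z.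
    by rewrite /den/=; rewrite (_ : qsq true z = 1 - qsq false z); [ring|lra].
  by field; rewrite !D0 S0.
have -> : - (J1 - J2) * qdotp false z = - (gap c * qdotp c z).
  by case: c; rewrite /gap ?E1; ring.
have -> : (if c then (den true z)^-1%:M else (den false z)^-1%:M) =
    (den c z)^-1%:M :> 'M[R]_2 by case: c.
have := D0 c; rewrite mul_scalar_mx /den /area /qdotp /qsq.
move: (part c z.1) (part c z.2) => q p d0.
by apply: col2P; rewrite !mxE/=; field; rewrite d0 S0.
Qed.

Lemma cyl_energy z : cotangent_sphere z ->
  2 * energy J z.1 z.2 = \sum_c (psq c z - gap c * integral_area c z) / (J1 + J2).
Proof.
move=> Mz; have q0 : z.1 != 0.
  apply/eqP => q0; have [/eqP] := Mz.
  by rewrite q0 /dot mulmx0 mxE eq_sym oner_eq0.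
rewrite energyE//; last exact: cyl_symposdef.
have S0 : J1 + J2 != 0 by rewrite gt_eqF// addr_gt0.
have H c : dot (part c z.2) (part c (velocity J z.1 z.2)) =
    (psq c z - gap c * integral_area c z) / (J1 + J2).
  rewrite part_velocity// dotZr /integral_area; have := den_gt0 c Mz.
  rewrite /psq /area; move: (den c z) (part c z.1) (part c z.2) => D q p D0.
  by rewrite dot2E !mxE/=; field; rewrite S0 gt_eqF.
by rewrite dot_part !H big_bool/= addrC.
Qed.

Section Motion.
Variables (y : R -> phase) (soly : veselova_T_sol J y).

Lemma T_cotangent t : cotangent_sphere (y t). Proof. by have [] := soly t. Qed.

Lemma T_qsq t : qsq false (y t) + qsq true (y t) = 1.
Proof. exact: ((cotangentP _).1 (T_cotangent t)).1. Qed.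

Lemma T_qdotp t : qdotp true (y t) = - qdotp false (y t).
Proof. by have := ((cotangentP _).1 (T_cotangent t)).2; lra. Qed.

Lemma is_derive_part c (f : R -> 'cV[R]_4) (t : R) df i :
  is_derive t (1 : R) f df ->
  is_derive t (1 : R) (fun s => part c (f s) i 0) (part c df i 0).
Proof.
move=> /is_derive_mxP H; rewrite /part /fst2 /snd2; case: c.
  by under eq_fun do rewrite mxE; rewrite mxE; exact: H.
by under eq_fun do rewrite mxE; rewrite mxE; exact: H.
Qed.

Lemma T_planar c : planar (J1 + J2) (gap c)
  (fun t => 2 * energy J (y t).1 (y t).2)
  (fun t => part c (y t).1 0 0) (fun t => part c (y t).1 1 0)
  (fun t => part c (y t).2 0 0) (fun t => part c (y t).2 1 0).
Proof.
move=> t l D; have [Mt dq dp] := soly t.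
have V := part_velocity c Mt.
split.
- exact: den_gt0.
- apply: is_derive1_eq (is_derive_part c 0 dq) _.
  by rewrite -/(velocity _ _ _) V mxE mulrC !mxE/=.
- apply: is_derive1_eq (is_derive_part c 1 dq) _.
  by rewrite -/(velocity _ _ _) V mxE mulrC !mxE/= mulrN.
- apply: is_derive1_eq (is_derive_part c 0 dp) _.
  by rewrite partZ mxE mulNr.
- apply: is_derive1_eq (is_derive_part c 1 dp) _.
  by rewrite partZ mxE mulNr.
Qed.

Let S_gt0 : 0 < J1 + J2. Proof. exact: addr_gt0. Qed.

Lemma T_integral_area c s t : integral_area c (y s) = integral_area c (y t).
Proof. exact: (planar_area S_gt0 (T_planar c)). Qed.

Lemma T_momentum s t : dot (y s).2 (y s).2 = dot (y t).2 (y t).2.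
Proof.
rewrite !(dot_part _.2) !psq_dot.
apply: (@is_derive0_cst _ (fun t => psq false (y t) + psq true (y t))) => {s}t.
apply: is_derive1_eq.
  exact: (is_derive1D (planar_norm_p (T_planar false) t)
                      (planar_norm_p (T_planar true) t)).
rewrite -mulrDr -[RHS](mulr0 (-2 * (2 * energy J (y t).1 (y t).2))); congr (_ * _).
exact: ((cotangentP _).1 (T_cotangent t)).2.
Qed.

Lemma T_energy s t : energy J (y s).1 (y s).2 = energy J (y t).1 (y t).2.
Proof.
suff : 2 * energy J (y s).1 (y s).2 = 2 * energy J (y t).1 (y t).2 by lra.
rewrite !cyl_energy; [|exact: T_cotangent..].
have := T_momentum s t; rewrite !dot_part !psq_dot => P.
rewrite !big_bool/= -!mulrDl; congr (_ / _).
rewrite !(T_integral_area _ s t); lra.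
Qed.

(** For r = p - mu q, with Cr orthogonal to q, twice the energy is r.Cr. If r = 0 then p is a
    multiple of q, hence zero since q.p = 0. *)
Lemma T_energy_gt0 t : (y t).2 != 0 -> 0 < 2 * energy J (y t).1 (y t).2.
Proof.
have [q1 qp] := T_cotangent t; move: (y t).1 (y t).2 q1 qp => q p q1 qp p0.
have q0 : q != 0.
  by apply/eqP => q0; move/eqP: q1; rewrite q0 /dot mulmx0 mxE eq_sym oner_eq0.
rewrite (energyE cyl_symposdef)//.
have := velocity_tangent cyl_symposdef p q0; rewrite /velocity.
set mu := (_ / _) => qv.
have -> : p = (p - mu *: q) + mu *: q by rewrite subrK.
rewrite addrK dotDl dotZl qv mulr0 addr0; apply: Cmx_pos cyl_symposdef _ _ q0 _.
apply: contra p0 => /eqP/eqP; rewrite subr_eq0 => /eqP pE.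
move: qp; rewrite pE dotZr q1 mulr1 => ->; by rewrite scale0r.
Qed.

End Motion.
End Cylinder.

(** * Period and return times of an oscillation *)

Section OscillatorPhase.
Variables (R : realType) (w u0 v0 : R) (u v : R -> R).
Hypotheses (w_neq0 : w != 0)
  (uE : forall t, u t = cos (w * t) * u0 + sin (w * t) * v0)
  (vE : forall t, v t = cos (w * t) * v0 - sin (w * t) * u0).

Let shift (k : int) t : cos (w * (t + k%:~R * (2 * pi / `|w|))) = cos (w * t) /\
  sin (w * (t + k%:~R * (2 * pi / `|w|))) = sin (w * t).
Proof.
have [j ->] : exists j : int, w * (t + k%:~R * (2 * pi / `|w|)) = w * t + 2 * pi * j%:~R.
  have [w0|w0] := ltP 0 w.
    by exists k; rewrite gtr0_norm//; move: pi => p; field.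
  by exists (- k); rewrite ler0_norm// mulrNz; move: pi => p; field.
have [cj sj] := @cos_sin_turns R j.
by rewrite cosD sinD cj sj !mulr0 !mulr1 subr0 addr0.
Qed.

Lemma oscillator_period t :
  u (t + 2 * pi / `|w|) = u t /\ v (t + 2 * pi / `|w|) = v t.
Proof. by have := shift 1 t; rewrite mul1r !uE !vE => -[-> ->]. Qed.

Lemma oscillator_phase t t' : ~ (u0 = 0 /\ v0 = 0) -> u t' = u t -> v t' = v t ->
  exists k : int, t' = t + k%:~R * (2 * pi / `|w|).
Proof.
move=> uv0; rewrite !uE !vE => E1 E2.
have n0 : u0 ^+ 2 + v0 ^+ 2 != 0.
  rewrite paddr_eq0 ?sqr_ge0// !sqrf_eq0; apply/negP => /andP[/eqP ? /eqP ?].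
  exact: uv0.
have cE : cos (w * t') = cos (w * t).
  apply: (mulIf n0).
  transitivity ((cos (w * t') * u0 + sin (w * t') * v0) * u0 +
    (cos (w * t') * v0 - sin (w * t') * u0) * v0); first ring.
  by rewrite E1 E2; ring.
have sE : sin (w * t') = sin (w * t).
  apply: (mulIf n0).
  transitivity ((cos (w * t') * u0 + sin (w * t') * v0) * v0 -
    (cos (w * t') * v0 - sin (w * t') * u0) * u0); first ring.
  by rewrite E1 E2; ring.
have pi0 := @pi_gt0 R.
have : cos (2 * pi * (w * (t' - t) / (2 * pi))) = 1.
  rewrite [2 * pi * _]mulrC divfK ?mulf_neq0 ?gt_eqF//.
  by rewrite mulrBr cosB cE sE -!expr2 cos2Dsin2.
move=> /cos_eq1_turns/intrP[k kE].
have {}kE : w * (t' - t) = k%:~R * (2 * pi).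
  by rewrite -kE divfK// mulf_neq0// gt_eqF.
have tE : t' = t + k%:~R * (2 * pi) / w.
  by rewrite -kE; field.
(* The period is counted with the absolute value of [w], so a negative frequency reverses the sign
   of the number of turns. *)
have [w1|w1] := ltP 0 w.
  by exists k; rewrite gtr0_norm// mulrA.
exists (- k); rewrite ler0_norm// mulrNz tE; move: pi => p.
by field; rewrite ?oppr_eq0 ?w_neq0.
Qed.

End OscillatorPhase.

(** * Periods and monodromy of the reduced motion *)

Section ReducedMotion.
Variables (R : realType) (J1 J2 : R).
Hypotheses (J1_gt0 : 0 < J1) (J2_gt0 : 0 < J2).
Local Notation J := (cyl_mass J1 J2).
Local Notation phase := ('cV[R]_4 * 'cV[R]_4)%type.
Implicit Types (z : phase) (c : bool).

(** The identity component of [GR], a 2-torus; the monodromy of the reduced motion is found in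
    it. *)
Definition turn (a b : R) : 'M[R]_4 := block_mx (rot2 a) 0 0 (rot2 b).
Definition turn_T (a b : R) (z : phase) : phase := (turn a b *m z.1, turn a b *m z.2).

Lemma part_turn c a b v : part c (turn a b *m v) = rot2 (if c then b else a) *m part c v.
Proof. by rewrite part_block; case: c. Qed.

Lemma phaseP z z' : (forall c, part c z.1 = part c z'.1) ->
  (forall c, part c z.2 = part c z'.2) -> z = z'.
Proof.
by case: z z' => [q p] [q' p'] /= H1 H2; congr (_, _); exact: part_inj.
Qed.

Lemma turn_invariants a b c z :
  [/\ qsq c (turn_T a b z) = qsq c z, qdotp c (turn_T a b z) = qdotp c z &
      psq c (turn_T a b z) = psq c z].
Proof.
rewrite -!qsq_dot -!qdotp_dot -!psq_dot !part_turn.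
have o := rot2_orthogonal (if c then b else a).
by rewrite !dot_mulmx !mulmxA o !mul1mx.
Qed.

Variables (y : R -> phase) (soly : veselova_T_sol J y).

Let S_gt0 : 0 < J1 + J2. Proof. exact: addr_gt0. Qed.

Lemma area_const0 c t0 t : area c (y t0) = 0 -> area c (y t) = 0.
Proof. exact: (planar_area0 S_gt0 (T_planar J1_gt0 J2_gt0 soly c) t). Qed.

Lemma area_const_neq0 c t0 t : area c (y t0) != 0 -> area c (y t) != 0.
Proof. by apply: contra => /eqP/(area_const0 t0) ->. Qed.

Lemma area_neq0_momentum c z : area c z != 0 -> z.2 != 0.
Proof. by apply: contra => /eqP z2; rewrite /area z2 part0 !mxE !mulr0 subrr. Qed.

Lemma part_floquet c T : (forall t, area c (y t) != 0) ->
  (forall t, qsq c (y (t + T)) = qsq c (y t)) ->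
  (forall t, qdotp c (y (t + T)) = qdotp c (y t)) ->
  exists a, forall t, part c (y (t + T)).1 = rot2 a *m part c (y t).1 /\
                      part c (y (t + T)).2 = rot2 a *m part c (y t).2.
Proof.
move=> l0 sT rT.
have [a H] := planar_floquet S_gt0 (T_planar J1_gt0 J2_gt0 soly c) l0 sT rT.
exists a => t; have [H1 H2 H3 H4] := H t.
split; apply: col2P; rewrite mxE sum2E//.
Qed.

Let H := 2 * energy J (y 0).1 (y 0).2.
Let hE t : 2 * energy J (y t).1 (y t).2 = H.
Proof. by rewrite /H (T_energy J1_gt0 J2_gt0 soly t 0). Qed.

(** The energy is frozen at that of [y], so that this function on phase space restricts to
    [radial_force] along [y]. *)
Definition force c z : R :=
  (psq c z - gap J1 J2 c * integral_area J1 J2 c z) / (J1 + J2) - H * qsq c z.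

Let forceE c t : force c (y t) = radial_force (J1 + J2) (gap J1 J2 c)
  (fun t => part c (y t).1 0 0) (fun t => part c (y t).1 1 0)
  (fun t => part c (y t).2 0 0) (fun t => part c (y t).2 1 0) H t.
Proof. by []. Qed.

Section Oscillating.
Hypothesis H_gt0 : 0 < H.
Let w := Num.sqrt (4 * H / (J1 + J2)).
Let w_gt0 : 0 < w. Proof. by rewrite sqrtr_gt0 divr_gt0// mulr_gt0. Qed.

Lemma radial_motion c t :
  w * qdotp c (y t) = cos (w * t) * (w * qdotp c (y 0)) + sin (w * t) * force c (y 0) /\
  force c (y t) = cos (w * t) * force c (y 0) - sin (w * t) * (w * qdotp c (y 0)).
Proof.
exact: (planar_radial_solution S_gt0 (T_planar J1_gt0 J2_gt0 soly c) H_gt0 hE t).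
Qed.

Lemma qsq_of_force c s t : force c (y s) = force c (y t) -> qsq c (y s) = qsq c (y t).
Proof.
have := planar_radial_integral S_gt0 (T_planar J1_gt0 J2_gt0 soly c) hE s t.
rewrite -!forceE => + E; rewrite E => /addrI/mulfI; apply.
by rewrite mulf_neq0// gt_eqF.
Qed.

Lemma radial_periodic c t : qdotp c (y (t + 2 * pi / w)) = qdotp c (y t) /\
  qsq c (y (t + 2 * pi / w)) = qsq c (y t).
Proof.
have w0 : w != 0 by rewrite gt_eqF.
have [] := oscillator_period w0 (fun t => (radial_motion c t).1)
  (fun t => (radial_motion c t).2) t.
rewrite gtr0_norm// => E1 E2; split; last exact: qsq_of_force.
exact: mulfI E1.
Qed.

(** Turns preserve the radial quantities, so points of the curve that differ by a turn are at the
    same phase of the radial oscillation, which is nonconstant by assumption. *)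
Lemma S4_floquet : (forall c t, area c (y t) != 0) -> qdotp false (y 0) != 0 \/ force false (y 0) != 0 ->
  exists T a b, [/\ 0 < T, forall t, y (t + T) = turn_T a b (y t) &
    forall a' b' t t', y t' = turn_T a' b' (y t) -> exists k : int, t' = t + k%:~R * T].
Proof.
move=> l0 f0; have T0 : 0 < 2 * pi / w by rewrite divr_gt0// mulr_gt0// pi_gt0.
have [a aE] := part_floquet (l0 false) (fun t => (radial_periodic false t).2)
  (fun t => (radial_periodic false t).1).
have [b bE] := part_floquet (l0 true) (fun t => (radial_periodic true t).2)
  (fun t => (radial_periodic true t).1).
exists (2 * pi / w), a, b; split => //.
  move=> t; have [a1 a2] := aE t; have [b1 b2] := bE t.
  by apply: phaseP => -[]; rewrite part_turn.
move=> a' b' t t' E; have w0 : w != 0 by rewrite gt_eqF.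
have [sE rE pE] := turn_invariants a' b' false (y t); rewrite -E in sE rE pE.
have := oscillator_phase w0 (fun t => (radial_motion false t).1)
  (fun t => (radial_motion false t).2) (t := t) (t' := t').
rewrite gtr0_norm//; apply.
- by case=> /eqP; rewrite mulf_eq0 (negPf w0)/= => /eqP r0 /eqP f0'; case: f0; rewrite ?r0 ?f0' ?eqxx.
- by rewrite rE.
- by rewrite /force sE pE (T_integral_area J1_gt0 J2_gt0 soly false t' t).
Qed.

End Oscillating.

(** Without a radial oscillation the clock is the uniform rotation in the first plane. After one of
    its periods only a turn of the second plane remains, which saves one dimension of the torus. *)
Lemma S4_steady : (forall c t, area c (y t) != 0) -> (forall t, qdotp false (y t) = 0) ->
  exists T b, [/\ 0 < T, forall t, y (t + T) = turn_T 0 b (y t) &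
    forall b' t t', y t' = turn_T 0 b' (y t) -> exists k : int, t' = t + k%:~R * T].
Proof.
move=> l0 r0; have [w w0 wE] := planar_circular S_gt0
  (T_planar J1_gt0 J2_gt0 soly false) (l0 false) r0.
have r1 t : qdotp true (y t) = 0 by rewrite (T_qdotp soly) r0 oppr0.
have T0 : 0 < 2 * pi / `|w| by rewrite divr_gt0 ?normr_gt0// mulr_gt0// pi_gt0.
have sC t : qsq false (y t) = qsq false (y 0).
  apply: (@is_derive0_cst _ (fun t => qsq false (y t))) => {}t.
  apply: is_derive1_eq (planar_norm_q S_gt0 (T_planar J1_gt0 J2_gt0 soly false) t) _.
  by have := r0 t; rewrite /qdotp => ->; rewrite mulr0 mul0r.
have s1 t : qsq true (y t) = qsq true (y 0).
  by have := T_qsq soly t; have := T_qsq soly 0; rewrite sC; lra.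
have [b bE] := part_floquet (T := 2 * pi / `|w|) (l0 true)
  (fun t => etrans (s1 _) (esym (s1 t))) (fun t => etrans (r1 _) (esym (r1 t))).
have q0 : ~ (part false (y 0).1 1 0 = 0 /\ part false (y 0).1 0 0 = 0).
  by move=> [E1 E2]; have := l0 false 0; rewrite /area E1 E2 !mul0r subrr eqxx.
have yE t : part false (y t).1 1 0 = cos (w * t) * part false (y 0).1 1 0 +
    sin (w * t) * part false (y 0).1 0 0 by have [_ -> _ _] := wE t; rewrite addrC.
have xE t : part false (y t).1 0 0 = cos (w * t) * part false (y 0).1 0 0 -
    sin (w * t) * part false (y 0).1 1 0 by have [-> _ _ _] := wE t.
have vE t : part false (y t).2 1 0 = cos (w * t) * part false (y 0).2 1 0 +
    sin (w * t) * part false (y 0).2 0 0 by have [_ _ _ ->] := wE t; rewrite addrC.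
have uE t : part false (y t).2 0 0 = cos (w * t) * part false (y 0).2 0 0 -
    sin (w * t) * part false (y 0).2 1 0 by have [_ _ -> _] := wE t.
exists (2 * pi / `|w|), b; split => //.
  move=> t; have [b1 b2] := bE t.
  have [E1 E2] := oscillator_period w0 yE xE t.
  have [E3 E4] := oscillator_period w0 vE uE t.
  by apply: phaseP => -[]; rewrite part_turn// rot20 mul1mx; exact: col2P.
move=> b' t t' E; apply: (oscillator_phase w0 yE xE q0).
  by rewrite E part_turn rot20 mul1mx.
by rewrite E part_turn rot20 mul1mx.
Qed.

Lemma rectilinear c t i : area c (y t) = 0 ->
  is_derive t (1 : R) (fun t => part c (y t).1 i 0) (part c (y t).2 i 0 / (J1 + J2)).
Proof.
move=> l0; have l0' s : area c (y s) = 0 by exact: area_const0 l0.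
have [] := planar_rectilinear (T_planar J1_gt0 J2_gt0 soly c) l0' t.
by move: i; apply: ord2P.
Qed.

(** With zero area the vectors q_c and p_c oscillate themselves, at half the frequency of
    |q_c|^2. *)
Lemma rectilinear_motion c t i : 0 < H -> area c (y 0) = 0 ->
  let w := Num.sqrt (H / (J1 + J2)) in
  (J1 + J2) * w * part c (y t).1 i 0 =
     cos (w * t) * ((J1 + J2) * w * part c (y 0).1 i 0) + sin (w * t) * part c (y 0).2 i 0 /\
  part c (y t).2 i 0 = cos (w * t) * part c (y 0).2 i 0 -
     sin (w * t) * ((J1 + J2) * w * part c (y 0).1 i 0).
Proof.
move=> H0 l0 w; have w2 : w ^+ 2 = H / (J1 + J2) by rewrite sqr_sqrtr// ltW// divr_gt0.
have S0 : J1 + J2 != 0 by rewrite gt_eqF.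
apply: (@oscillator _ w (fun t => (J1 + J2) * w * part c (y t).1 i 0)
  (fun t => part c (y t).2 i 0)) => {}t.
  have d := rectilinear i (area_const0 t l0).
  by apply: is_derive1_eq (is_derive1M (is_derive1c _ t) d) _; field.
have [_ _ dp] := soly t; apply: is_derive1_eq (is_derive_part c i dp) _.
rewrite partZ mxE hE -[H](divfK S0) -w2; ring.
Qed.

(** The period of q_1 is taken, not the shorter one of |q_1|^2: the first half then returns with its
    sign, and a turn of the second plane is all that remains. *)
Lemma S3_floquet : ~ (part false (y 0).1 = 0 /\ part false (y 0).2 = 0) ->
  area false (y 0) = 0 -> (forall t, area true (y t) != 0) ->
  exists T b, [/\ 0 < T, forall t, y (t + T) = turn_T 0 b (y t) &
    forall b' t t', y t' = turn_T 0 b' (y t) -> exists k : int, t' = t + k%:~R * T].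
Proof.
move=> y0 l0 l1.
have H0 : 0 < H by apply: T_energy_gt0 => //; exact: area_neq0_momentum (l1 0).
pose w := Num.sqrt (H / (J1 + J2)).
have w0 : 0 < w by rewrite sqrtr_gt0 divr_gt0.
have wn0 : w != 0 by rewrite gt_eqF.
have Sw0 : (J1 + J2) * w != 0 by rewrite mulf_neq0 ?gt_eqF.
have M i t := rectilinear_motion t i H0 l0.
have T0 : 0 < 2 * pi / w by rewrite divr_gt0// mulr_gt0// pi_gt0.
have per t i : part false (y (t + 2 * pi / w)).1 i 0 = part false (y t).1 i 0 /\
    part false (y (t + 2 * pi / w)).2 i 0 = part false (y t).2 i 0.
  have [] := oscillator_period wn0 (fun t => (M i t).1) (fun t => (M i t).2) t.
  by rewrite gtr0_norm// => /(mulfI Sw0).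
have per0 t : qsq false (y (t + 2 * pi / w)) = qsq false (y t).
  by rewrite /qsq !(per t _).1.
have per1 t : qsq true (y (t + 2 * pi / w)) = qsq true (y t).
  by have := T_qsq soly t; have := T_qsq soly (t + 2 * pi / w); rewrite per0; lra.
have per2 t : qdotp true (y (t + 2 * pi / w)) = qdotp true (y t).
  by rewrite !(T_qdotp soly) /qdotp !(per t _).1 !(per t _).2.
have [b bE] := part_floquet l1 per1 per2.
exists (2 * pi / w), b; split => //.
  move=> t; have [b1 b2] := bE t.
  have p1 : part false (y (t + 2 * pi / w)).1 = part false (y t).1.
    by apply: col2P; exact: (per t _).1.
  have p2 : part false (y (t + 2 * pi / w)).2 = part false (y t).2.
    by apply: col2P; exact: (per t _).2.
  by apply: phaseP => -[]; rewrite part_turn// rot20 mul1mx.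
move=> b' t t' E.
(* Some coordinate of the first half oscillates with nonzero amplitude and serves as the clock. *)
have [i i0] : exists i, ~ ((J1 + J2) * w * part false (y 0).1 i 0 = 0 /\
    part false (y 0).2 i 0 = 0).
  apply: contrapT => no; apply: y0.
  have Z i : part false (y 0).1 i 0 = 0 /\ part false (y 0).2 i 0 = 0.
    apply: contrapT => ni; apply: no; exists i => -[/eqP].
    by rewrite mulf_eq0 (negPf Sw0)/= => /eqP E1 E2; exact: ni.
  by split; apply/matrixP => i j; rewrite ord1 [RHS]mxE; case: (Z i).
have := oscillator_phase wn0 (fun t => (M i t).1) (fun t => (M i t).2) (t := t)
  (t' := t') i0.
by rewrite gtr0_norm//; apply; rewrite E part_turn rot20 mul1mx.
Qed.

End ReducedMotion.

(** * Continuity of matrix expressions *)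

Section MatrixContinuity.
Variables (R : realType) (V : topologicalType).

Lemma sum_continuous (I : Type) (r : seq I) (F : I -> V -> R) (x : V) :
  (forall i, F i y @[y --> x] --> F i x) ->
  \sum_(i <- r) F i y @[y --> x] --> \sum_(i <- r) F i x.
Proof.
move=> H; elim: r => [|i r IH].
  by under eq_fun do rewrite big_nil; rewrite big_nil; exact: cvg_cst.
under eq_fun do rewrite big_cons; rewrite big_cons; exact: (cvgD (H i) IH).
Qed.

Lemma entry_continuous m n (f : V -> 'M[R]_(m, n)) (x : V) i j :
  f y @[y --> x] --> f x -> f y i j @[y --> x] --> f x i j.
Proof.
move=> H; have G : {for f x, continuous (fun M : 'M[R]_(m, n) => M i j)}.
  exact: coord_continuous.
exact: (@continuous_comp _ _ _ f (fun M => M i j) x H G).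
Qed.

Lemma mulmx_continuous m n p (f : V -> 'M[R]_(m, n)) (g : V -> 'M[R]_(n, p)) (x : V) :
  f y @[y --> x] --> f x -> g y @[y --> x] --> g x ->
  f y *m g y @[y --> x] --> f x *m g x.
Proof.
move=> fx gx; apply: mx_continuous => i j; rewrite mxE.
under eq_fun do rewrite mxE; apply: sum_continuous => k.
apply: (@cvgM _ _ (nbhs x) _ (fun y => f y i k) (fun y => g y k j)).
  exact: entry_continuous.
exact: entry_continuous.
Qed.

Lemma trmx_continuous m n (f : V -> 'M[R]_(m, n)) (x : V) :
  f y @[y --> x] --> f x -> (f y)^T @[y --> x] --> (f x)^T.
Proof.
move=> fx; apply: mx_continuous => i j; rewrite mxE.
by under eq_fun do rewrite mxE; exact: entry_continuous.
Qed.

Lemma block_continuous m1 m2 n1 n2 (f : V -> 'M[R]_(m1, n1)) (g : V -> 'M[R]_(m2, n2))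
    (x : V) :
  f y @[y --> x] --> f x -> g y @[y --> x] --> g x ->
  block_mx (f y) 0 0 (g y) @[y --> x] --> block_mx (f x) 0 0 (g x).
Proof.
move=> fx gx; apply: mx_continuous => i j.
have [i' ->|i' ->] := split_ordP i; have [j' ->|j' ->] := split_ordP j.
- by rewrite block_mxEul; under eq_fun do rewrite block_mxEul; exact: entry_continuous.
- by rewrite block_mxEur; under eq_fun do rewrite block_mxEur; rewrite mxE; exact: cvg_cst.
- by rewrite block_mxEdl; under eq_fun do rewrite block_mxEdl; rewrite mxE; exact: cvg_cst.
- by rewrite block_mxEdr; under eq_fun do rewrite block_mxEdr; exact: entry_continuous.
Qed.

Lemma turn_continuous (f g : V -> R) (x : V) :
  f y @[y --> x] --> f x -> g y @[y --> x] --> g x ->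
  turn (f y) (g y) @[y --> x] --> turn (f x) (g x).
Proof.
move=> fx gx; apply: (@block_continuous 2 2 2 2).
  by apply: (continuous_comp fx); exact: rot2_continuous.
by apply: (continuous_comp gx); exact: rot2_continuous.
Qed.

End MatrixContinuity.

(** * The right symmetry group and its orbits *)

Section Turn.
Variable R : realType.
Implicit Types (a b : R).

Lemma block2M (A D A' D' : 'M[R]_2) : (block_mx A 0 0 D : 'M[R]_4) *m block_mx A' 0 0 D' =
  block_mx (A *m A') 0 0 (D *m D').
Proof. by rewrite (@mulmx_block _ 2 2 2 2 2 2) !mul0mx !mulmx0 !addr0 !add0r. Qed.

Lemma turnD a b a' b' : turn (a + a') (b + b') = turn a b *m turn a' b'.
Proof. by rewrite /turn !rot2D block2M. Qed.

Lemma turn_int a b : a \is a Num.int -> b \is a Num.int -> turn a b = 1%:M.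
Proof. by move=> ai bi; rewrite /turn !rot2_int// -(@scalar_mx_block _ 2 2). Qed.

Lemma turn0 : turn 0 0 = 1%:M :> 'M[R]_4. Proof. exact: turn_int. Qed.

Lemma turnT a b : (turn a b)^T = turn (- a) (- b).
Proof. by rewrite /turn (@tr_block_mx _ 2 2 2 2) !rot2T !trmx0. Qed.

Lemma turn_orthogonal a b : orthogonal_mx (turn a b).
Proof. by rewrite /orthogonal_mx turnT -turnD !addNr turn0. Qed.

Lemma turn_GR a b : GR (turn a b).
Proof. by exists (rot2 a), (rot2 b); split => //; exact: rot2_orthogonal. Qed.

Lemma GR_orthogonal (h : 'M[R]_4) : GR h -> orthogonal_mx h.
Proof.
move=> [h1 [h2 [ho1 ho2 hE]]]; rewrite hE /orthogonal_mx (@tr_block_mx _ 2 2 2 2) !trmx0.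
by rewrite block2M ho1 ho2 -(@scalar_mx_block _ 2 2).
Qed.

Lemma GR_cyl J1 J2 (h : 'M[R]_4) : GR h -> h *m cyl_mass J1 J2 *m h^T = cyl_mass J1 J2.
Proof.
move=> [h1 [h2 [ho1 ho2 hE]]]; rewrite hE (@tr_block_mx _ 2 2 2 2) !trmx0 !block2M.
by rewrite !mul_mx_scalar -!scalemxAl !(mulmx1C ho1) !(mulmx1C ho2) !scalemx1.
Qed.

Lemma GRV (h : 'M[R]_4) : GR h -> GR h^T.
Proof.
move=> [h1 [h2 [ho1 ho2 hE]]]; rewrite hE; exists h1^T, h2^T.
split; rewrite ?/orthogonal_mx ?trmxK; [exact: mulmx1C|exact: mulmx1C|].
by rewrite (@tr_block_mx _ 2 2 2 2) !trmx0.
Qed.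

Lemma part_GR c (h : 'M[R]_4) : GR h -> exists k : 'M[R]_2,
  orthogonal_mx k /\ forall v, part c (h *m v) = k *m part c v.
Proof.
move=> [h1 [h2 [ho1 ho2 hE]]]; rewrite hE; exists (if c then h2 else h1).
by split=> [|v]; [case: c|rewrite part_block].
Qed.

Lemma orbit_T_invariants c (z z' : 'cV[R]_4 * 'cV[R]_4) : orbit_T z z' ->
  [/\ qsq c z' = qsq c z, qdotp c z' = qdotp c z & psq c z' = psq c z].
Proof.
move=> [h Gh ->]; have [k [hok kE]] := part_GR c Gh; rewrite -!qsq_dot -!qdotp_dot -!psq_dot/= !kE.
by rewrite !dot_mulmx !mulmxA hok !mul1mx.
Qed.

Lemma orbit_T_sym (z z' : 'cV[R]_4 * 'cV[R]_4) : orbit_T z z' -> orbit_T z' z.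
Proof.
move=> [h Gh ->]; exists h^T; first exact: GRV.
have oh := GR_orthogonal Gh.
by rewrite /= !orthogonalK//; case: z.
Qed.

(** With the vectors as columns, equality of Gram matrices reads M'^T M' = M^T M; as M is
    invertible, M' M^-1 is orthogonal. *)
Lemma gram2 (q p q' p' : 'cV[R]_2) : cross q p != 0 -> dot q' q' = dot q q ->
  dot q' p' = dot q p -> dot p' p' = dot p p ->
  exists h : 'M[R]_2, [/\ orthogonal_mx h, q' = h *m q & p' = h *m p].
Proof.
move=> qp0 qq qp pp.
pose M (q p : 'cV[R]_2) : 'M[R]_2 := \matrix_(i, j) if j == 0 then q i 0 else p i 0.
have Mu : M q p \in unitmx.
  pose N : 'M[R]_2 := \matrix_(i, j) ((cross q p)^-1 *
    (if i == 0 then (if j == 0 then p 1 0 else - p 0 0)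
     else (if j == 0 then - q 1 0 else q 0 0))).
  have NM : N *m M q p = 1%:M.
    apply/matrixP; apply: ord2P; apply: ord2P; rewrite mxE sum2E !mxE/=;
      move: qp0; rewrite /cross => ?; field; exact.
  by case: (mulmx1_unit NM).
have gram (a b : 'cV[R]_2) (i j : 'I_2) : ((M a b)^T *m M a b) i j =
    dot (if i == 0 then a else b) (if j == 0 then a else b).
  by rewrite dot2E mxE sum2E !mxE; case: (i == 0); case: (j == 0).
have E : (M q' p')^T *m M q' p' = (M q p)^T *m M q p.
  apply/matrixP => i j; rewrite !gram.
  by case: (i == 0); case: (j == 0); rewrite // dotC qp dotC.
exists (M q' p' *m invmx (M q p)).
have HM : M q' p' *m invmx (M q p) *m M q p = M q' p' by rewrite mulmxKV.
split.
- rewrite /orthogonal_mx trmx_mul mulmxA -(mulmxA (invmx _)^T) E.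
  by rewrite mulmxA mulmxK// -trmx_mul mulmxV// trmx1.
- apply/matrixP => i j; rewrite ord1; have /matrixP/(_ i 0) := HM.
  by rewrite [RHS]mxE/= => <-; rewrite !mxE; apply: eq_bigr => k _; rewrite !mxE.
- apply/matrixP => i j; rewrite ord1; have /matrixP/(_ i 1) := HM.
  by rewrite [RHS]mxE/= => <-; rewrite !mxE; apply: eq_bigr => k _; rewrite !mxE.
Qed.

Lemma orbit_T_gram (z z' : 'cV[R]_4 * 'cV[R]_4) :
  (forall c, [/\ qsq c z' = qsq c z, qdotp c z' = qdotp c z & psq c z' = psq c z]) ->
  (forall c, area c z != 0 \/ part c z.1 = 0 /\ part c z.2 = 0) ->
  orbit_T z z'.
Proof.
move=> gram nd.
have H c : exists h : 'M[R]_2, [/\ orthogonal_mx h, part c z'.1 = h *m part c z.1 &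
    part c z'.2 = h *m part c z.2].
  have [g1 g2 g3] := gram c; have [a0|[q0 p0]] := nd c.
    by apply: gram2 => //; rewrite ?qsq_dot ?qdotp_dot ?psq_dot.
  exists 1%:M; rewrite !mul1mx; split; first by rewrite /orthogonal_mx trmx1 mul1mx.
    by rewrite q0; apply: dot_eq0; rewrite qsq_dot g1 -qsq_dot q0 /dot mulmx0 mxE.
  by rewrite p0; apply: dot_eq0; rewrite psq_dot g3 -psq_dot p0 /dot mulmx0 mxE.
have [h1 [ho1 q1 p1]] := H false; have [h2 [ho2 q2 p2]] := H true.
exists (block_mx h1 0 0 h2); first by exists h1, h2.
by apply: phaseP => -[]; rewrite part_block.
Qed.

End Turn.

(** * Invariant tori in the cotangent bundle *)

Section ReducedTori.
Variables (R : realType) (J1 J2 : R).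
Hypotheses (J1_gt0 : 0 < J1) (J2_gt0 : 0 < J2).
Local Notation J := (cyl_mass J1 J2).
Local Notation phase := ('cV[R]_4 * 'cV[R]_4)%type.
Variables (y : R -> phase) (soly : veselova_T_sol J y).

Lemma T_sol_GR (h : 'M[R]_4) : GR h -> veselova_T_sol J (fun t => (h *m (y t).1, h *m (y t).2)).
Proof.
move=> Gh; rewrite -(GR_cyl J1 J2 Gh).
by apply: T_sol_conj => //; [exact: cyl_symposdef|exact: GR_orthogonal].
Qed.

Lemma T_continuous (t : R) : y s @[s --> t] --> y t.
Proof.
have [_ dq dp] := soly t.
have := pair_continuous (is_derive_mx_continuous dq) (is_derive_mx_continuous dp).
by rewrite -surjective_pairing; under eq_fun do rewrite -surjective_pairing.
Qed.

Lemma turn_T_continuous (V : topologicalType) (f g tau : V -> R) (x : V) :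
  f v @[v --> x] --> f x -> g v @[v --> x] --> g x -> tau v @[v --> x] --> tau x ->
  turn_T (f v) (g v) (y (tau v)) @[v --> x] --> turn_T (f x) (g x) (y (tau x)).
Proof.
move=> fx gx tx; have tc := turn_continuous fx gx.
have yc : y (tau v) @[v --> x] --> y (tau x).
  by apply: (continuous_comp tx); exact: T_continuous.
apply: pair_continuous; apply: mulmx_continuous => //.
  by apply: (continuous_comp yc); exact: cvg_fst.
by apply: (continuous_comp yc); exact: cvg_snd.
Qed.

Lemma turn_TD a b a' b' (z : phase) :
  turn_T (a + a') (b + b') z = turn_T a b (turn_T a' b' z).
Proof. by rewrite /turn_T /= turnD !mulmxA. Qed.

Lemma turn_T_int a b (z : phase) : a \is a Num.int -> b \is a Num.int ->
  turn_T a b z = z.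
Proof. by move=> ai bi; rewrite /turn_T turn_int// !mul1mx; case: z. Qed.

Lemma T_torus2 (T b : R) : 0 < T -> (forall t, y (t + T) = turn_T 0 b (y t)) ->
  (forall b' t t', y t' = turn_T 0 b' (y t) -> exists k : int, t' = t + k%:~R * T) ->
  (forall t, part true (y t).1 != 0) -> lies_on_torus (veselova_T_sol J) 2 y.
Proof.
move=> T0 yT ph q0.
apply: (@floquet_torus _ _ _ 1 2 (fun a => turn_T 0 (a 0 0)) y T (const_mx b)) => //.
- move=> au; apply: (@turn_T_continuous _ (fun=> 0) (fun au : 'rV[R]_1 * R => au.1 0 0) (fun au => au.2) au).
  + exact: cvg_cst.
  + by apply: entry_continuous; exact: cvg_fst.
  + exact: cvg_snd.
- by move=> a a' u; rewrite -turn_TD addr0 mxE.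
- by move=> a u ai; apply: turn_T_int.
- by move=> t; rewrite yT mxE.
- move=> a tau; have := T_sol_GR (turn_GR 0 (a 0 0)); exact: T_sol_shift.
- by move=> a t t' E; exact: ph E.
- move=> a t /(congr1 (fun z => part true z.1)); rewrite part_turn/= => /rot2_fix H i.
  by rewrite ord1; exact: (H (q0 t)).
Qed.

Lemma T_torus3 (T a b : R) : 0 < T -> (forall t, y (t + T) = turn_T a b (y t)) ->
  (forall a' b' t t', y t' = turn_T a' b' (y t) -> exists k : int, t' = t + k%:~R * T) ->
  (forall c t, part c (y t).1 != 0) -> lies_on_torus (veselova_T_sol J) 3 y.
Proof.
move=> T0 yT ph q0.
apply: (@floquet_torus _ _ _ 2 3 (fun a => turn_T (a 0 0) (a 0 1)) y T
  (\row_i if i == 0 then a else b)) => //.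
- move=> au; apply: (@turn_T_continuous _ (fun au : 'rV[R]_2 * R => au.1 0 0)
    (fun au : 'rV[R]_2 * R => au.1 0 1) (fun au => au.2) au).
  + by apply: entry_continuous; exact: cvg_fst.
  + by apply: entry_continuous; exact: cvg_fst.
  + exact: cvg_snd.
- by move=> c c' u; rewrite -turn_TD !mxE.
- by move=> c u ci; apply: turn_T_int.
- by move=> t; rewrite yT !mxE.
- move=> c tau; have := T_sol_GR (turn_GR (c 0 0) (c 0 1)); exact: T_sol_shift.
- by move=> c t t' E; exact: ph E.
- move=> c t E.
  have := congr1 (fun z => part false z.1) E; rewrite part_turn/= => /rot2_fix H0.
  have := congr1 (fun z => part true z.1) E; rewrite part_turn/= => /rot2_fix H1.
  by apply: ord2P; [exact: (H0 (q0 false t))|exact: (H1 (q0 true t))].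
Qed.

End ReducedTori.

(** * The strata in the cotangent bundle *)

Section ReducedStrata.
Variables (R : realType) (J1 J2 : R).
Hypotheses (J1_gt0 : 0 < J1) (J2_gt0 : 0 < J2).
Local Notation J := (cyl_mass J1 J2).
Local Notation phase := ('cV[R]_4 * 'cV[R]_4)%type.
Implicit Types (z : phase) (c : bool).

Lemma area_cross c z : area c z = cross (part c z.1) (part c z.2).
Proof. by []. Qed.

Lemma S4P z : S4 z <-> forall c, area c z != 0.
Proof.
rewrite /S4/= /independent !free2; split=> [[? ?] []//|H].
by split; [exact: (H false)|exact: (H true)].
Qed.

Lemma area_neq0_q c z : area c z != 0 -> part c z.1 != 0.
Proof. by apply: contra => /eqP q0; rewrite area_cross q0 /cross !mxE !mul0r subrr. Qed.

Variables (y : R -> phase) (soly : veselova_T_sol J y).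
Let S_gt0 : 0 < J1 + J2. Proof. exact: addr_gt0. Qed.

(** The norm of p is conserved, so p stays zero, and then the velocity is zero. *)
Lemma T_rest t0 : (y t0).2 = 0 -> is_equilibrium y.
Proof.
move=> p0; have p t : (y t).2 = 0.
  by apply: dot_eq0; rewrite (T_momentum J1_gt0 J2_gt0 soly t t0) p0 /dot mulmx0 mxE.
have q s t : (y s).1 = (y t).1.
  apply: (@is_derive0_mx_cst _ _ _ (fun t => (y t).1)) => {s}t.
  have [_ dq _] := soly t; apply: is_derive_eq dq _.
  by rewrite p {1}/dot trmx0 mul0mx mxE mul0r scale0r subrr mulmx0.
by move=> s t; rewrite [LHS]surjective_pairing [RHS]surjective_pairing (q s t) !p.
Qed.

(** A vanishing half has zero area, hence obeys the linear oscillator with zero initial data. The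
    nonzero momentum supplies the positive frequency. *)
Lemma zero_part_persists c t0 : part c (y t0).1 = 0 -> part c (y t0).2 = 0 ->
  (y t0).2 != 0 -> forall t, part c (y t).1 = 0 /\ part c (y t).2 = 0.
Proof.
move=> q0 p0 pn0 t; have sols := T_sol_shift t0 soly.
have H0 := T_energy_gt0 J1_gt0 J2_gt0 sols (t := 0); rewrite add0r in H0.
have a0 : area c (y (0 + t0)) = 0 by rewrite add0r area_cross q0 /cross !mxE !mul0r subrr.
have M i := rectilinear_motion J1_gt0 J2_gt0 sols (t - t0) i _ a0.
rewrite /= subrK add0r in M.
have Sw : (J1 + J2) * Num.sqrt (2 * energy J (y t0).1 (y t0).2 / (J1 + J2)) != 0.
  by rewrite mulf_neq0 ?gt_eqF// sqrtr_gt0 divr_gt0// H0.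
split; apply/matrixP => i j; rewrite ord1 [RHS]mxE; have [E1 E2] := M (H0 pn0) i.
  by move: E1; rewrite q0 p0 !mxE !mulr0 addr0 => /eqP; rewrite mulf_eq0 (negPf Sw) => /eqP.
by move: E2; rewrite q0 p0 !mxE !mulr0 subr0.
Qed.

Lemma planar_relative_equilibrium c t0 : part c (y t0).1 = 0 -> part c (y t0).2 = 0 ->
  part (~~ c) (y t0).2 != 0 ->
  [/\ forall t, part c (y t).1 = 0 /\ part c (y t).2 = 0,
      forall t, qsq (~~ c) (y t) = 1, forall t, qdotp (~~ c) (y t) = 0 &
      is_relative_equilibrium (@orbit_T R) y].
Proof.
move=> q0 p0 pn0; have p1 : (y t0).2 != 0.
  by apply: contra pn0 => /eqP ->; rewrite part0.
have Z := zero_part_persists q0 p0 p1.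
have qz t : qsq c (y t) = 0 by rewrite -qsq_dot (Z t).1 /dot mulmx0 mxE.
have rz t : qdotp c (y t) = 0 by rewrite -qdotp_dot (Z t).1 /dot trmx0 mul0mx mxE.
have pz t : psq c (y t) = 0 by rewrite -psq_dot (Z t).2 /dot mulmx0 mxE.
have q1 t : qsq (~~ c) (y t) = 1.
  by move: (qz t) (T_qsq soly t); case: (c) => /= ->; rewrite ?addr0 ?add0r.
have r1 t : qdotp (~~ c) (y t) = 0.
  move: (rz t) (T_qdotp soly t); case: (c) => /= ->; last by rewrite oppr0.
  by move=> /esym/eqP; rewrite oppr_eq0 => /eqP.
have P1 s t : psq (~~ c) (y s) = psq (~~ c) (y t).
  have := T_momentum J1_gt0 J2_gt0 soly s t; rewrite !dot_part !psq_dot.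
  by move: (pz s) (pz t); case: (c) => /= -> ->; rewrite ?addr0 ?add0r.
have cc c' : c' = c \/ c' = ~~ c by case: (c) c' => -[]; auto.
split => // s t; apply: orbit_T_gram => c'.
  by have [->|->] := cc c'; split; rewrite ?qz ?rz ?pz ?q1 ?r1//; exact: P1.
have [->|->] := cc c'; first by right; exact: Z.
(* With q.p = 0 and |q| = 1 in the surviving half, Lagrange's identity equates the squared area with
   |p|^2, which is nonzero. *)
left; apply/eqP => a0; have := lagrange_identity (~~ c) (y s).
rewrite r1 a0 q1 (P1 s t0) -psq_dot expr0n/= addr0 mul1r => /esym/dot_eq0/eqP.
exact/negP.
Qed.

Lemma relative_equilibrium_radial : is_relative_equilibrium (@orbit_T R) y ->
  forall t, qdotp false (y t) = 0.
Proof.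
move=> req t; have sC s : qsq false (y s) = qsq false (y 0).
  by have [] := orbit_T_invariants false (req 0 s).
have d1 := planar_norm_q S_gt0 (T_planar J1_gt0 J2_gt0 soly false) t.
have d2 : is_derive t (1 : R) (fun s => qsq false (y s)) 0.
  by under eq_fun do rewrite sC; exact: is_derive1c.
have /eqP := is_derive_unique d1 d2.
by rewrite mulf_eq0 invr_eq0 (gt_eqF S_gt0) orbF mulf_eq0 pnatr_eq0 => /eqP.
Qed.

(** At a relative equilibrium q_1.p_1 is identically zero, hence so is its derivative, and |p_1|^2
    is a positive multiple of |q_1|^2. Lagrange's identity with zero area then makes both vanish. *)
Lemma rectilinear_not_relative_equilibrium t : (y t).2 != 0 ->
  area false (y t) = 0 -> ~ (part false (y t).1 = 0 /\ part false (y t).2 = 0) ->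
  ~ is_relative_equilibrium (@orbit_T R) y.
Proof.
move=> p0 a0 nz req; have r0 := relative_equilibrium_radial req.
have hE s : 2 * energy J (y s).1 (y s).2 = 2 * energy J (y t).1 (y t).2.
  by rewrite (T_energy J1_gt0 J2_gt0 soly s t).
have d1 := planar_radial S_gt0 (T_planar J1_gt0 J2_gt0 soly false) hE t.
have d2 : is_derive t (1 : R) (fun s => qdotp false (y s)) 0.
  by under eq_fun do rewrite r0; exact: is_derive1c.
have := is_derive_unique d1 d2.
rewrite /radial_force /area_integral -/(area false (y t)) a0 expr0n/= mul0r mulr0 subr0.
rewrite -/(qsq false (y t)) -/(psq false (y t)) => E.
have H0 := T_energy_gt0 J1_gt0 J2_gt0 soly p0.
have L := lagrange_identity false (y t); rewrite r0 a0 expr0n/= addr0 in L.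
have S0 : J1 + J2 != 0 by rewrite gt_eqF.
have pE : psq false (y t) = (J1 + J2) * (2 * energy J (y t).1 (y t).2) * qsq false (y t).
  by rewrite -[LHS](divfK S0); move/eqP : E; rewrite subr_eq0 => /eqP ->; ring.
move: L; rewrite pE mulrCA => /esym/eqP; rewrite mulf_eq0 mulf_eq0.
rewrite (gt_eqF S_gt0) (gt_eqF H0)/= mulf_eq0 orbb => /eqP q0.
apply: nz; split; apply: dot_eq0; first by rewrite qsq_dot.
by rewrite psq_dot pE q0 mulr0.
Qed.

Lemma S4_persists t0 : S4 (y t0) -> forall c t, area c (y t) != 0.
Proof. by move=> /S4P H c t; apply: (area_const_neq0 J1_gt0 J2_gt0 soly t (H c)). Qed.

(** The radii are constant, so the area integrals fix the squared areas, and Lagrange's identity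
    fixes |p_j|^2. The Gram matrices of both halves are thus constant. *)
Lemma steady_relative_equilibrium : (forall c t, area c (y t) != 0) ->
  (forall t, qdotp false (y t) = 0) -> is_relative_equilibrium (@orbit_T R) y.
Proof.
move=> a0 r0 s t; apply: orbit_T_gram => c; last by left.
have rc u : qdotp c (y u) = 0 by case: c; rewrite ?(T_qdotp soly) r0 ?oppr0.
have qf u : qsq false (y u) = qsq false (y 0).
  apply: (@is_derive0_cst _ (fun t => qsq false (y t))) => v.
  apply: is_derive1_eq (planar_norm_q S_gt0 (T_planar J1_gt0 J2_gt0 soly false) v) _.
  by have := r0 v; rewrite /qdotp => ->; rewrite mulr0 mul0r.
have qc u : qsq c (y u) = qsq c (y 0).
  by case: c {rc} => //; have := T_qsq soly u; have := T_qsq soly 0; rewrite qf; lra.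
have ac : area c (y t) ^+ 2 = area c (y s) ^+ 2.
  have := T_integral_area J1_gt0 J2_gt0 soly c t s.
  rewrite /integral_area /den !qc => /divIf; apply.
  by rewrite gt_eqF//; exact: (den_gt0 J1_gt0 J2_gt0 c (T_cotangent soly 0)).
split; [by rewrite !qc|by rewrite !rc|].
have q0 : qsq c (y 0) != 0.
  by rewrite -qsq_dot gt_eqF// dot_gt0// area_neq0_q.
apply: (mulfI q0); rewrite -{1}(qc t) -(qc s) -!lagrange_identity.
by rewrite !rc ac.
Qed.

Lemma S4_cases t0 : S4 (y t0) ->
  (is_relative_equilibrium (@orbit_T R) y /\
    exists T b, [/\ 0 < T, forall t, y (t + T) = turn_T 0 b (y t) &
    forall b' t t', y t' = turn_T 0 b' (y t) -> exists k : int, t' = t + k%:~R * T]) \/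
  (is_relative_periodic (@orbit_T R) y /\
    exists T a b, [/\ 0 < T, forall t, y (t + T) = turn_T a b (y t) &
    forall a' b' t t', y t' = turn_T a' b' (y t) -> exists k : int, t' = t + k%:~R * T]).
Proof.
move=> /S4_persists a0; have [r0|r0] := pselect (forall t, qdotp false (y t) = 0).
  left; split; first exact: steady_relative_equilibrium.
by have := S4_steady J1_gt0 J2_gt0 soly a0 r0.
right; have H0 : 0 < 2 * energy J (y 0).1 (y 0).2.
  by apply: T_energy_gt0 => //; exact: area_neq0_momentum (a0 false 0).
have F := S4_floquet J1_gt0 J2_gt0 soly H0 a0.
have [T [a [b [T0 yT ph]]]] : exists T a b, [/\ 0 < T, forall t, y (t + T) = turn_T a b (y t) &
    forall a' b' t t', y t' = turn_T a' b' (y t) -> exists k : int, t' = t + k%:~R * T].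
  (* If both initial values vanished, the radial oscillation would be identically zero, against
     [r0]. *)
  apply: F; apply: contrapT => /not_orP[/negP/negPn/eqP r1 /negP/negPn/eqP f1].
  apply: r0 => t; have [+ _] := radial_motion J1_gt0 J2_gt0 soly H0 false t.
  rewrite r1 f1 !mulr0 addr0 => /eqP; rewrite mulf_eq0 gt_eqF//=; first by move/eqP.
  by rewrite sqrtr_gt0 divr_gt0// mulr_gt0.
split; last by exists T, a, b.
split; first by move/relative_equilibrium_radial.
exists T; split => // t; rewrite yT; apply: orbit_T_sym.
by exists (turn a b) => //; exact: turn_GR.
Qed.

End ReducedStrata.

(** * Reconstruction *)

Section Rotations.
Variable R : realType.

Lemma det2E (K : 'M[R]_2) : \det K = K 0 0 * K 1 1 - K 0 1 * K 1 0.
Proof.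
rewrite (expand_det_row K 0) sum2E /cofactor !det_mx11 !mxE/=.
have -> : lift (0 : 'I_2) (0 : 'I_1) = 1 by exact: val_inj.
have -> : lift (1 : 'I_2) (0 : 'I_1) = 0 by exact: val_inj.
by rewrite expr0 expr1 mul1r mulN1r mulrN.
Qed.

Lemma SO2_rot2 (K : 'M[R]_2) : orthogonal_mx K -> \det K = 1 -> exists a, K = rot2 a.
Proof.
move=> /matrixP oK; rewrite det2E => dK.
have := oK 0 0; have := oK 0 1; rewrite !mxE !sum2E !mxE/= ?mulr0n ?mulr1n => K01 K00.
have cs : K 0 0 ^+ 2 + K 1 0 ^+ 2 = 1 by rewrite !expr2.
have K11 : K 1 1 = K 0 0.
  transitivity (K 1 1 * (K 0 0 ^+ 2 + K 1 0 ^+ 2)); first by rewrite cs mulr1.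
  transitivity (K 0 0 * (K 0 0 * K 1 1 - K 0 1 * K 1 0) +
    K 1 0 * (K 0 0 * K 0 1 + K 1 0 * K 1 1)); first ring.
  by rewrite dK K01 mulr1 mulr0 addr0.
have K0N : K 0 1 = - K 1 0.
  transitivity (K 0 1 * (K 0 0 ^+ 2 + K 1 0 ^+ 2)); first by rewrite cs mulr1.
  transitivity (K 0 0 * (K 0 0 * K 0 1 + K 1 0 * K 1 1) -
    K 1 0 * (K 0 0 * K 1 1 - K 0 1 * K 1 0)); first ring.
  by rewrite dK K01 mulr1 mulr0 add0r.
have [a [a00 a01 a10 a11]] := rot2P cs; exists a.
by apply/matrixP; apply: ord2P; apply: ord2P; rewrite ?a00 ?a01 ?a10 ?a11.
Qed.

Lemma det_turn (a b : R) : \det (turn a b) = 1.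
Proof.
have d (c : R) : \det (rot2 c) = 1.
  have [r00 r01 r10 r11] := rot2E c; rewrite det2E r00 r01 r10 r11.
  by rewrite mulNr opprK -!expr2 cos2Dsin2.
by rewrite /turn [LHS](@det_ublock _ 2 2) !d mulr1.
Qed.

Lemma fix_plane_block (A : 'M[R]_4) : orthogonal_mx A -> \det A = 1 ->
  A *m ebasis R 0 = ebasis R 0 -> A *m ebasis R 1 = ebasis R 1 ->
  exists a, A = turn 0 a.
Proof.
move=> oA dA A0 A1.
have fixA (j : 'I_2) : A *m ebasis R (lshift 2 j : 'I_4) = ebasis R (lshift 2 j : 'I_4).
  move: j; apply: ord2P.
    by rewrite (_ : (lshift 2 (0 : 'I_2) : 'I_4) = 0)//; exact: val_inj.
  by rewrite (_ : (lshift 2 (1 : 'I_2) : 'I_4) = 1)//; exact: val_inj.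
have fixAT (j : 'I_2) : A^T *m ebasis R (lshift 2 j : 'I_4) = ebasis R (lshift 2 j : 'I_4).
  by rewrite -{1}fixA orthogonalK.
have AE (i : 'I_4) (j : 'I_2) : A i (lshift 2 j) = (i == lshift 2 j)%:R.
  by rewrite -mulmx_ebasis fixA mxE eqxx andbT.
have AT (i : 'I_4) (j : 'I_2) : A (lshift 2 j) i = (i == lshift 2 j)%:R.
  have <- : A^T i (lshift 2 j) = A (lshift 2 j) i by rewrite mxE.
  by rewrite -mulmx_ebasis fixAT mxE eqxx andbT.
pose K : 'M[R]_2 := \matrix_(i, j) A (rshift 2 i) (rshift 2 j).
have AK : A = block_mx (1%:M : 'M[R]_2) 0 0 K.
  apply/matrixP => i j.
  have [i' ->|i' ->] := @split_ordP 2 2 i; have [j' ->|j' ->] := @split_ordP 2 2 j.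
  - by rewrite AE (@block_mxEul _ 2 2 2 2) mxE (inj_eq (@lshift_inj 2 2)).
  - by rewrite AT (@block_mxEur _ 2 2 2 2) mxE (@eq_rlshift 2 2).
  - by rewrite AE (@block_mxEdl _ 2 2 2 2) mxE (@eq_rlshift 2 2).
  - by rewrite (@block_mxEdr _ 2 2 2 2) mxE.
have oK : orthogonal_mx K.
  have := oA; rewrite /orthogonal_mx AK (@tr_block_mx _ 2 2 2 2) !trmx0 block2M.
  rewrite (@scalar_mx_block _ 2 2) => /(congr1 (@drsubmx _ 2 2 2 2)).
  by rewrite !block_mxKdr.
have dK : \det K = 1 by have := dA; rewrite AK [LHS](@det_ublock _ 2 2) det1 mul1r.
have [a Ka] := SO2_rot2 oK dK; exists a.
by rewrite AK Ka /turn rot20.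
Qed.

Definition spin (Q : 'M[R]_4) (a : R) : 'M[R]_4 := Q^T *m turn 0 a *m Q.

Lemma turn_fix (a : R) v : part true v = 0 -> turn 0 a *m v = v.
Proof.
move=> v0; apply: part_inj => -[]; rewrite part_turn; first by rewrite v0 mulmx0.
by rewrite rot20 mul1mx.
Qed.

Lemma part_ebasis (r : 'I_4) : (r < 2)%N -> part true (ebasis R r) = 0.
Proof.
move=> r2; apply/matrixP => i j; rewrite /part /snd2 !mxE [X in X && _](_ : _ = false)//.
by apply/negbTE; rewrite -val_eqE/= neq_ltn orbC (leq_trans r2)// leq_addr.
Qed.

(** A reflection fixing e_1 carries [u] to the second axis. In that frame [A] fixes two basis
    vectors, and determinant 1 leaves a rotation of the remaining plane. *)
Lemma spin_axis (A : 'M[R]_4) (u : 'cV[R]_4) : orthogonal_mx A -> \det A = 1 ->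
  A *m ebasis R 0 = ebasis R 0 -> A *m u = u -> u != 0 -> dot (ebasis R 0) u = 0 ->
  exists Q a, [/\ orthogonal_mx Q, Q *m ebasis R 0 = ebasis R 0,
    Q *m u = Num.sqrt (dot u u) *: ebasis R 1 & A = spin Q a].
Proof.
move=> oA dA A0 Au u0 eu; pose r := Num.sqrt (dot u u).
have r0 : 0 < r by rewrite sqrtr_gt0 dot_gt0.
have r2 : r ^+ 2 = dot u u by rewrite sqr_sqrtr// dot_ge0.
have [||Q [oQ Qu Qf]] := @householder R 3 (r^-1 *: u) (ebasis R 1).
- by rewrite dotZl dotZr -r2; field; rewrite gt_eqF.
- by rewrite dot_ebasis eqxx.
have Q0 : Q *m ebasis R 0 = ebasis R 0.
  by apply: Qf; [rewrite dotZl dotC eu mulr0|rewrite dot_ebasis].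
have Qu' : Q *m u = r *: ebasis R 1.
  by rewrite -Qu -scalemxAr scalerA divff ?scale1r// gt_eqF.
have A1 : Q *m A *m Q^T *m ebasis R 1 = ebasis R 1.
  by rewrite -{1}Qu -!mulmxA orthogonalK// -!scalemxAr Au scalemxAr.
have A0' : Q *m A *m Q^T *m ebasis R 0 = ebasis R 0.
  by rewrite -{1}Q0 -!mulmxA orthogonalK// A0.
have oQA : orthogonal_mx (Q *m A *m Q^T).
  by apply: orthogonalM; [exact: orthogonalM|exact: orthogonalT].
have dQA : \det (Q *m A *m Q^T) = 1.
  rewrite !det_mulmx mulrAC -det_mulmx orthogonal_mxC// det1 mul1r//.
have [a aE] := fix_plane_block oQA dQA A0' A1.
exists Q, a; split => //; rewrite /spin -aE !mulmxA oQ mul1mx -mulmxA oQ mulmx1//.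
Qed.

Lemma spinD Q a b : orthogonal_mx Q -> spin Q (a + b) = spin Q a *m spin Q b.
Proof.
move=> oQ; rewrite /spin -[X in turn X _](addr0 0) turnD !mulmxA.
by rewrite -[_ *m Q *m Q^T]mulmxA orthogonal_mxC// mulmx1.
Qed.

Lemma spin_int Q a : orthogonal_mx Q -> a \is a Num.int -> spin Q a = 1%:M.
Proof. by move=> oQ ai; rewrite /spin turn_int// mulmx1. Qed.

Lemma spin_orthogonal Q a : orthogonal_mx Q -> orthogonal_mx (spin Q a).
Proof.
move=> oQ; apply: orthogonalM => //; apply: orthogonalM; first exact: orthogonalT.
exact: turn_orthogonal.
Qed.

Lemma spin_fix0 Q a : orthogonal_mx Q -> Q *m ebasis R 0 = ebasis R 0 ->
  spin Q a *m ebasis R 0 = ebasis R 0.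
Proof.
move=> oQ Q0; rewrite /spin -!mulmxA Q0 turn_fix ?part_ebasis//.
by rewrite -{1}Q0 orthogonalK.
Qed.

Lemma spin_eq1 Q a : orthogonal_mx Q -> spin Q a = 1%:M -> a \is a Num.int.
Proof.
move=> oQ E; have {}E : turn 0 a = 1%:M.
  rewrite -[LHS]mul1mx -[LHS]mulmx1 -(orthogonal_mxC oQ) !mulmxA.
  by rewrite -!mulmxA [X in Q *m X]mulmxA [X in Q *m X]mulmxA -/(spin Q a) E mul1mx orthogonal_mxC.
apply: rot2_eq1; move: E; rewrite /turn (@scalar_mx_block _ 2 2).
by move=> /(congr1 (@drsubmx _ 2 2 2 2)); rewrite !block_mxKdr.
Qed.

Lemma det_continuous (V : topologicalType) n (f : V -> 'M[R]_n) (x : V) :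
  f y @[y --> x] --> f x -> \det (f y) @[y --> x] --> \det (f x).
Proof.
move=> fx.
have H (s : 'I_n -> 'I_n) :
    \prod_i f y i (s i) @[y --> x] --> \prod_i f x i (s i).
  elim: (index_enum _) => [|i r IH].
    by under eq_fun do rewrite big_nil; rewrite big_nil; exact: cvg_cst.
  under eq_fun do rewrite big_cons /=; rewrite big_cons /=.
  have fi : f y i (s i) @[y --> x] --> f x i (s i) by exact: entry_continuous.
  exact: (cvgM fi IH).
by apply: sum_continuous => s; apply: cvgMl_tmp; exact: H.
Qed.

Lemma sign_constant (f : R -> R) : (forall t, f s @[s --> t] --> f t) ->
  (forall t, f t ^+ 2 = 1) -> forall s t, f s = f t.
Proof.
move=> fc f1; suff H s t : s <= t -> f s = f t.
  by move=> s t; have [/H|/ltW/H] := leP s t.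
move=> st; apply: contrapT => fst.
have fE u : f u = 1 \/ f u = -1.
  have : (f u == 1) || (f u == -1) by rewrite -eqf_sqr f1 expr1n.
  by case/orP => /eqP; auto.
have [||c _ fc0] := @IVT R f s t 0 st.
- by apply: continuous_subspaceT => u; exact: fc.
- have [E1|E1] := fE s; have [E2|E2] := fE t; rewrite E1 E2 in fst *.
  + by [].
  + by rewrite ge_min le_max lerN10 ler01 orbT.
  + by rewrite ge_min le_max lerN10 ler01 orbT.
  + by [].
by have := f1 c; rewrite fc0 expr0n => /eqP; rewrite eq_sym oner_eq0.
Qed.

End Rotations.

(** * Monodromy and tori on D *)

Section Reconstruction.
Variables (R : realType) (J1 J2 : R).
Hypotheses (J1_gt0 : 0 < J1) (J2_gt0 : 0 < J2).
Local Notation J := (cyl_mass J1 J2).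
Local Notation full := ('M[R]_4 * 'M[R]_4)%type.
Let Jpos : symposdef J := cyl_symposdef J1_gt0 J2_gt0.

Lemma D_sol_GR (x : R -> full) (A h : 'M[R]_4) : orthogonal_mx A ->
  A *m ebasis R 0 = ebasis R 0 -> GR h -> veselova_D_sol J x ->
  veselova_D_sol J (fun t => (A *m (x t).1 *m h^T, h *m (x t).2 *m h^T)).
Proof.
move=> oA A0 Gh sol; rewrite -(GR_cyl J1 J2 Gh).
by apply: D_sol_conj => //; exact: GR_orthogonal.
Qed.

Lemma proj_GR (z : full) (A h : 'M[R]_4) : orthogonal_mx A ->
  A *m ebasis R 0 = ebasis R 0 -> GR h -> orthogonal_mx z.1 ->
  veselova_proj J (A *m z.1 *m h^T, h *m z.2 *m h^T) =
  (h *m (veselova_proj J z).1, h *m (veselova_proj J z).2).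
Proof.
move=> oA A0 Gh oz; rewrite -{1}(GR_cyl J1 J2 Gh).
by apply: veselova_proj_conj => //; exact: GR_orthogonal.
Qed.

Variables (x : R -> full) (solx : veselova_D_sol J x).
Let y t := veselova_proj J (x t).
Let soly : veselova_T_sol J y := D_proj_sol Jpos solx.
Let ox t : orthogonal_mx (x t).1 := D_orth solx t.

Let yq t : (y t).1 = (x t).1^T *m ebasis R 0.
Proof. exact: (poissonE 0 (ox t)). Qed.

(** Given the body part [h], the space part must be g(t) h g(s)^T; it fixes e_1 because [h] carries
    q(s) to q(t). The angular velocities match since (q, p) determines them. *)
Lemma orbit_D_proj s t : orbit_D (x s) (x t) <-> orbit_T (y s) (y t).
Proof.
split=> [[A [B [[oA A0] GB E]]]|[h Gh E]].
  exists B => //; rewrite /y E (orthogonal_inv (GR_orthogonal GB)).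
  by rewrite proj_GR.
have oh := GR_orthogonal Gh.
exists ((x t).1 *m h *m (x s).1^T), h; split => //.
  split; first by apply: orthogonalM; [exact: orthogonalM|exact: orthogonalT].
  have E1 : (y t).1 = h *m (y s).1 by rewrite E.
  by rewrite -!mulmxA -yq -E1 yq orthogonalKV.
have OmE : (x t).2 = h *m (x s).2 *m h^T.
  have V := velocity_conj Jpos oh (y s).2 (D_q0 solx s).
  rewrite (GR_cyl J1 J2 Gh) in V.
  by rewrite (D_Om Jpos solx) -/(y t) E /= V wedge_conj -(D_Om Jpos solx).
rewrite (orthogonal_inv oh) -OmE -!mulmxA (mulmxA (x s).1^T) ox mul1mx orthogonal_mxC//.
by rewrite mulmx1; case: (x t).
Qed.

Lemma relative_equilibrium_D : is_relative_equilibrium (@orbit_D R) x <->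
  is_relative_equilibrium (@orbit_T R) y.
Proof. by split=> H s t; apply/orbit_D_proj. Qed.

Lemma relative_periodic_D : is_relative_periodic (@orbit_D R) x <->
  is_relative_periodic (@orbit_T R) y.
Proof.
split=> -[nreq [T [T0 HT]]]; (split; first by move=> /relative_equilibrium_D).
  by exists T; split => // t; apply/orbit_D_proj.
by exists T; split => // t; apply/orbit_D_proj.
Qed.

Lemma D_rest t0 : (y t0).2 = 0 -> is_equilibrium x.
Proof.
move=> p0; have yE := T_rest J1_gt0 J2_gt0 soly p0.
have Om0 t : (x t).2 = 0.
  rewrite (D_Om Jpos solx) -/(y t) (yE t t0) p0 /velocity.
  rewrite {1}/dot trmx0 mul0mx mxE mul0r scale0r subrr mulmx0.
  by rewrite /wedge trmx0 mulmx0 mul0mx subrr.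
have gE s t : (x s).1 = (x t).1.
  apply: (@is_derive0_mx_cst _ _ _ (fun t => (x t).1)) => {s}t.
  have [_ dg _] := solx t; apply: is_derive_eq dg _.
  by rewrite Om0 mulmx0.
by move=> s t; rewrite [LHS]surjective_pairing [RHS]surjective_pairing (gE s t) !Om0.
Qed.

Lemma D_g_continuous (t : R) : (x s).1 @[s --> t] --> (x t).1.
Proof. by have [_ dg _] := solx t; exact: is_derive_mx_continuous dg. Qed.

(** The equation of motion differentiates [inertia_op J Om] only. For diagonal J this operator
    multiplies the entry (i, j) by the positive number d_i + d_j, so continuity passes to Om. *)
Lemma D_Om_continuous (t : R) : (x s).2 @[s --> t] --> (x t).2.
Proof.
pose d : 'I_4 -> R := fun i => if (i < 2)%N then J1 else J2.
have JE : J = diag_mx (\row_i d i).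
  apply/matrixP => i j; rewrite /cyl_mass.
  have [i' ->|i' ->] := @split_ordP 2 2 i; have [j' ->|j' ->] := @split_ordP 2 2 j.
  - by rewrite (@block_mxEul _ 2 2 2 2) !mxE (inj_eq (@lshift_inj 2 2)) /d/= ltn_ord.
  - by rewrite (@block_mxEur _ 2 2 2 2) !mxE (@eq_lrshift 2 2).
  - by rewrite (@block_mxEdl _ 2 2 2 2) !mxE (@eq_rlshift 2 2).
  - by rewrite (@block_mxEdr _ 2 2 2 2) !mxE (inj_eq (@rshift_inj 2 2)) /d/=.
have d0 i : 0 < d i by rewrite /d; case: ifP.
have IE s i j : (x s).2 i j = (d i + d j)^-1 * inertia_op J (x s).2 i j.
  rewrite /inertia_op JE mul_diag_mx mul_mx_diag !mxE [_ * d j]mulrC -mulrDl.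
  by rewrite mulKf// gt_eqF// addr_gt0.
have [_ _ [lam dI]] := solx t; have Ic := is_derive_mx_continuous dI.
apply: mx_continuous => i j; under eq_fun do rewrite IE; rewrite IE.
by apply: cvgMl_tmp; exact: entry_continuous Ic.
Qed.

Lemma D_continuous (t : R) : x s @[s --> t] --> x t.
Proof.
have := pair_continuous (@D_g_continuous t) (@D_Om_continuous t).
by rewrite -surjective_pairing; under eq_fun do rewrite -surjective_pairing.
Qed.

Lemma D_det_constant s t : \det (x s).1 = \det (x t).1.
Proof.
apply: (@sign_constant _ (fun t => \det (x t).1)) => {s}t.
  by apply: det_continuous; exact: D_g_continuous.
by rewrite expr2 -{1}det_tr -det_mulmx ox det1.
Qed.

(** Undoing the turn on the translate by T gives a second solution over the same reduced curve, and
    [D_same_projection] supplies the constant space factor. *)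
Lemma D_floquet T a b : (forall t, y (t + T) = turn_T a b (y t)) ->
  exists A, [/\ orthogonal_mx A, \det A = 1, A *m ebasis R 0 = ebasis R 0,
   (forall t, x (t + T) = (A *m (x t).1 *m (turn a b)^T, turn a b *m (x t).2 *m (turn a b)^T)) &
   (forall t, A *m (x t).1 = (x (t + T)).1 *m turn a b)].
Proof.
move=> yT; have o := turn_orthogonal a b; have oT := orthogonalT o.
have GT := GRV (turn_GR a b).
have sol' := D_sol_GR (@orthogonal1 R 3) (mul1mx _) GT (D_sol_shift T solx).
have [|OmE [A [oA A0 AE]]] := D_same_projection Jpos solx sol'.
  move=> t; rewrite (proj_GR (@orthogonal1 R 3) (mul1mx _) GT (ox (t + T))).
  by rewrite -/(y (t + T)) yT /= !orthogonalK// -/(y t); case: (y t).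
have AE' t : A *m (x t).1 = (x (t + T)).1 *m turn a b by rewrite -AE mul1mx trmxK.
exists A; split => //.
  (* Turns have determinant 1 and det g is the same at both ends, so det A = 1. *)
  have := congr1 determinant (AE' 0); rewrite !det_mulmx det_turn mulr1.
  rewrite (D_det_constant (0 + T) 0) -[RHS]mul1r => /mulIf; apply.
  by rewrite -unitfE -unitmxE orthogonal_unit.
move=> t; rewrite AE' -mulmxA orthogonal_mxC// mulmx1 -OmE trmxK.
rewrite !mulmxA orthogonal_mxC// mul1mx -mulmxA orthogonal_mxC// mulmx1.
by case: (x (t + T)).
Qed.

Lemma D_monodromy_momentum T a b A : (forall t, y (t + T) = turn_T a b (y t)) ->
  (forall t, A *m (x t).1 = (x (t + T)).1 *m turn a b) ->
  A *m ((x 0).1 *m (y 0).2) = (x 0).1 *m (y 0).2.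
Proof.
move=> yT AE; rewrite mulmxA AE -mulmxA.
have -> : turn a b *m (y 0).2 = (y (0 + T)).2 by rewrite yT.
by have := D_momentum Jpos solx (0 + T) 0.
Qed.

Lemma momentum_perp : dot (ebasis R 0) ((x 0).1 *m (y 0).2) = 0.
Proof. by rewrite dot_mulmx -yq; exact: D_qp. Qed.

Lemma momentum_neq0 : (y 0).2 != 0 -> (x 0).1 *m (y 0).2 != 0.
Proof. by apply: contra => /eqP E; rewrite -(orthogonalK (y 0).2 (ox 0)) E mulmx0. Qed.

Definition turn_D (Q : 'M[R]_4) (a0 a b : R) (z : full) : full :=
  (spin Q a0 *m z.1 *m (turn a b)^T, turn a b *m z.2 *m (turn a b)^T).

Section Action.
Variables (Q : 'M[R]_4) (oQ : orthogonal_mx Q) (Q0 : Q *m ebasis R 0 = ebasis R 0).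

Lemma turn_D_continuous (V : topologicalType) (f0 f g tau : V -> R) (v : V) :
  f0 u @[u --> v] --> f0 v -> f u @[u --> v] --> f v -> g u @[u --> v] --> g v ->
  tau u @[u --> v] --> tau v ->
  turn_D Q (f0 u) (f u) (g u) (x (tau u)) @[u --> v] -->
  turn_D Q (f0 v) (f v) (g v) (x (tau v)).
Proof.
move=> f0v fv gv tv; have tc := turn_continuous fv gv.
have xc : x (tau u) @[u --> v] --> x (tau v).
  by apply: (continuous_comp tv); exact: D_continuous.
have x1c : (x (tau u)).1 @[u --> v] --> (x (tau v)).1.
  by apply: (continuous_comp xc); exact: cvg_fst.
have x2c : (x (tau u)).2 @[u --> v] --> (x (tau v)).2.
  by apply: (continuous_comp xc); exact: cvg_snd.
have sc : spin Q (f0 u) @[u --> v] --> spin Q (f0 v).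
  apply: mulmx_continuous; last exact: cvg_cst.
  apply: mulmx_continuous; first exact: cvg_cst.
  by apply: turn_continuous => //; exact: cvg_cst.
apply: pair_continuous; apply: mulmx_continuous;
  [exact: mulmx_continuous|exact: trmx_continuous|exact: mulmx_continuous|exact: trmx_continuous].
Qed.

Lemma turn_DD a0 a b a0' a' b' (z : full) :
  turn_D Q (a0 + a0') (a + a') (b + b') z = turn_D Q a0 a b (turn_D Q a0' a' b' z).
Proof. by rewrite /turn_D/= spinD// turnD trmx_mul !mulmxA. Qed.

Lemma turn_D_int a0 a b (z : full) : a0 \is a Num.int -> a \is a Num.int ->
  b \is a Num.int -> turn_D Q a0 a b z = z.
Proof.
move=> a0i ai bi; rewrite /turn_D spin_int// turn_int// trmx1 !mul1mx !mulmx1.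
by case: z.
Qed.

Lemma turn_D_sol a0 a b tau : veselova_D_sol J (fun t => turn_D Q a0 a b (x (t + tau))).
Proof.
have := D_sol_GR (spin_orthogonal a0 oQ) (spin_fix0 a0 oQ Q0) (turn_GR a b) solx.
exact: D_sol_shift.
Qed.

Lemma turn_D_proj a0 a b t t' : x t' = turn_D Q a0 a b (x t) -> y t' = turn_T a b (y t).
Proof.
move=> E; rewrite /y E; apply: proj_GR (ox t) => //.
- exact: spin_orthogonal.
- exact: spin_fix0.
- exact: turn_GR.
Qed.

Lemma turn_D_fix a0 a b t : a \is a Num.int -> b \is a Num.int ->
  turn_D Q a0 a b (x t) = x t -> a0 \is a Num.int.
Proof.
move=> ai bi /(congr1 fst); rewrite /turn_D/= turn_int// trmx1 mulmx1 => E.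
by apply: (spin_eq1 oQ); rewrite -[LHS]mulmx1 -(orthogonal_mxC (ox t)) mulmxA E.
Qed.

Lemma turn_T_fix a b t (c : bool) : part c (y t).1 != 0 -> turn_T a b (y t) = y t ->
  (if c then b else a) \is a Num.int.
Proof.
move=> q0 /(congr1 (fun z => part c z.1)); rewrite part_turn.
exact: rot2_fix.
Qed.

Lemma D_torus3 T a0 b : 0 < T -> (forall t, x (t + T) = turn_D Q a0 0 b (x t)) ->
  (forall b' t t', y t' = turn_T 0 b' (y t) -> exists k : int, t' = t + k%:~R * T) ->
  (forall t, part true (y t).1 != 0) -> lies_on_torus (veselova_D_sol J) 3 x.
Proof.
move=> T0 xT ph q0.
apply: (@floquet_torus _ _ _ 2 3 (fun a => turn_D Q (a 0 0) 0 (a 0 1)) x T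
  (\row_i if i == 0 then a0 else b)) => //.
- move=> au; apply: (@turn_D_continuous _ (fun au : 'rV[R]_2 * R => au.1 0 0)
    (fun=> 0) (fun au : 'rV[R]_2 * R => au.1 0 1) (fun au => au.2) au).
  + by apply: entry_continuous; exact: cvg_fst.
  + exact: cvg_cst.
  + by apply: entry_continuous; exact: cvg_fst.
  + exact: cvg_snd.
- by move=> c c' u; rewrite -turn_DD !mxE addr0.
- by move=> c u ci; apply: turn_D_int.
- by move=> t; rewrite xT !mxE.
- by move=> c tau; exact: turn_D_sol.
- by move=> c t t' /turn_D_proj E; exact: ph E.
- move=> c t E; have Ey := turn_D_proj (esym E).
  have b1 := turn_T_fix (q0 t) (esym Ey).
  by apply: ord2P => //; apply: turn_D_fix E.
Qed.

Lemma D_torus4 T a0 a b : 0 < T -> (forall t, x (t + T) = turn_D Q a0 a b (x t)) ->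
  (forall a' b' t t', y t' = turn_T a' b' (y t) -> exists k : int, t' = t + k%:~R * T) ->
  (forall c t, part c (y t).1 != 0) -> lies_on_torus (veselova_D_sol J) 4 x.
Proof.
move=> T0 xT ph q0.
pose i0 : 'I_3 := 0; pose i1 : 'I_3 := 1; pose i2 : 'I_3 := 2%:R.
apply: (@floquet_torus _ _ _ 3 4 (fun a => turn_D Q (a 0 i0) (a 0 i1) (a 0 i2)) x T
  (\row_i if i == i0 then a0 else if i == i1 then a else b)) => //.
- move=> au; apply: (@turn_D_continuous _ (fun au : 'rV[R]_3 * R => au.1 0 i0)
    (fun au : 'rV[R]_3 * R => au.1 0 i1) (fun au : 'rV[R]_3 * R => au.1 0 i2)
    (fun au => au.2) au).
  + by apply: entry_continuous; exact: cvg_fst.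
  + by apply: entry_continuous; exact: cvg_fst.
  + by apply: entry_continuous; exact: cvg_fst.
  + exact: cvg_snd.
- by move=> c c' u; rewrite -turn_DD !mxE.
- by move=> c u ci; apply: turn_D_int.
- by move=> t; rewrite xT !mxE.
- by move=> c tau; exact: turn_D_sol.
- by move=> c t t' /turn_D_proj E; exact: ph E.
- move=> c t E; have Ey := turn_D_proj (esym E).
  have b1 := turn_T_fix (q0 true t) (esym Ey).
  have a1 := turn_T_fix (q0 false t) (esym Ey).
  have a01 := turn_D_fix a1 b1 E.
  have iE (i : 'I_3) : [\/ i = i0, i = i1 | i = i2].
    by case: i => [[|[|[|//]]] lti]; [apply: Or31|apply: Or32|apply: Or33]; exact: val_inj.
  by move=> i; case: (iE i) => ->.
Qed.

Lemma D_torus2 T b : 0 < T -> (forall t, x (t + T) = turn_D Q 0 0 b (x t)) ->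
  (forall b' t t', y t' = turn_T 0 b' (y t) -> exists k : int, t' = t + k%:~R * T) ->
  (forall t, part true (y t).1 != 0) -> lies_on_torus (veselova_D_sol J) 2 x.
Proof.
move=> T0 xT ph q0.
apply: (@floquet_torus _ _ _ 1 2 (fun a => turn_D Q 0 0 (a 0 0)) x T (const_mx b)) => //.
- move=> au; apply: (@turn_D_continuous _ (fun=> 0) (fun=> 0)
    (fun au : 'rV[R]_1 * R => au.1 0 0) (fun au => au.2) au).
  + exact: cvg_cst.
  + exact: cvg_cst.
  + by apply: entry_continuous; exact: cvg_fst.
  + exact: cvg_snd.
- by move=> c c' u; rewrite -turn_DD !mxE !addr0.
- by move=> c u ci; apply: turn_D_int.
- by move=> t; rewrite xT !mxE.
- by move=> c tau; exact: turn_D_sol.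
- by move=> c t t' /turn_D_proj E; exact: ph E.
- move=> c t E i; have Ey := turn_D_proj (esym E).
  by rewrite ord1; exact: (turn_T_fix (q0 t) (esym Ey)).
Qed.

End Action.

Lemma D_monodromy T a b : (forall t, y (t + T) = turn_T a b (y t)) -> (y 0).2 != 0 ->
  exists Q a0, [/\ orthogonal_mx Q, Q *m ebasis R 0 = ebasis R 0,
    (exists2 r, r != 0 & Q *m ((x 0).1 *m (y 0).2) = r *: ebasis R 1),
    (forall t, x (t + T) = turn_D Q a0 a b (x t)) &
    (forall t, spin Q a0 *m (x t).1 = (x (t + T)).1 *m turn a b)].
Proof.
move=> yT p0; have [A [oA dA A0 xA AE]] := D_floquet yT.
have Au := D_monodromy_momentum yT AE.
have u0 := momentum_neq0 p0.
have [Q [a0 [oQ Q0 Qu AQ]]] := spin_axis oA dA A0 Au u0 momentum_perp.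
exists Q, a0; split => //; last 2 first.
- by move=> t; rewrite xA AQ.
- by move=> t; rewrite -AE AQ.
by eexists; last exact: Qu; rewrite gt_eqF// sqrtr_gt0 dot_gt0.
Qed.

(* A body vector orthogonal to the motion is also fixed in space; together with
   e_1 and the momentum this leaves no room for a nontrivial monodromy. *)
Lemma D_trivial_monodromy T b n : (forall t, y (t + T) = turn_T 0 b (y t)) ->
  (y 0).2 != 0 -> n != 0 -> part true n = 0 -> (forall t, dot (y t).1 n = 0) ->
  dot (y 0).2 n = 0 ->
  (forall t, (x t).1 *m n = (x 0).1 *m n) /\
  forall t, x (t + T) = turn_D 1%:M 0 0 b (x t).
Proof.
move=> yT p0 n0 nT qn pn.
(* As q.n stays 0, the velocity is orthogonal to [n] as well; hence Om n = 0 and g n does not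
   move. *)
have gn : forall s t, (x s).1 *m n = (x t).1 *m n.
  apply: is_derive0_mx_cst => t; have [_ dg _] := solx t.
  apply: is_derive_eq; first exact: (is_derive_mulmxr n dg).
  have d1 : is_derive t (1 : R) (fun s => n^T *m (y s).1) 0.
    rewrite (_ : (fun s => _) = cst 0); first exact: is_derive_cst.
    by apply/funext => s; rewrite dot_mx dotC qn; apply/matrixP => i j; rewrite !mxE mul0rn.
  have [_ dq _] := soly t.
  have := is_derive_unique (is_derive_mulmxl n^T dq) d1.
  rewrite -/(velocity _ _ _) => vn; rewrite -mulmxA (D_Om Jpos solx t) wedge_mulmx.
  rewrite -/(y t) qn scale0r subr0 dotC /dot vn mxE scale0r mulmx0//.
have [Q [a0 [oQ Q0 [r r0 Qu] xT AE]]] := D_monodromy yT p0.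
split=> [t|]; first exact: gn.
pose m := Q *m ((x 0).1 *m n).
have m0 : m != 0.
  apply: contra n0 => /eqP m0.
  by rewrite -(orthogonalK n (ox 0)) -(orthogonalK (_ *m n) oQ) -/m m0 !mulmx0.
have mf : turn 0 a0 *m m = m.
  have E : spin Q a0 *m ((x 0).1 *m n) = (x 0).1 *m n.
    by rewrite mulmxA AE -mulmxA turn_fix// (gn _ 0).
  by rewrite -{2}/m /m -{2}E /spin !mulmxA orthogonal_mxC// mul1mx.
have me0 : dot (ebasis R 0) m = 0.
  by rewrite -Q0 orthogonal_dot// dot_mulmx -yq qn.
have me1 : dot (ebasis R 1) m = 0.
  apply: (mulfI r0); rewrite mulr0 -dotZl -Qu orthogonal_dot// orthogonal_dot//; exact: ox.
have mp : part false m = 0.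
  have eE (k : 'I_4) : dot (ebasis R k) m = m k 0.
    rewrite dotE (bigD1 k)//= [X in _ + X]big1 ?addr0 => [|i ir].
      by rewrite mxE !eqxx mul1r.
    by rewrite mxE (negPf ir) mul0r.
  have pE (v : 'cV[R]_4) (j : 'I_2) : part false v j 0 = v (lshift 2 j : 'I_4) 0.
    by rewrite /part /fst2 mxE.
  apply: col2P; rewrite pE [RHS]mxE.
    by rewrite -[RHS]me0 eE; congr (fun_of_matrix m _ _); exact: val_inj.
  by rewrite -[RHS]me1 eE; congr (fun_of_matrix m _ _); exact: val_inj.
have a0i : a0 \is a Num.int.
  have mt : part true m != 0.
    by apply: contra m0 => /eqP mt; apply/eqP/part_inj => -[]; rewrite part0.
  by apply: (rot2_fix mt); rewrite -[in RHS]mf part_turn.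
move=> t; rewrite xT /turn_D spin_int// spin_int//; exact: orthogonal1.
Qed.

End Reconstruction.

(** * Spans of two vectors *)

Section Planes.
Variable R : realType.

Lemma char_poly_scalar n (a : R) : char_poly (a%:M : 'M[R]_n) = ('X - a%:P) ^+ n.
Proof.
rewrite /char_poly /char_poly_mx map_scalar_mx /= -raddfB/= det_scalar//.
Qed.

Lemma rank_orthogonal_pair (q p : 'cV[R]_4) : dot q q = 1 -> dot q p = 0 -> p != 0 ->
  \rank (q^T + p^T)%MS = 2%N.
Proof.
move=> qq qp p0; have pp : dot p p != 0 by rewrite gt_eqF// dot_gt0.
rewrite addsmxE; apply/eqP; rewrite -/(row_free (col_mx q^T p^T)); apply/row_freeP.
exists (row_mx q ((dot p p)^-1 *: p)).
rewrite mul_col_row -!scalemxAr !dot_mx qq qp (dotC p q) qp raddf0 scaler0.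
by rewrite scale_scalar_mx mulVf// -scalar_mx_block.
Qed.

Lemma cross_colinear (a b : 'cV[R]_2) : cross a b = 0 -> ~ (a = 0 /\ b = 0) ->
  exists (d : 'cV[R]_2) (s r : R), [/\ d != 0, a = s *: d & b = r *: d].
Proof.
move=> ab nz; have [b0|b0] := eqVneq b 0.
  have a0 : a != 0 by apply/eqP => a0; apply: nz.
  by exists a, 1, 0; rewrite scale1r scale0r.
have : ~~ free [:: a; b] by rewrite free2 ab eqxx.
rewrite free_cons span_seq1 seq1_free b0 andbT negbK => /vlineP[k ->].
by exists b, k, 1; rewrite scale1r.
Qed.

End Planes.

(** * Steady rotations in S_1, S_1' and S_2 *)

Section SteadyRotations.
Variables (R : realType) (J1 J2 : R).
Hypotheses (J1_gt0 : 0 < J1) (J2_gt0 : 0 < J2).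
Local Notation J := (cyl_mass J1 J2).
Local Notation full := ('M[R]_4 * 'M[R]_4)%type.
Let Jpos : symposdef J := cyl_symposdef J1_gt0 J2_gt0.
Let S_gt0 : 0 < J1 + J2. Proof. exact: addr_gt0. Qed.
Variables (x : R -> full) (solx : veselova_D_sol J x).
Let y t := veselova_proj J (x t).
Let soly : veselova_T_sol J y := D_proj_sol Jpos solx.

Definition mass (c : bool) : R := if c then J2 else J1.

Lemma cyl_eigen c (v : 'cV[R]_4) : part (~~ c) v = 0 -> J *m v = mass c *: v.
Proof.
move=> v0; apply: part_inj => c'; rewrite part_block partZ.
have [->|->] : c' = c \/ c' = ~~ c by case: (c) c' => -[]; auto.
  by case: (c); rewrite mul_scalar_mx.
by rewrite v0 mulmx0 scaler0.
Qed.

Lemma cyl_eigen_row c (v : 'cV[R]_4) : part (~~ c) v = 0 ->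
  (v^T <= eigenspace J (mass c))%MS.
Proof.
by move=> v0; apply/eigenspaceP; rewrite -[J]Jpos.1 -trmx_mul (cyl_eigen v0) linearZ.
Qed.

(** When the velocity is k p, Om = k (q ^ p), writing ^ for the wedge. Its derivative consists of
    multiples of p ^ p and q ^ q and vanishes. *)
Lemma steady_rotation (k t0 : R) (Pi : 'M[R]_4) :
  (forall t, velocity J (y t).1 (y t).2 = k *: (y t).2) -> k != 0 -> (y t0).2 != 0 ->
  (Pi :=: (y t0).1^T + (y t0).2^T)%MS -> stablemx Pi J -> steady_rotation_in J Pi x.
Proof.
move=> vE k0 p0 PiE Pist; have [qq qp] := T_cotangent soly t0.
have OmE t : (x t).2 = k *: wedge (y t).1 (y t).2.
  by rewrite (D_Om Jpos solx) -/(y t) vE wedgeZr.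
have WC : forall s t, wedge (y s).1 (y s).2 = wedge (y t).1 (y t).2.
  apply: is_derive0_mx_cst => t; have [_ dq dp] := soly t.
  rewrite -/(velocity _ _ _) vE in dq.
  apply: is_derive_eq; first exact: (is_derive1B (is_derive_mulmx dq (is_derive_trmx dp))
    (is_derive_mulmx dp (is_derive_trmx dq))).
  by rewrite !linearZ/= -!scalemxAl [X in _ - X]addrC subrr.
split => //.
  by split => //; rewrite PiE; exact: rank_orthogonal_pair.
exists (x t0).2; split.
- rewrite OmE scaler_eq0 negb_or k0; apply: contra p0 => /eqP W0.
  have := wedge_mulmx (y t0).1 (y t0).2 (y t0).1.
  by rewrite W0 mul0mx dotC qp qq scale0r scale1r sub0r => /eqP; rewrite eq_sym oppr_eq0.
- by move=> t; rewrite !OmE (WC t t0).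
- by exists k, (y t0).1, (y t0).2.
Qed.

Lemma pure_steady_rotation c t0 : part (~~ c) (y t0).1 = 0 -> part (~~ c) (y t0).2 = 0 ->
  part c (y t0).2 != 0 ->
  is_relative_equilibrium (@orbit_D R) x /\
  exists Pi, [/\ steady_rotation_in J Pi x, pure_plane J Pi &
                 moment_of_inertia J Pi (2 * mass c)].
Proof.
move=> q0 p0 p1; have p1' : part (~~ ~~ c) (y t0).2 != 0 by rewrite negbK.
have [Z qn rn req] := planar_relative_equilibrium J1_gt0 J2_gt0 soly q0 p0 p1'.
split; first by apply/(relative_equilibrium_D J1_gt0 J2_gt0 solx).
have pn0 : (y t0).2 != 0 by apply: contra p1 => /eqP ->; rewrite part0.
pose Pi : 'M[R]_4 := ((y t0).1^T + (y t0).2^T)%MS.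
have PiE : (Pi <= eigenspace J (mass c))%MS.
  by rewrite addsmx_sub !cyl_eigen_row.
have rk : \rank Pi = 2%N.
  by have [qq qp] := T_cotangent soly t0; exact: rank_orthogonal_pair.
have Pist : stablemx Pi J.
  by move/eigenspaceP : PiE => ->; exact: scalemx_sub.
(* This is [den c] at |q_c| = 1, equal to twice the eigenvalue of the surviving half; its reciprocal
   is the factor k between velocity and momentum. *)
have D0 : J1 + J2 + gap J1 J2 c != 0.
  have -> : J1 + J2 + gap J1 J2 c = 2 * mass c by rewrite /gap /mass; case: (c); ring.
  by rewrite gt_eqF// mulr_gt0// /mass; case: (c).
exists Pi; split; last 2 first.
- by exists (mass c).
- exists (mass c), (mass c); split; last by rewrite mulr_natl mulr2n.
  rewrite (@conjmx_eigenvalue _ _ _ (mass c)) ?row_base_free ?eq_row_base//.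
  by rewrite char_poly_scalar rk expr2.
apply: (@steady_rotation ((J1 + J2 + gap J1 J2 c)^-1) t0) => //; last by rewrite invr_eq0.
move=> t; apply: part_inj => c'; rewrite partZ part_velocity//; last exact: T_cotangent soly t.
have [->|->] : c' = ~~ c \/ c' = c by case: (c) c' => -[]; auto.
  have [z1 z2] := Z t; apply: col2P; rewrite !mxE z1 z2 !mxE/=.
    by rewrite mulr0 addr0 !mulr0.
  by rewrite oppr0 mulr0 addr0 !mulr0.
have := qn t; have := rn t; rewrite !negbK => rt qt.
rewrite /den qt mulr1; move: rt qt; rewrite /qdotp /qsq /area.
have S0 : J1 + J2 != 0 by rewrite gt_eqF.
move: (part c (y t).1) (part c (y t).2) (gap J1 J2 c) D0 => q p d D0 rt qt.
(* With |q| = 1 and q.p = 0, p is the area times q turned by a right angle. *)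
have E0 : p 0 0 = - (q 0 0 * p 1 0 - q 1 0 * p 0 0) * q 1 0.
  transitivity (p 0 0 * (q 0 0 ^+ 2 + q 1 0 ^+ 2) - q 0 0 * (q 0 0 * p 0 0 + q 1 0 * p 1 0)).
    by rewrite qt rt; ring.
  ring.
have E1 : p 1 0 = (q 0 0 * p 1 0 - q 1 0 * p 0 0) * q 0 0.
  transitivity (p 1 0 * (q 0 0 ^+ 2 + q 1 0 ^+ 2) - q 1 0 * (q 0 0 * p 0 0 + q 1 0 * p 1 0)).
    by rewrite qt rt; ring.
  ring.
move: (q 0 0 * p 1 0 - q 1 0 * p 0 0) E0 E1 => l E0 E1.
apply: col2P; rewrite !mxE/=.
  by rewrite E0; field; rewrite S0 D0.
by rewrite E1; field; rewrite S0 D0.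
Qed.

(** Zero area puts q_j and p_j on one line in each half. The two lines span the plane of q and p,
    and without the area terms the velocity is p / S. *)
Lemma mixed_steady_rotation t0 : (forall c, area c (y t0) = 0) ->
  (forall c, ~ (part c (y t0).1 = 0 /\ part c (y t0).2 = 0)) -> (y t0).2 != 0 ->
  exists Pi, steady_rotation_in J Pi x /\ mixed_plane J J1 J2 Pi.
Proof.
move=> a0 nz p0; have [qq qp] := T_cotangent soly t0.
have [d1 [s1 [r1 [d10 q1 p1]]]] := cross_colinear (a0 false) (nz false).
have [d2 [s2 [r2 [d20 q2 p2]]]] := cross_colinear (a0 true) (nz true).
pose w1 : 'cV[R]_4 := col_mx d1 (0 : 'cV[R]_2).
pose w2 : 'cV[R]_4 := col_mx (0 : 'cV[R]_2) d2.
have qE : (y t0).1 = s1 *: w1 + s2 *: w2.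
  by apply: part_inj => -[]; rewrite partD !partZ !part_col scaler0 ?addr0 ?add0r.
have pE : (y t0).2 = r1 *: w1 + r2 *: w2.
  by apply: part_inj => -[]; rewrite partD !partZ !part_col scaler0 ?addr0 ?add0r.
have e1 : (w1^T <= eigenspace J J1)%MS by apply: (@cyl_eigen_row false); rewrite part_col.
have e2 : (w2^T <= eigenspace J J2)%MS by apply: (@cyl_eigen_row true); rewrite part_col.
pose Pi : 'M[R]_4 := ((y t0).1^T + (y t0).2^T)%MS.
have rk : \rank Pi = 2%N by exact: rank_orthogonal_pair.
have sub : (Pi <= w1^T + w2^T)%MS.
  by rewrite addsmx_sub qE pE !linearD/= !linearZ/= !addmx_sub_adds ?scalemx_sub.
(* A subspace of rank 2 inside a sum of two lines is the whole sum. *)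
have PiE : (Pi :=: w1^T + w2^T)%MS.
  apply/eqmxP; rewrite sub -(geq_leqif (mxrank_leqif_sup sub)) rk.
  rewrite (leq_trans (mxrank_adds_leqif _ _))//.
  by rewrite (leq_add (rank_leq_row _) (rank_leq_row _)).
have Pist : stablemx Pi J.
  rewrite (eqmxMr J PiE) PiE addsmxMr.
  move/eigenspaceP : e1 => ->; move/eigenspaceP : e2 => ->.
  by apply: addsmxS; exact: scalemx_sub.
exists Pi; split; last first.
  exists w1^T, w2^T; split => //.
    rewrite trmx_eq0; apply: contra d10 => /eqP w0.
    by have := part_col false d1 0; rewrite -/w1 w0 part0 => <-.
  rewrite trmx_eq0; apply: contra d20 => /eqP w0.
  by have := part_col true 0 d2; rewrite -/w2 w0 part0 => <-.
apply: (@steady_rotation (J1 + J2)^-1 t0) => //; last by rewrite invr_eq0 gt_eqF.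
move=> t; apply: part_inj => c; rewrite partZ part_velocity//; last exact: T_cotangent soly t.
rewrite (area_const0 J1_gt0 J2_gt0 soly t (a0 c)).
by congr (_ *: _); apply: col2P; rewrite mxE mulr0 !mul0r addr0.
Qed.

End SteadyRotations.

(** * Motions in a three-dimensional subspace *)

Section HyperplaneReduction.
Variables (R : realType) (J3 : 'M[R]_3) (k : R).
Definition extend (v : 'cV[R]_3) : 'cV[R]_4 := col_mx v (0 : 'cV[R]_1).
Definition block31 (M : 'M[R]_3) (D : 'M[R]_1) : 'M[R]_4 := block_mx M 0 0 D.
Local Notation J4 := (block31 J3 k%:M).
Hypothesis (J4pos : symposdef J4).

Lemma dot_extend (v w : 'cV[R]_3) : dot (extend v) (extend w) = dot v w.
Proof.
rewrite !dotE [LHS](@big_split_ord _ _ _ 3 1)/= [X in _ + X]big1 ?addr0 => [|i _].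
  by apply: eq_bigr => i _; rewrite /extend !(@col_mxEu _ 3 1).
by rewrite /extend !(@col_mxEd _ 3 1) mxE mul0r.
Qed.

Lemma block31_extend (M : 'M[R]_3) D v : block31 M D *m extend v = extend (M *m v).
Proof.
by rewrite /block31 /extend (@mul_block_col _ 3 1 3 1 1) !mulmx0 mul0mx !addr0.
Qed.

Lemma block31M (M M' : 'M[R]_3) (D D' : 'M[R]_1) :
  block31 M D *m block31 M' D' = block31 (M *m M') (D *m D').
Proof.
by rewrite /block31 (@mulmx_block _ 3 1 3 1 3 1) !mul0mx !mulmx0 !addr0 !add0r.
Qed.

Lemma block31D (M M' : 'M[R]_3) (D D' : 'M[R]_1) :
  block31 M D + block31 M' D' = block31 (M + M') (D + D').
Proof. by rewrite /block31 (@add_block_mx _ 3 1 3 1) !addr0. Qed.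

Lemma block31N (M : 'M[R]_3) (D : 'M[R]_1) : - block31 M D = block31 (- M) (- D).
Proof. by rewrite /block31 (@opp_block_mx _ 3 1 3 1) !oppr0. Qed.

Lemma block31T (M : 'M[R]_3) (D : 'M[R]_1) : (block31 M D)^T = block31 M^T D^T.
Proof. by rewrite /block31 (@tr_block_mx _ 3 1 3 1) !trmx0. Qed.

Lemma block31_inj (M M' : 'M[R]_3) (D D' : 'M[R]_1) : block31 M D = block31 M' D' -> M = M'.
Proof.
by move=> /(congr1 (@ulsubmx _ 3 1 3 1)); rewrite /block31 !block_mxKul.
Qed.

Lemma extend_inj : injective extend.
Proof. by move=> v w /(congr1 (@usubmx _ 3 1 1)); rewrite /extend !col_mxKu. Qed.

Lemma extendD v w : extend (v + w) = extend v + extend w.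
Proof. by rewrite /extend (@add_col_mx _ 3 1 1) addr0. Qed.

Lemma extendZ (a : R) v : extend (a *: v) = a *: extend v.
Proof. by rewrite /extend (@scale_col_mx _ 3 1 1) scaler0. Qed.

Lemma extendB v w : extend (v - w) = extend v - extend w.
Proof. by rewrite extendD -scaleN1r extendZ scaleN1r. Qed.

Lemma extend_neq0 v : v != 0 -> extend v != 0.
Proof.
apply: contra => /eqP v0; apply/eqP/extend_inj; rewrite v0.
by rewrite /extend [RHS](@col_mx0 _ 3 1).
Qed.

Lemma symposdef_block31 : symposdef J3.
Proof.
split; first by have := J4pos.1; rewrite block31T => /block31_inj.
move=> a a0; have := J4pos.2 _ (extend_neq0 a0).
by rewrite block31_extend dot_extend.
Qed.

Lemma Cmx_extend q w : q != 0 -> Cmx J4 (extend q) *m extend w = extend (Cmx J3 q *m w).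
Proof.
move=> q0; have := metric_unit J4pos (extend_neq0 q0).
have := metric_unit symposdef_block31 q0.
rewrite /Cmx block31_extend dot_extend; set K := dot q _ => U3 U4.
have E : J4 + K%:M = block31 (J3 + K%:M) (k%:M + K%:M).
  by rewrite -block31D /block31 -(@scalar_mx_block _ 3 1).
rewrite -{1}[w](mulKVmx U3) -(block31_extend (J3 + K%:M) (k%:M + K%:M)) -E mulKmx//.
Qed.

Lemma velocity_extend q p : q != 0 ->
  velocity J4 (extend q) (extend p) = extend (velocity J3 q p).
Proof.
by move=> q0; rewrite /velocity !Cmx_extend// !dot_extend -extendZ -extendB Cmx_extend.
Qed.

Lemma energy_extend q p : q != 0 -> energy J4 (extend q) (extend p) = energy J3 q p.
Proof. by move=> q0; rewrite /energy !Cmx_extend// !dot_extend. Qed.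

Lemma is_derive_extend (f : R -> 'cV[R]_3) df t :
  is_derive t (1 : R) (fun s => extend (f s)) (extend df) -> is_derive t (1 : R) f df.
Proof.
move=> /is_derive_mxP H; apply/is_derive_mxP => i j.
have := H (lshift 1 i) j; rewrite /extend (@col_mxEu _ 3 1).
by under eq_fun do rewrite (@col_mxEu _ 3 1).
Qed.

Lemma T_sol_extend (z : R -> 'cV[R]_3 * 'cV[R]_3) :
  veselova_T_sol J4 (fun t => (extend (z t).1, extend (z t).2)) -> veselova_T_sol J3 z.
Proof.
move=> sol t; have [[/= qq qp] dq dp] := sol t; rewrite !dot_extend in qq qp.
have q0 : (z t).1 != 0.
  by apply/eqP => q0; move/eqP: qq; rewrite q0 /dot mulmx0 mxE eq_sym oner_eq0.
split => //.
  by apply: is_derive_extend; rewrite -/(velocity _ _ _) -velocity_extend.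
by apply: is_derive_extend; rewrite extendZ -energy_extend.
Qed.

Lemma is_derive_block31 (f : R -> 'M[R]_3) df (D : R -> 'M[R]_1) dD t :
  is_derive t (1 : R) (fun s => block31 (f s) (D s)) (block31 df dD) -> is_derive t (1 : R) f df.
Proof.
move=> /is_derive_mxP H; apply/is_derive_mxP => i j.
have := H (lshift 1 i) (lshift 1 j); rewrite /block31 (@block_mxEul _ 3 1 3 1).
by under eq_fun do rewrite (@block_mxEul _ 3 1 3 1).
Qed.

Lemma inertia_block31 M : inertia_op J4 (block31 M 0) = block31 (inertia_op J3 M) 0.
Proof. by rewrite /inertia_op !block31M block31D mulmx0 mul0mx addr0. Qed.

Lemma ebasis_extend : ebasis R 0 = extend (ebasis R 0).
Proof.
apply/matrixP => i j; rewrite ord1 /extend.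
have [i' ->|i' ->] := @split_ordP 3 1 i.
  by rewrite (@col_mxEu _ 3 1) !mxE; congr ((_ && _)%:R).
by rewrite (@col_mxEd _ 3 1) !mxE; congr ((_ && _)%:R).
Qed.

Lemma wedge_extend v w : wedge (extend v) (extend w) = block31 (wedge v w) 0.
Proof.
have H (a b : 'cV[R]_3) : extend a *m (extend b)^T = block31 (a *m b^T) 0.
  by rewrite /extend (@tr_col_mx _ 3 1) (@mul_col_row _ 3 1 1 3 1) !trmx0 !mulmx0 !mul0mx.
by rewrite /wedge !H block31N block31D oppr0 addr0.
Qed.

(** The upper left block of an antisymmetric matrix that kills an extended q is antisymmetric and
    kills q, so the reaction restricts to an admissible one. *)
Lemma D_sol_extend (z : R -> 'M[R]_3 * 'M[R]_3) :
  veselova_D_sol J4 (fun t => (block31 (z t).1 1%:M, block31 (z t).2 0)) ->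
  veselova_D_sol J3 z.
Proof.
move=> /[dup] sol4 /veselova_D_solP sol; apply/veselova_D_solP => t.
have [[/= og OT _] dg [dI [dIE]]] := sol t; cbv zeta => -[NT Nq].
have og3 : orthogonal_mx (z t).1.
  by have := og; rewrite /orthogonal_mx block31T block31M (@scalar_mx_block _ 3 1) => /block31_inj.
have OT3 : (z t).2^T = - (z t).2.
  by have := OT; rewrite block31T block31N => /block31_inj.
have qE : poisson 0 (block31 (z t).1 1%:M) = extend (poisson 0 (z t).1).
  by rewrite (poissonE 0 og) (poissonE 0 og3) ebasis_extend block31T block31_extend.
split.
(* The witness is again [- (Om q)], which stays in the subspace. *)
- split => //; exists (- ((z t).2 *m poisson 0 (z t).1)).
  have := D_Om_wedge sol4 t; rewrite /= qE block31_extend -scaleN1r -extendZ scaleN1r.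
  by rewrite wedge_extend => /block31_inj.
- by apply: is_derive_block31; move: dg; rewrite block31M; exact: id.
pose dI3 : 'M[R]_3 := @ulsubmx _ 3 1 3 1 dI.
have dI3E : is_derive t (1 : R) (fun s => inertia_op J3 (z s).2) dI3.
  move/is_derive_mxP : dIE => H; apply/is_derive_mxP => i j.
  have := H (lshift 1 i) (lshift 1 j).
  under eq_fun do rewrite inertia_block31 /block31 (@block_mxEul _ 3 1 3 1).
  by rewrite [dI3 i j]mxE [in X in _ -> X]mxE.
exists dI3; split => //.
set N := dI - _ in NT Nq; set N3 := dI3 - _.
have N3E : @ulsubmx _ 3 1 3 1 N = N3.
  have uB (X Y : 'M[R]_4) : @ulsubmx _ 3 1 3 1 (X - Y) =
      @ulsubmx _ 3 1 3 1 X - @ulsubmx _ 3 1 3 1 Y.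
    by apply/matrixP => i j; rewrite !mxE.
  have uK M D : @ulsubmx _ 3 1 3 1 (block31 M D) = M by exact: block_mxKul.
  by rewrite /N /N3 inertia_block31 !block31M !uB !uK.
split.
  by rewrite -N3E (@trmx_ulsub _ 3 1 3 1) NT; apply/matrixP => i j; rewrite !mxE.
move: Nq; rewrite /= qE -[N](@submxK _ 3 1 3 1) /extend (@mul_block_col _ 3 1 3 1 1).
rewrite !mulmx0 !addr0 N3E => /(congr1 (@usubmx _ 3 1 1)); rewrite col_mxKu => ->.
by apply/matrixP => i j; rewrite !mxE.
Qed.

End HyperplaneReduction.

Section Axisymmetric.
Variables (R : realType).

(* The body basis (e_1, e_3, e_4, e_2): the last vector is normal to the
   three-dimensional subspace of the motion. *)
Definition reorder_index (i : 'I_4) : 'I_4 :=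
  match val i with 0%N => inord 0 | 1%N => inord 2 | 2%N => inord 3 | _ => inord 1 end.
Definition reorder : 'M[R]_4 := \matrix_(i, j) (j == reorder_index i)%:R.

Lemma reorder_index_inj : injective reorder_index.
Proof.
have inj : forall i j : 'I_4, val (reorder_index i) = val (reorder_index j) -> i = j.
  move=> [[|[|[|[|//]]]] lti] [[|[|[|[|//]]]] ltj];
    by rewrite /reorder_index/= !inordK// => _; exact: val_inj.
by move=> i j ij; apply: inj; rewrite ij.
Qed.

Lemma reorder_mul n (M : 'M[R]_(4, n)) i j : (reorder *m M) i j = M (reorder_index i) j.
Proof.
rewrite mxE (bigD1 (reorder_index i))//= [X in _ + X]big1 ?addr0 => [|k ki].
  by rewrite mxE eqxx mul1r.
by rewrite mxE (negPf ki) mul0r.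
Qed.

Lemma reorder_conj (M : 'M[R]_4) i j :
  (reorder *m M *m reorder^T) i j = M (reorder_index i) (reorder_index j).
Proof.
have -> : reorder *m M *m reorder^T = (reorder *m (reorder *m M)^T)^T.
  by rewrite trmx_mul trmxK.
by rewrite mxE reorder_mul mxE reorder_mul.
Qed.

Lemma reorder_orthogonal : orthogonal_mx reorder.
Proof.
apply: mulmx1C; rewrite -[reorder in X in X *m _]mulmx1; apply/matrixP => i j.
by rewrite reorder_conj !mxE (inj_eq reorder_index_inj).
Qed.

Lemma reorder_cyl (J1 J2 : R) :
  reorder *m cyl_mass J1 J2 *m reorder^T = block31 (axi_mass J1 J2) J1%:M.
Proof.
have cylE (i j : 'I_4) : cyl_mass J1 J2 i j =
    if i == j then (if (i < 2)%N then J1 else J2) else 0.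
  rewrite /cyl_mass.
  have [i' ->|i' ->] := @split_ordP 2 2 i; have [j' ->|j' ->] := @split_ordP 2 2 j.
  - by rewrite (@block_mxEul _ 2 2 2 2) !mxE (inj_eq (@lshift_inj 2 2)); case: eqP.
  - by rewrite (@block_mxEur _ 2 2 2 2) !mxE (@eq_lrshift 2 2).
  - by rewrite (@block_mxEdl _ 2 2 2 2) !mxE (@eq_rlshift 2 2).
  - by rewrite (@block_mxEdr _ 2 2 2 2) !mxE (inj_eq (@rshift_inj 2 2)); case: eqP.
have axiE (i j : 'I_3) : axi_mass J1 J2 i j =
    if i == j then (if (i < 1)%N then J1 else J2) else 0.
  rewrite /axi_mass.
  have [i' ->|i' ->] := @split_ordP 1 2 i; have [j' ->|j' ->] := @split_ordP 1 2 j.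
  - by rewrite (@block_mxEul _ 1 2 1 2) !mxE (inj_eq (@lshift_inj 1 2)); case: eqP.
  - by rewrite (@block_mxEur _ 1 2 1 2) !mxE (@eq_lrshift 1 2).
  - by rewrite (@block_mxEdl _ 1 2 1 2) !mxE (@eq_rlshift 1 2).
  - by rewrite (@block_mxEdr _ 1 2 1 2) !mxE (inj_eq (@rshift_inj 1 2)); case: eqP.
have blockE (i j : 'I_4) : block31 (axi_mass J1 J2) J1%:M i j =
    if i == j then (if (i < 1)%N then J1 else if (i < 3)%N then J2 else J1) else 0.
  rewrite /block31.
  have [i' ->|i' ->] := @split_ordP 3 1 i; have [j' ->|j' ->] := @split_ordP 3 1 j.
  - by rewrite (@block_mxEul _ 3 1 3 1) axiE (inj_eq (@lshift_inj 3 1)); case: eqP.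
  - by rewrite (@block_mxEur _ 3 1 3 1) !mxE (@eq_lrshift 3 1).
  - by rewrite (@block_mxEdl _ 3 1 3 1) !mxE (@eq_rlshift 3 1).
  - by rewrite (@block_mxEdr _ 3 1 3 1) !mxE (inj_eq (@rshift_inj 3 1)); case: eqP.
apply/matrixP => i j; rewrite reorder_conj.
rewrite cylE blockE (inj_eq reorder_index_inj); case: eqP => // _.
by case: i => [[|[|[|[|//]]]] lti]; rewrite /reorder_index/= inordK.
Qed.

Lemma reorder_extend (v : 'cV[R]_4) : part false v 1 0 = 0 ->
  reorder *m v = extend (@usubmx _ 3 1 1 (reorder *m v)).
Proof.
move=> v1; have D0 : @dsubmx _ 3 1 1 (reorder *m v) = 0.
  apply/matrixP => i j; rewrite !ord1 [RHS]mxE mxE reorder_mul -[RHS]v1.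
  rewrite /part /fst2 mxE; congr (fun_of_matrix v _ _).
  by apply: val_inj; rewrite /reorder_index/= inordK.
by rewrite /extend -D0 vsubmxK.
Qed.

Lemma reorder_mulT_last : reorder^T *m ebasis R (rshift 3 (0 : 'I_1) : 'I_4) = ebasis R 1.
Proof.
rewrite -[ebasis R 1](orthogonalK _ reorder_orthogonal); congr (_ *m _).
apply/matrixP => i j; rewrite reorder_mul ord1 !mxE; congr ((_ && _)%:R).
have -> : 1 = reorder_index (rshift 3 (0 : 'I_1)).
  by apply: val_inj; rewrite /reorder_index/= inordK.
by rewrite (inj_eq reorder_index_inj).
Qed.

Lemma block31P (M : 'M[R]_4) (k : R) :
  M *m ebasis R (rshift 3 (0 : 'I_1) : 'I_4) = k *: ebasis R (rshift 3 (0 : 'I_1) : 'I_4) ->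
  M^T *m ebasis R (rshift 3 (0 : 'I_1) : 'I_4) = k *: ebasis R (rshift 3 (0 : 'I_1) : 'I_4) ->
  M = block31 (@ulsubmx _ 3 1 3 1 M) k%:M.
Proof.
move=> Mr Ml.
have cE (i : 'I_4) : M i (rshift 3 (0 : 'I_1)) = k * (i == rshift 3 (0 : 'I_1))%:R.
  by rewrite -mulmx_ebasis Mr !mxE eqxx andbT.
have rE (i : 'I_4) : M (rshift 3 (0 : 'I_1)) i = k * (i == rshift 3 (0 : 'I_1))%:R.
  have <- : M^T i (rshift 3 (0 : 'I_1)) = M (rshift 3 (0 : 'I_1)) i by rewrite mxE.
  by rewrite -mulmx_ebasis Ml !mxE eqxx andbT.
have UR : @ursubmx _ 3 1 3 1 M = 0.
  by apply/matrixP => i j; rewrite ord1 !mxE cE (@eq_lrshift 3 1) mulr0.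
have DL : @dlsubmx _ 3 1 3 1 M = 0.
  by apply/matrixP => i j; rewrite ord1 !mxE rE (@eq_lrshift 3 1) mulr0.
have DR : @drsubmx _ 3 1 3 1 M = k%:M.
  by apply/matrixP => i j; rewrite !ord1 !mxE cE eqxx mulr1.
by rewrite /block31 -UR -DL -DR submxK.
Qed.

End Axisymmetric.

(** * The three-dimensional subspace of a motion in S_3 *)

Section MeridianMotion.
Variables (R : realType) (J1 J2 : R).
Hypotheses (J1_gt0 : 0 < J1) (J2_gt0 : 0 < J2).
Local Notation J := (cyl_mass J1 J2).
Let Jpos : symposdef J := cyl_symposdef J1_gt0 J2_gt0.
Let S_gt0 : 0 < J1 + J2. Proof. exact: addr_gt0. Qed.
Local Notation last := (ebasis R (rshift 3 (0 : 'I_1) : 'I_4)).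

Definition body_frame (a : R) : 'M[R]_4 := reorder R *m turn a 0.

Lemma body_frame_orthogonal a : orthogonal_mx (body_frame a).
Proof. by apply: orthogonalM; [exact: reorder_orthogonal|exact: turn_orthogonal]. Qed.

Lemma body_frame_cyl a :
  body_frame a *m J *m (body_frame a)^T = block31 (axi_mass J1 J2) J1%:M.
Proof.
rewrite /body_frame trmx_mul -reorder_cyl !mulmxA; congr (_ *m _).
by rewrite -!mulmxA (mulmxA (turn _ _)) GR_cyl//; exact: turn_GR.
Qed.

Lemma axi_symposdef : symposdef (block31 (axi_mass J1 J2) J1%:M).
Proof.
by rewrite -(body_frame_cyl 0); apply: symposdef_conj => //; exact: body_frame_orthogonal.
Qed.

Variables (y : R -> 'cV[R]_4 * 'cV[R]_4) (soly : veselova_T_sol J y).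

(** With zero area q_1 and p_1 are combinations of their initial values, which lie on one line; the
    rotation takes this line to the first axis. *)
Lemma S3_meridian t0 : S3 (y t0) ->
  [/\ forall t, area false (y t) = 0, forall t, area true (y t) != 0,
      ~ (part false (y 0).1 = 0 /\ part false (y 0).2 = 0) &
      exists a, forall t, (rot2 a *m part false (y t).1) 1 0 = 0 /\
                          (rot2 a *m part false (y t).2) 1 0 = 0].
Proof.
move=> [[dep nz] ind].
have a0 t : area false (y t) = 0.
  by apply: (area_const0 J1_gt0 J2_gt0 soly t (t0 := t0)); apply/eqP; rewrite -[_ == _]negbK -free2.
have a1 t : area true (y t) != 0.
  by apply: (area_const_neq0 J1_gt0 J2_gt0 soly t (t0 := t0)); rewrite -free2.
have nz0 : ~ (part false (y 0).1 = 0 /\ part false (y 0).2 = 0).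
  move=> [q0 p0]; apply: nz.
  exact: (zero_part_persists J1_gt0 J2_gt0 soly q0 p0 (area_neq0_momentum (a1 0)) t0).
split => //.
have [d [s [r [d0 qE pE]]]] := cross_colinear (a0 0) nz0.
have H0 : 0 < 2 * energy J (y 0).1 (y 0).2.
  by apply: T_energy_gt0 => //; exact: area_neq0_momentum (a1 0).
have dd : 0 < dot d d by exact: dot_gt0.
pose e := Num.sqrt (dot d d); have e0 : 0 < e by rewrite sqrtr_gt0.
have e2 : d 0 0 ^+ 2 + d 1 0 ^+ 2 = e ^+ 2 by rewrite sqr_sqrtr ?ltW// dot2E !expr2.
(* The rotation through minus the polar angle of [d], which annihilates the second coordinate. *)
have [|a [a00 a01 a10 a11]] := @rot2P _ (d 0 0 / e) (- d 1 0 / e).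
  by rewrite !expr_div_n sqrrN -mulrDl e2 divff// expf_neq0// gt_eqF.
exists a => t; rewrite !mxE !sum2E a10 a11.
have [M0 N0] := rectilinear_motion J1_gt0 J2_gt0 soly t 0 H0 (a0 0).
have [M1 N1] := rectilinear_motion J1_gt0 J2_gt0 soly t 1 H0 (a0 0).
rewrite !qE !pE ![(_ *: d) _ _]mxE in M0 M1 N0 N1.
have Sw : (J1 + J2) * Num.sqrt (2 * energy J (y 0).1 (y 0).2 / (J1 + J2)) != 0.
  by rewrite mulf_neq0 ?gt_eqF// sqrtr_gt0 divr_gt0.
move: (cos _) (sin _) ((J1 + J2) * Num.sqrt _) Sw M0 M1 N0 N1 => c n k Sw M0 M1 N0 N1.
split; last by rewrite N0 N1; ring.
apply: (mulfI Sw); rewrite mulr0 mulrDr !(mulrCA k) M0 M1; ring.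
Qed.

Lemma S3_like_3D_T t0 : S3 (y t0) -> like_3D_T J J1 J2 y.
Proof.
move=> /S3_meridian[_ _ _ [a aE]].
have fE v : (rot2 a *m part false v) 1 0 = 0 ->
    body_frame a *m v = extend (@usubmx _ 3 1 1 (body_frame a *m v)).
  by move=> v0; rewrite /body_frame -mulmxA; apply: reorder_extend; rewrite part_turn.
exists (body_frame a), J1, (fun t => (@usubmx _ 3 1 1 (body_frame a *m (y t).1),
  @usubmx _ 3 1 1 (body_frame a *m (y t).2))).
split.
- exact: body_frame_orthogonal.
- exact: body_frame_cyl.
- apply: (T_sol_extend axi_symposdef) => /=.
  have := T_sol_conj Jpos (body_frame_orthogonal a) soly; rewrite body_frame_cyl.
  congr veselova_T_sol; apply/funext => t.
  by rewrite -(fE _ (aE t).1) -(fE _ (aE t).2).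
- by move=> t; split; [exact: fE (aE t).1|exact: fE (aE t).2].
Qed.

(** The unit body vector that [body_frame a] takes to the last basis vector, hence the normal to the
    subspace of the motion. *)
Definition normal (a : R) : 'cV[R]_4 := (turn a 0)^T *m ebasis R 1.

Lemma body_frame_normal a : (body_frame a)^T *m last = normal a.
Proof. by rewrite /body_frame trmx_mul -mulmxA reorder_mulT_last. Qed.

Lemma dot_normal a v : dot v (normal a) = (rot2 a *m part false v) 1 0.
Proof.
rewrite /normal dot_mulmx trmxK dotC dotE.
pose j : 'I_4 := lshift 2 (1 : 'I_2).
have -> : 1 = j by exact: val_inj.
rewrite (bigD1 j)//= [X in _ + X]big1 ?addr0 => [|i ij]; last first.
  by rewrite mxE (negPf ij) mul0r.
rewrite mxE !eqxx mul1r -[rot2 a *m _](@part_turn R false a 0) /part /fst2.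
by rewrite [RHS]mxE.
Qed.

Lemma normal_neq0 a : normal a != 0.
Proof.
apply/eqP => n0; have : dot (normal a) (normal a) = 1.
  by rewrite orthogonal_dot ?dot_ebasis ?eqxx//; apply: orthogonalT; exact: turn_orthogonal.
by rewrite n0 /dot mulmx0 mxE => /eqP; rewrite eq_sym oner_eq0.
Qed.

Lemma normal_part a : part true (normal a) = 0.
Proof. by rewrite /normal turnT part_turn part_ebasis ?mulmx0. Qed.

End MeridianMotion.

(** * Motions in S_3 on D *)

Section MeridianReconstruction.
Variables (R : realType) (J1 J2 : R).
Hypotheses (J1_gt0 : 0 < J1) (J2_gt0 : 0 < J2).
Local Notation J := (cyl_mass J1 J2).
Local Notation full := ('M[R]_4 * 'M[R]_4)%type.
Let Jpos : symposdef J := cyl_symposdef J1_gt0 J2_gt0.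
Local Notation last := (ebasis R (rshift 3 (0 : 'I_1) : 'I_4)).
Variables (x : R -> full) (solx : veselova_D_sol J x).
Let y t := veselova_proj J (x t).
Let soly : veselova_T_sol J y := D_proj_sol Jpos solx.

Lemma S3_D t0 : S3 (y t0) -> lies_on_torus (veselova_D_sol J) 2 x /\ like_3D_D J J1 J2 x.
Proof.
move=> Sy; have [a0 a1 nz0 [a aE]] := S3_meridian J1_gt0 J2_gt0 soly Sy.
have [T [b [T0 yT ph]]] := S3_floquet J1_gt0 J2_gt0 soly nz0 (a0 0) a1.
have p0 : (y 0).2 != 0 := area_neq0_momentum (a1 0).
have qn t : dot (y t).1 (normal a) = 0 by rewrite dot_normal (aE t).1.
have pn : dot (y 0).2 (normal a) = 0 by rewrite dot_normal (aE 0).2.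
have [gn xT] := D_trivial_monodromy J1_gt0 J2_gt0 solx yT p0 (normal_neq0 a) (normal_part a) qn pn.
split.
  apply: (D_torus2 J1_gt0 J2_gt0 solx (@orthogonal1 R 3) (mul1mx _) T0 xT ph).
  by move=> t; exact: area_neq0_q (a1 t).
pose B := body_frame a; have oB : orthogonal_mx B := body_frame_orthogonal a.
have og t : orthogonal_mx (x t).1 := D_orth solx t.
have n1 : dot (normal a) (normal a) = 1.
  by rewrite orthogonal_dot ?dot_ebasis ?eqxx//; apply: orthogonalT; exact: turn_orthogonal.
(* The image g n of the normal is fixed in space and orthogonal to e_1, so it can be moved to the
   last axis with e_1 kept. *)
have [||A [oA An Af]] := @householder R 3 ((x 0).1 *m normal a) last.
- by rewrite orthogonal_dot.
- by rewrite dot_ebasis eqxx.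
have A0 : A *m ebasis R 0 = ebasis R 0.
  apply: Af; last by rewrite dot_ebasis.
  by rewrite dotC dot_mulmx -(D_q solx) qn.
pose x' t : full := (A *m (x t).1 *m B^T, B *m (x t).2 *m B^T).
have sol' : veselova_D_sol (block31 (axi_mass J1 J2) J1%:M) x'.
  by rewrite -(body_frame_cyl J1 J2 a); apply: D_sol_conj.
have gl t : (x' t).1 *m last = last.
  by rewrite /x'/= -!mulmxA body_frame_normal gn An.
(* The last column of g is constant, so g Om kills the last basis vector, and g is invertible. *)
have Oml t : (x' t).2 *m last = 0.
  have [_ dg _] := sol' t; have o' : orthogonal_mx (x' t).1 := D_orth sol' t.
  have d1 := is_derive_mulmxr last dg.
  have d2 : is_derive t (1 : R) (fun s => (x' s).1 *m last) 0.
    by under eq_fun do rewrite gl; exact: is_derive1c.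
  have E := is_derive_unique d1 d2; rewrite -mulmxA in E.
  by rewrite -(orthogonalK ((x' t).2 *m last) o') E mulmx0.
have x1E t : (x' t).1 = block31 (@ulsubmx _ 3 1 3 1 (x' t).1) 1%:M.
  apply: block31P; rewrite scale1r//.
  by rewrite -{1}(gl t) orthogonalK//; exact: D_orth sol' t.
have x2E t : (x' t).2 = block31 (@ulsubmx _ 3 1 3 1 (x' t).2) 0.
  rewrite -(raddf0 (@scalar_mx R 1)); apply: block31P; rewrite scale0r//.
  by rewrite (D_Om_tr sol') mulNmx Oml oppr0.
exists A, B, J1, (fun t => (@ulsubmx _ 3 1 3 1 (x' t).1, @ulsubmx _ 3 1 3 1 (x' t).2)).
split => //.
- exact: body_frame_cyl.
- apply: (D_sol_extend (k := J1)).
  move: sol'; congr veselova_D_sol; apply/funext => t /=.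
  by rewrite -x1E -x2E.
- by move=> t; split; [exact: x1E|exact: x2E].
Qed.

End MeridianReconstruction.

(** * Stability *)

Section Lyapunov.
Variables (R : realType) (J1 J2 : R).
Hypotheses (J1_gt0 : 0 < J1) (J2_gt0 : 0 < J2).
Local Notation J := (cyl_mass J1 J2).
Local Notation phase := ('cV[R]_4 * 'cV[R]_4)%type.
Implicit Types (z : phase) (c : bool).
Let S_gt0 : 0 < J1 + J2. Proof. exact: addr_gt0. Qed.

Definition pair2 (u v : R) : 'cV[R]_2 := \col_i (if i == 0 then u else v).

(* A section of the orbit space over S_4, with [s] = |q_1|^2, [r] = q_1.p_1 and
   [a], [b] the two area integrals. *)
Definition section (s r a b : R) : phase :=
  (col_mx (pair2 (Num.sqrt s) 0) (pair2 (Num.sqrt (1 - s)) 0),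
   col_mx (pair2 (r / Num.sqrt s) (Num.sqrt (a * (J1 + J2 + gap J1 J2 false * s)) / Num.sqrt s))
     (pair2 (- r / Num.sqrt (1 - s))
       (Num.sqrt (b * (J1 + J2 + gap J1 J2 true * (1 - s))) / Num.sqrt (1 - s)))).

Lemma section_cotangent s r a b : 0 < s < 1 -> cotangent_sphere (section s r a b).
Proof.
move=> /andP[s0 s1]; apply/cotangentP; rewrite /qsq /qdotp /section !part_col !mxE/=.
have s1' : 0 < 1 - s by rewrite subr_gt0.
rewrite !sqr_sqrtr ?ltW// expr0n/= !addr0 !mul0r !addr0; split; first by rewrite subrKC.
have n0 : Num.sqrt s != 0 by rewrite gt_eqF// sqrtr_gt0.
have n1 : Num.sqrt (1 - s) != 0 by rewrite gt_eqF// sqrtr_gt0.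
by rewrite ![Num.sqrt _ * (_ / _)]mulrC !divfK// subrr.
Qed.

(** Both points have the same Gram matrices: [section] prescribes |q_c|^2, q_c.p_c and the squared
    areas, and Lagrange's identity gives |p_c|^2. *)
Lemma section_orbit z : cotangent_sphere z -> (forall c, area c z != 0) ->
  orbit_T (section (qsq false z) (qdotp false z) (integral_area J1 J2 false z)
    (integral_area J1 J2 true z)) z.
Proof.
move=> Mz a0; have [s1 r1] := (cotangentP z).1 Mz.
have q0 c : 0 < qsq c z by rewrite -qsq_dot dot_gt0// area_neq0_q.
have D0 c := den_gt0 J1_gt0 J2_gt0 c Mz.
have E1 : 1 - qsq false z = qsq true z by lra.
have E2 : - qdotp false z = qdotp true z by lra.
have aD c : integral_area J1 J2 c z * (J1 + J2 + gap J1 J2 c * qsq c z) = area c z ^+ 2.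
  by rewrite /integral_area -/(den J1 J2 c z) divfK// gt_eqF.
have gq c s : qsq c (section s (qdotp false z) (integral_area J1 J2 false z)
    (integral_area J1 J2 true z)) = Num.sqrt (if c then 1 - s else s) ^+ 2.
  by rewrite /qsq part_col; case: c; rewrite !mxE/= expr0n addr0.
pose w := section (qsq false z) (qdotp false z) (integral_area J1 J2 false z)
    (integral_area J1 J2 true z).
have W c : [/\ part c w.1 = pair2 (Num.sqrt (qsq c z)) 0 &
    part c w.2 = pair2 (qdotp c z / Num.sqrt (qsq c z))
      (Num.sqrt (area c z ^+ 2) / Num.sqrt (qsq c z))].
  by rewrite !part_col; case: c; rewrite ?E1 ?E2 aD.
have n0 c : Num.sqrt (qsq c z) != 0 by rewrite gt_eqF// sqrtr_gt0.
apply: orbit_T_gram => c; have [w1 w2] := W c.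
  have r2 : Num.sqrt (qsq c z) ^+ 2 = qsq c z by rewrite sqr_sqrtr// ltW.
  have l2 : Num.sqrt (area c z ^+ 2) ^+ 2 = area c z ^+ 2 by rewrite sqr_sqrtr// sqr_ge0.
  split; rewrite -/w.
  - by rewrite [RHS]/qsq w1 !mxE/= expr0n addr0 r2.
  - by rewrite [RHS]/qdotp w1 w2 !mxE/= mul0r addr0 mulrC divfK.
  - rewrite [RHS]/psq w2 !mxE/= !expr_div_n -mulrDl l2 r2 lagrange_identity.
    by rewrite mulrAC mulfV ?mul1r// gt_eqF.
left; rewrite -/w area_cross w1 w2 /cross !mxE/= mul0r subr0 mulrC divfK//.
by rewrite sqrtr_sqr normr_eq0.
Qed.

(** Twice the energy, as a function of the invariants. Unlike [force], the functions below take the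
    energy of the point itself and so compare different solutions. *)
Definition energy2 z : R :=
  (psq false z - gap J1 J2 false * integral_area J1 J2 false z) / (J1 + J2) +
  (psq true z - gap J1 J2 true * integral_area J1 J2 true z) / (J1 + J2).
Definition radial_acc z : R :=
  (psq false z - gap J1 J2 false * integral_area J1 J2 false z) / (J1 + J2)
  - energy2 z * qsq false z.
(** Twice the energy being H, this is 2 H times the value of |q_1|^2 at the middle of its
    oscillation. *)
Definition center z : R := radial_acc z + 2 * energy2 z * qsq false z.
(** The squared radius of the circle described by the scaled q_1.p_1 together with the force. *)
Definition amplitude z : R :=
  radial_acc z ^+ 2 + 4 * energy2 z / (J1 + J2) * qdotp false z ^+ 2.

Lemma orbit_invariants z z' : orbit_T z z' ->
  [/\ forall c, integral_area J1 J2 c z' = integral_area J1 J2 c z,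
      energy2 z' = energy2 z, center z' = center z & amplitude z' = amplitude z].
Proof.
move=> E; have inv c := orbit_T_invariants c E.
have ia c : integral_area J1 J2 c z' = integral_area J1 J2 c z.
  have [s r p] := inv c; rewrite /integral_area /den s; congr (_ / _).
  by have := lagrange_identity c z; have := lagrange_identity c z'; rewrite s r p; lra.
have [s0 r0 p0] := inv false; have [s1 r1 p1] := inv true.
have e2 : energy2 z' = energy2 z by rewrite /energy2 !ia p0 p1.
have ra : radial_acc z' = radial_acc z by rewrite /radial_acc e2 ia p0 s0.
by split => //; rewrite /center /amplitude ra e2 ?s0 ?r0.
Qed.

Lemma orbit_area z z' : orbit_T z z' -> forall c, area c z != 0 -> area c z' != 0.
Proof.
move=> E c; have [s r p] := orbit_T_invariants c E.
have := lagrange_identity c z; have := lagrange_identity c z'; rewrite s r p => L L'.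
by apply: contra => /eqP a0; rewrite -sqrf_eq0; apply/eqP; move: L; rewrite a0 expr0n/=; lra.
Qed.

Lemma orbit_cotangent z z' : orbit_T z z' -> cotangent_sphere z -> cotangent_sphere z'.
Proof.
move=> E /cotangentP; have [s0 r0 _] := orbit_T_invariants false E.
have [s1 r1 _] := orbit_T_invariants true E.
by move=> H; apply/cotangentP; rewrite s0 s1 r0 r1.
Qed.

Section AlongSolution.
Variables (y : R -> phase) (soly : veselova_T_sol J y).

Lemma energy2E t : energy2 (y t) = 2 * energy J (y t).1 (y t).2.
Proof.
rewrite cyl_energy//; last exact: T_cotangent soly t.
by rewrite /energy2 big_bool/= addrC.
Qed.

Lemma conserved s t : [/\ forall c, integral_area J1 J2 c (y s) = integral_area J1 J2 c (y t),
  energy2 (y s) = energy2 (y t), center (y s) = center (y t) &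
  amplitude (y s) = amplitude (y t)].
Proof.
have ia c := T_integral_area J1_gt0 J2_gt0 soly c s t.
have e2 u : energy2 (y u) = energy2 (y t).
  by rewrite !energy2E (T_energy J1_gt0 J2_gt0 soly u t).
have hE u : 2 * energy J (y u).1 (y u).2 = energy2 (y t) by rewrite -energy2E e2.
have P := T_planar J1_gt0 J2_gt0 soly false.
split => //.
  rewrite /center /radial_acc !e2.
  exact: (planar_radial_integral S_gt0 P hE s t).
rewrite /amplitude /radial_acc !e2.
exact: (planar_radial_conserved S_gt0 P hE s t).
Qed.

End AlongSolution.

Section Continuity.
Variable w : phase.
Hypothesis Mw : cotangent_sphere w.

Lemma part_continuous (sel : phase -> 'cV[R]_4) c i :
  sel z @[z --> w] --> sel w -> part c (sel z) i 0 @[z --> w] --> part c (sel w) i 0.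
Proof.
move=> selc; have E v : part c v i 0 = v (if c then rshift 2 i else lshift 2 i : 'I_4) 0.
  by case: c; rewrite /part /fst2 /snd2 mxE.
under eq_fun do rewrite E; rewrite E; exact: entry_continuous.
Qed.

Let qc c i : part c z.1 i 0 @[z --> w] --> part c w.1 i 0.
Proof. by apply: part_continuous; exact: cvg_fst. Qed.
Let pc c i : part c z.2 i 0 @[z --> w] --> part c w.2 i 0.
Proof. by apply: part_continuous; exact: cvg_snd. Qed.

Let cvgm (f g : phase -> R) : f z @[z --> w] --> f w -> g z @[z --> w] --> g w ->
  f z * g z @[z --> w] --> f w * g w.
Proof. by move=> fc gc; exact: (cvgM fc gc). Qed.
Let cvga (f g : phase -> R) : f z @[z --> w] --> f w -> g z @[z --> w] --> g w ->
  f z + g z @[z --> w] --> f w + g w.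
Proof. by move=> fc gc; exact: (cvgD fc gc). Qed.
Let cvgn (f : phase -> R) : f z @[z --> w] --> f w -> - f z @[z --> w] --> - f w.
Proof. by move=> fc; exact: (cvgN fc). Qed.
Let cvgc (a : R) : a @[z --> w] --> a. Proof. exact: cvg_cst. Qed.

Lemma qsq_continuous c : qsq c z @[z --> w] --> qsq c w.
Proof. by rewrite /qsq !expr2; under eq_fun do rewrite !expr2; apply: cvga; exact: cvgm. Qed.
Lemma psq_continuous c : psq c z @[z --> w] --> psq c w.
Proof. by rewrite /psq !expr2; under eq_fun do rewrite !expr2; apply: cvga; exact: cvgm. Qed.
Lemma qdotp_continuous c : qdotp c z @[z --> w] --> qdotp c w.
Proof. by apply: cvga; exact: cvgm. Qed.
Lemma area_continuous c : area c z @[z --> w] --> area c w.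
Proof. by apply: cvga; [exact: cvgm|apply: cvgn; exact: cvgm]. Qed.

Lemma integral_area_continuous c :
  integral_area J1 J2 c z @[z --> w] --> integral_area J1 J2 c w.
Proof.
rewrite /integral_area expr2; under eq_fun do rewrite expr2.
have ac := @area_continuous c; apply: cvgm; first exact: cvgm.
apply: cvgV; first by rewrite gt_eqF// den_gt0.
apply: cvga; first exact: cvgc.
by apply: cvgm; [exact: cvgc|exact: qsq_continuous].
Qed.

Lemma energy2_continuous : energy2 z @[z --> w] --> energy2 w.
Proof.
apply: cvga; (apply: cvgm; last exact: cvgc); (apply: cvga; first exact: psq_continuous);
  apply: cvgn; (apply: cvgm; [exact: cvgc|exact: integral_area_continuous]).
Qed.

Lemma radial_acc_continuous : radial_acc z @[z --> w] --> radial_acc w.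
Proof.
apply: cvga.
  apply: cvgm; last exact: cvgc.
  apply: cvga; first exact: psq_continuous.
  by apply: cvgn; apply: cvgm; [exact: cvgc|exact: integral_area_continuous].
by apply: cvgn; apply: cvgm; [exact: energy2_continuous|exact: qsq_continuous].
Qed.

Lemma center_continuous : center z @[z --> w] --> center w.
Proof.
apply: cvga; first exact: radial_acc_continuous.
apply: cvgm; last exact: qsq_continuous.
by apply: cvgm; [exact: cvgc|exact: energy2_continuous].
Qed.

Lemma amplitude_continuous : amplitude z @[z --> w] --> amplitude w.
Proof.
rewrite /amplitude !expr2; under eq_fun do rewrite !expr2.
have rc := radial_acc_continuous; have dc := @qdotp_continuous false.
apply: cvga; first exact: cvgm.
apply: cvgm; last exact: cvgm.
apply: cvgm; last exact: cvgc.
by apply: cvgm; [exact: cvgc|exact: energy2_continuous].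
Qed.

End Continuity.
Section SectionContinuity.
Variables (V : topologicalType) (x : V).

Lemma pair2_continuous (f g : V -> R) : f y @[y --> x] --> f x ->
  g y @[y --> x] --> g x -> pair2 (f y) (g y) @[y --> x] --> pair2 (f x) (g x).
Proof.
move=> fx gx; apply: mx_continuous => i j; rewrite mxE; under eq_fun do rewrite mxE.
by case: (i == 0).
Qed.

Lemma col_continuous (f g : V -> 'cV[R]_2) : f y @[y --> x] --> f x ->
  g y @[y --> x] --> g x ->
  (col_mx (f y) (g y) : 'cV[R]_4) @[y --> x] --> (col_mx (f x) (g x) : 'cV[R]_4).
Proof.
move=> fx gx; apply: mx_continuous => i j.
have [k ->|k ->] := @split_ordP 2 2 i.
  by rewrite (@col_mxEu _ 2 2); under eq_fun do rewrite (@col_mxEu _ 2 2); exact: entry_continuous.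
by rewrite (@col_mxEd _ 2 2); under eq_fun do rewrite (@col_mxEd _ 2 2); exact: entry_continuous.
Qed.

Lemma section_continuous (s r a b : V -> R) : 0 < s x < 1 ->
  s y @[y --> x] --> s x -> r y @[y --> x] --> r x ->
  a y @[y --> x] --> a x -> b y @[y --> x] --> b x ->
  section (s y) (r y) (a y) (b y) @[y --> x] --> section (s x) (r x) (a x) (b x).
Proof.
move=> /andP[s0 s1] sc rc ac bc.
have one_sub : 1 - s y @[y --> x] --> 1 - s x by apply: cvgB => //; exact: cvg_cst.
have sqrtc (f : V -> R) : f y @[y --> x] --> f x ->
    Num.sqrt (f y) @[y --> x] --> Num.sqrt (f x).
  by move=> fc; apply: (continuous_comp fc); exact: sqrt_continuous.
have divc (f g : V -> R) : g x != 0 -> f y @[y --> x] --> f x ->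
    g y @[y --> x] --> g x -> f y / g y @[y --> x] --> f x / g x.
  by move=> g0 fc gc; apply: (cvgM fc); exact: cvgV.
have n0 : Num.sqrt (s x) != 0 by rewrite gt_eqF// sqrtr_gt0.
have n1 : Num.sqrt (1 - s x) != 0 by rewrite gt_eqF// sqrtr_gt0 subr_gt0.
have mc (f g : V -> R) k l : f y @[y --> x] --> f x -> g y @[y --> x] --> g x ->
    f y * (k + l * g y) @[y --> x] --> f x * (k + l * g x).
  move=> fc gc; apply: (cvgM fc); apply: cvgD; first exact: cvg_cst.
  exact: cvgMl_tmp.
apply: pair_continuous; apply: col_continuous; apply: pair2_continuous.
- exact: sqrtc.
- exact: cvg_cst.
- exact: sqrtc.
- exact: cvg_cst.
- by apply: divc => //; exact: sqrtc.
- by apply: divc => //; apply: sqrtc => //; exact: mc.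
- by apply: divc => //; [exact: cvgN|exact: sqrtc].
- by apply: divc => //; apply: sqrtc => //; exact: mc.
Qed.

End SectionContinuity.

Section Stability.
Variables (y : R -> phase) (soly : veselova_T_sol J y).
Hypotheses (y_area : forall c t, area c (y t) != 0)
  (y_radial : forall t, qdotp false (y t) = 0).

(** Coordinates on the orbit space: four constants of motion, and two quantities that oscillate
    within bounds set by the amplitude. [pos] recovers |q_1|^2 by solving the definition of
    [center]. *)
Let coords (z : phase) : 'rV[R]_6 := \row_(i < 6)
  [:: integral_area J1 J2 false z; integral_area J1 J2 true z; energy2 z; center z;
      radial_acc z; qdotp false z]`_i.
Let coord (p : 'rV[R]_6) (i : nat) : R := p 0 (inord i).
Let pos (p : 'rV[R]_6) : R := (coord p 3 - coord p 4) / (2 * coord p 2).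
Let param (p : 'rV[R]_6) : phase := section (pos p) (coord p 5) (coord p 0) (coord p 1).

Let coordE z i : (i < 6)%N -> coord (coords z) i =
  [:: integral_area J1 J2 false z; integral_area J1 J2 true z; energy2 z; center z;
      radial_acc z; qdotp false z]`_i.
Proof. by move=> i6; rewrite /coord mxE inordK. Qed.

Let posE z : energy2 z != 0 -> pos (coords z) = qsq false z.
Proof.
by move=> h0; rewrite /pos !coordE//= /center addrC addKr; field.
Qed.

Let qsq01 z : cotangent_sphere z -> (forall c, area c z != 0) -> 0 < qsq false z < 1.
Proof.
move=> /cotangentP[s1 _] a0.
have q0 c : 0 < qsq c z by rewrite -qsq_dot dot_gt0// area_neq0_q.
by have := q0 true; have := q0 false; lra.
Qed.

Let param_orbit z : cotangent_sphere z -> (forall c, area c z != 0) -> energy2 z != 0 ->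
  cotangent_sphere (param (coords z)) /\ orbit_T (param (coords z)) z.
Proof.
move=> Mz a0 h0; rewrite /param posE// !coordE//=; split; last exact: section_orbit.
exact/section_cotangent/qsq01.
Qed.

Let H0 : 0 < energy2 (y 0).
Proof.
rewrite energy2E//; apply: T_energy_gt0 => //; exact: area_neq0_momentum (y_area false 0).
Qed.

Let acc0 : radial_acc (y 0) = 0.
Proof.
have hE u : 2 * energy J (y u).1 (y u).2 = energy2 (y 0).
  by rewrite -energy2E//; have [] := conserved soly u 0.
have d1 := planar_radial S_gt0 (T_planar J1_gt0 J2_gt0 soly false) hE 0.
have d2 : is_derive (0 : R) (1 : R) (fun s => qdotp false (y s)) 0.
  by under eq_fun do rewrite y_radial; exact: is_derive1c.
exact: is_derive_unique d1 d2.
Qed.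

(** The set [V] is cut out by constants of motion, so solutions cannot leave it. Points of [V] have
    coordinates near those of [y], hence a nearby representative in the section, and invariance of
    [U] extends membership to the whole orbit. *)
Lemma steady_stable :
  orbit_Lyapunov_stable (@cotangent_sphere R 3) (veselova_T_sol J) (@orbit_T R) y.
Proof.
rewrite /orbit_Lyapunov_stable/=; set S := [set _ | _] => U; rewrite /set_nbhd_in => -[UM Unbhd] Uinv.
have My := T_cotangent soly 0.
set p0 := coords (y 0).
have h0 : energy2 (y 0) != 0 by rewrite gt_eqF.
have [Mp0 Ep0] := param_orbit My (y_area^~ 0) h0.
have Sp0 : S (param p0) by exists 0; exact: orbit_T_sym.
have coordc (p : 'rV[R]_6) i : coord q i @[q --> p] --> coord p i.
  exact: coord_continuous.
have paramc : param p @[p --> p0] --> param p0.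
  apply: section_continuous; last 3 first.
  - exact: coordc.
  - exact: coordc.
  - exact: coordc.
  - by rewrite posE//; exact: qsq01.
  - rewrite /pos; have c3 := coordc p0 3%N; have c4 := coordc p0 4%N.
    have c2 := coordc p0 2%N.
    have num : coord q 3 - coord q 4 @[q --> p0] --> coord p0 3 - coord p0 4.
      exact: (cvgB c3 c4).
    have den : 2 * coord q 2 @[q --> p0] --> 2 * coord p0 2 by exact: (cvgMl_tmp c2).
    apply: (cvgM num); apply: cvgV => //.
    by rewrite coordE//= mulf_neq0.
have : nbhs p0 [set p | cotangent_sphere (param p) -> U (param p)].
  exact: (paramc _ (Unbhd _ Sp0)).
move=> /nbhs_ballP[e /= e0 eU].
(* The second bound keeps the energy of nearby points above half that of [y]. *)
pose e1 := Num.min e (energy2 (y 0) / 2).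
have e10 : 0 < e1 by rewrite lt_min e0 divr_gt0.
(* The first term bounds the force by [e]. The second bounds q_1.p_1 by [e], because its square
   enters the amplitude with a coefficient of at least 2 [energy2 (y 0)] / S on [V]. *)
pose eta := Num.min (e ^+ 2) (e ^+ 2 * (2 * energy2 (y 0) / (J1 + J2))).
have eta0 : 0 < eta.
  by rewrite lt_min exprn_gt0//= mulr_gt0 ?exprn_gt0// divr_gt0// mulr_gt0.
pose near0 (f : phase -> R) z := `|f (y 0) - f z| < e1.
pose V := [set z | [/\ cotangent_sphere z, forall c, area c z != 0,
  [/\ near0 (integral_area J1 J2 false) z, near0 (integral_area J1 J2 true) z,
      near0 energy2 z & near0 center z] & amplitude z < eta]].
have VU z : V z -> [/\ 0 < energy2 z & radial_acc z ^+ 2 < e ^+ 2] /\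
    qdotp false z ^+ 2 < e ^+ 2.
  move=> [Mz az [_ _ nh _] am].
  have hz : energy2 (y 0) / 2 < energy2 z.
    have : `|energy2 (y 0) - energy2 z| < energy2 (y 0) / 2.
      by rewrite (lt_le_trans nh)// ge_min lexx orbT.
    by rewrite ltr_norml => /andP[_]; lra.
  have hz0 : 0 < energy2 z by rewrite (lt_trans _ hz)// divr_gt0.
  have k0 : 0 <= 4 * energy2 z / (J1 + J2) * qdotp false z ^+ 2.
    by rewrite mulr_ge0 ?sqr_ge0// divr_ge0 ?ltW// mulr_gt0.
  have am1 : amplitude z < e ^+ 2 by rewrite (lt_le_trans am)// ge_min lexx.
  have am2 : amplitude z < e ^+ 2 * (2 * energy2 (y 0) / (J1 + J2)).
    by rewrite (lt_le_trans am)// ge_min lexx orbT.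
  split; first split => //.
    by rewrite (le_lt_trans _ am1)// lerDl.
  have K0 : 0 < 2 * energy2 (y 0) / (J1 + J2) by rewrite divr_gt0// mulr_gt0.
  rewrite -(ltr_pM2r K0) (le_lt_trans _ am2)//.
  rewrite (@le_trans _ _ (4 * energy2 z / (J1 + J2) * qdotp false z ^+ 2))//; last first.
    by rewrite lerDr sqr_ge0.
  rewrite mulrC ler_wpM2r ?sqr_ge0// ler_pM2r ?invr_gt0//; lra.
exists V; split.
- split; first by move=> z [].
  move=> w [t Ew]; rewrite /within/= .
  have Mw : cotangent_sphere w := orbit_cotangent Ew (T_cotangent soly t).
  have aw c : area c w != 0 := orbit_area Ew (y_area c t).
  have [ia e2 ce am] := orbit_invariants Ew.
  have [ia' e2' ce' am'] := conserved soly t 0.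
  have nearc (f : phase -> R) : f z @[z --> w] --> f w -> f w = f (y 0) ->
      \forall z \near w, near0 f z.
    move=> fc fw; move/cvgrPdist_lt : fc => /(_ _ e10); rewrite fw.
    exact.
  have n1 := nearc _ (@integral_area_continuous w Mw false) (etrans (ia false) (ia' false)).
  have n2 := nearc _ (@integral_area_continuous w Mw true) (etrans (ia true) (ia' true)).
  have n3 := nearc _ (energy2_continuous Mw) (etrans e2 e2').
  have n4 := nearc _ (center_continuous Mw) (etrans ce ce').
  have n5 : \forall z \near w, amplitude z < eta.
    have amw : amplitude w < eta.
      by rewrite am am' /amplitude acc0 y_radial !expr0n/= mulr0 addr0.
    have := amplitude_continuous Mw => /cvgr_lt; exact.
  have na c : \forall z \near w, area c z != 0.
    have := @area_continuous w c => /cvgr_neq0; apply; exact: aw.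
  have n6 := na false; have n7 := na true.
  near=> z => Mz; split => //.
  - by case; [near: z|near: z].
  - by split; near: z.
  - by near: z.
- move=> z z' E [Mz az [n1 n2 n3 n4] am]; have [ia e2 ce am'] := orbit_invariants E.
  split.
  + exact: orbit_cotangent E Mz.
  + by move=> c; exact: (orbit_area E (az c)).
  + by rewrite /near0 !ia e2 ce.
  + by rewrite am'.
move=> z solz [t1 Vz] t; have [Mz1 az1 [n1 n2 n3 n4] am1] := Vz.
have [ia e2 ce am] := conserved solz t t1.
have Vt : V (z t).
  split.
  - exact: T_cotangent solz t.
  - by move=> c; exact: (area_const_neq0 J1_gt0 J2_gt0 solz t (az1 c)).
  - by rewrite /near0 !ia e2 ce.
  - by rewrite am.
have [[ht ft] rt] := VU _ Vt; have [Mt at0 [m1 m2 m3 m4] _] := Vt.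
have [Mp Ep] := param_orbit Mt at0 (lt0r_neq0 ht).
(* It is enough to place the representative of [z t] in [U], by comparing its six coordinates with
   those of [y 0]. *)
apply: Uinv Ep _; apply: eU Mp.
have sq_lt (u : R) : u ^+ 2 < e ^+ 2 -> `|u| < e.
  by rewrite -ltr_sqrt ?exprn_gt0// !sqrtr_sqr (gtr0_norm e0).
have le1 : e1 <= e by rewrite ge_min lexx.
split=> // i j; rewrite ord1 /ball/= !mxE.
case: j => [[|[|[|[|[|[|//]]]]]] ltj] /=; try exact: lt_le_trans le1.
- by rewrite acc0 sub0r normrN sq_lt.
- by rewrite y_radial sub0r normrN sq_lt.
Unshelve. all: by end_near. Qed.

End Stability.
End Lyapunov.

(** * Transport of tori along an injective map *)

Section TorusMap.
Variables (R : realType) (X Y : topologicalType).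
Variables (solX : (R -> X) -> Prop) (solY : (R -> Y) -> Prop) (f : X -> Y).

Lemma lies_on_torus_map d x : continuous f -> injective f ->
  (forall x, solX x -> solY (f \o x)) ->
  lies_on_torus solX d x -> lies_on_torus solY d (f \o x).
Proof.
move=> fc fi fsol [k [phi [w [kd [phic phii phis] [a aE]]]]].
exists k, (f \o phi), w; split => //; last by exists a => t /=; rewrite aE.
split.
- by move=> b; apply: continuous_comp; [exact: phic|exact: fc].
- by move=> b b'; rewrite -phii /=; split => [/fi|->].
- by move=> b; exact: fsol (phis b).
Qed.

End TorusMap.

(** * Exchange of the two planes *)

Section Swap.
Variable R : realType.

(** Conjugation by this involution exchanges J_1 with J_2 and carries S_3' to S_3, so that every
    result on S_3' follows from one on S_3. *)
Definition swap : 'M[R]_4 := block_mx (0 : 'M[R]_2) 1%:M 1%:M (0 : 'M[R]_2).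

Lemma swapT : swap^T = swap.
Proof. by rewrite /swap (@tr_block_mx _ 2 2 2 2) !trmx0 !trmx1. Qed.

Lemma swap2 : swap *m swap = 1%:M.
Proof.
rewrite /swap (@mulmx_block _ 2 2 2 2 2 2) !mul0mx !mulmx0 !mul1mx !addr0 !add0r.
by rewrite -(@scalar_mx_block _ 2 2).
Qed.

Lemma swap_orthogonal : orthogonal_mx swap.
Proof. by rewrite /orthogonal_mx swapT swap2. Qed.

Lemma swap_cyl J1 J2 : swap *m cyl_mass J1 J2 *m swap^T = cyl_mass J2 J1.
Proof.
rewrite swapT /swap /cyl_mass !(@mulmx_block _ 2 2 2 2 2 2).
by rewrite !(mul0mx, mulmx0, mul1mx, mulmx1, addr0, add0r).
Qed.

Lemma part_swap c v : part c (swap *m v) = part (~~ c) v.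
Proof.
rewrite -[v in LHS](@vsubmxK _ 2 2 1) /part /fst2 /snd2 /swap.
rewrite (@mul_block_col _ 2 2 2 2 1) !mul0mx !mul1mx addr0 add0r.
by rewrite (@col_mxKu _ 2 2) (@col_mxKd _ 2 2); case: c.
Qed.

Lemma swapK m (M : 'M[R]_(4, m)) : swap *m (swap *m M) = M.
Proof. by rewrite mulmxA swap2 mul1mx. Qed.

Lemma S3'_swap (z : 'cV[R]_4 * 'cV[R]_4) : S3' z -> S3 (swap *m z.1, swap *m z.2).
Proof.
have E c v : (if c then snd2 (swap *m v) else fst2 (swap *m v)) =
    if c then fst2 v else snd2 v.
  by have := part_swap c v; rewrite /part; case: c.
by rewrite /S3' /S3/= (E false z.1) (E false z.2) (E true z.1) (E true z.2).
Qed.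

End Swap.

(** * The strata S_3 and S_3' *)

Section Strata3.
Variables (R : realType) (J1 J2 : R).
Hypotheses (J1_gt0 : 0 < J1) (J2_gt0 : 0 < J2).

Lemma S3_T (y : R -> 'cV[R]_4 * 'cV[R]_4) t0 :
  veselova_T_sol (cyl_mass J1 J2) y -> S3 (y t0) ->
  lies_on_torus (veselova_T_sol (cyl_mass J1 J2)) 2 y /\ like_3D_T (cyl_mass J1 J2) J1 J2 y.
Proof.
move=> soly Sy; split; last exact: S3_like_3D_T Sy.
have [a0 a1 nz0 _] := S3_meridian J1_gt0 J2_gt0 soly Sy.
have [T [b [T0 yT ph]]] := S3_floquet J1_gt0 J2_gt0 soly nz0 (a0 0) a1.
apply: (T_torus2 J1_gt0 J2_gt0 soly T0 yT ph) => t; exact: area_neq0_q (a1 t).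
Qed.

End Strata3.

Section Strata3'.
Variables (R : realType) (J1 J2 : R).
Hypotheses (J1_gt0 : 0 < J1) (J2_gt0 : 0 < J2).

Lemma S3'_T (y : R -> 'cV[R]_4 * 'cV[R]_4) t0 :
  veselova_T_sol (cyl_mass J1 J2) y -> S3' (y t0) ->
  lies_on_torus (veselova_T_sol (cyl_mass J1 J2)) 2 y /\ like_3D_T (cyl_mass J1 J2) J2 J1 y.
Proof.
move=> soly /S3'_swap Sy; pose f (z : 'cV[R]_4 * 'cV[R]_4) := (swap R *m z.1, swap R *m z.2).
have fsol K1 K2 (K10 : 0 < K1) (K20 : 0 < K2) x :
    veselova_T_sol (cyl_mass K1 K2) x -> veselova_T_sol (cyl_mass K2 K1) (f \o x).
  move=> sol; rewrite -(swap_cyl K1 K2).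
  by apply: (T_sol_conj (cyl_symposdef K10 K20) (swap_orthogonal R) sol).
have fK z : f (f z) = z by rewrite /f/= !swapK; case: z.
have fc : continuous f.
  move=> z; apply: pair_continuous; apply: mulmx_continuous.
  - exact: cvg_cst.
  - exact: cvg_fst.
  - exact: cvg_cst.
  - exact: cvg_snd.
have [tor [B [c [z [oB BJ solz zE]]]]] := S3_T J2_gt0 J1_gt0 (fsol _ _ J1_gt0 J2_gt0 _ soly) Sy.
split.
  (* The torus was found for the exchanged masses; the involution [f] brings it back. *)
  have -> : y = f \o (f \o y) by apply/funext => t /=; rewrite fK.
  apply: (lies_on_torus_map fc (can_inj fK) _ tor) => x; exact: fsol.
exists (B *m swap R), c, z; split => //.
- by apply: orthogonalM => //; exact: swap_orthogonal.
- rewrite trmx_mul -BJ -(swap_cyl J1 J2) !mulmxA; done.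
- by move=> t; have := zE t; rewrite /= !mulmxA.
Qed.

Lemma S3'_D (x : R -> 'M[R]_4 * 'M[R]_4) t0 :
  veselova_D_sol (cyl_mass J1 J2) x -> S3' (veselova_proj (cyl_mass J1 J2) (x t0)) ->
  lies_on_torus (veselova_D_sol (cyl_mass J1 J2)) 2 x /\ like_3D_D (cyl_mass J1 J2) J2 J1 x.
Proof.
move=> solx /S3'_swap Sx.
pose f (z : 'M[R]_4 * 'M[R]_4) := (1%:M *m z.1 *m (swap R)^T, swap R *m z.2 *m (swap R)^T).
have fsol K1 K2 (K10 : 0 < K1) (K20 : 0 < K2) u :
    veselova_D_sol (cyl_mass K1 K2) u -> veselova_D_sol (cyl_mass K2 K1) (f \o u).
  move=> sol; rewrite -(swap_cyl K1 K2).
  by apply: (D_sol_conj (swap_orthogonal R) (@orthogonal1 R 3) (mul1mx _) sol).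
have fK z : f (f z) = z.
  rewrite /f/= !mul1mx swapT -!mulmxA swap2 !mulmx1 swapK; by case: z.
have fc : continuous f.
  move=> z; apply: pair_continuous; apply: mulmx_continuous; try exact: cvg_cst.
  - by apply: mulmx_continuous; [exact: cvg_cst|exact: cvg_fst].
  - by apply: mulmx_continuous; [exact: cvg_cst|exact: cvg_snd].
have pE : veselova_proj (cyl_mass J2 J1) ((f \o x) t0) =
    (swap R *m (veselova_proj (cyl_mass J1 J2) (x t0)).1,
     swap R *m (veselova_proj (cyl_mass J1 J2) (x t0)).2).
  rewrite -(swap_cyl J1 J2).
  apply: (veselova_proj_conj _ (swap_orthogonal R) (@orthogonal1 R 3) (mul1mx _)).
  exact: D_orth solx t0.
rewrite -pE in Sx.
have [tor [A [B [c [z [[GA oB] BJ solz zE]]]]]] :=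
  S3_D J2_gt0 J1_gt0 (fsol _ _ J1_gt0 J2_gt0 _ solx) Sx.
split.
  have -> : x = f \o (f \o x) by apply/funext => t /=; rewrite fK.
  apply: (lies_on_torus_map fc (can_inj fK) _ tor) => u; exact: fsol.
exists A, (B *m swap R), c, z; split => //.
- by split => //; apply: orthogonalM => //; exact: swap_orthogonal.
- by rewrite trmx_mul -BJ -(swap_cyl J1 J2) !mulmxA.
- by move=> t; have := zE t; rewrite /f/= mul1mx trmx_mul !mulmxA.
Qed.

End Strata3'.

(** * Assembly over the strata *)

Theorem theorem5p8 (R : realType) (J1 J2 : R)
    (J1_gt0 : 0 < J1) (J2_gt0 : 0 < J2) (J1_neq_J2 : J1 != J2) :
  let J := cyl_mass J1 J2 in
  let solT := veselova_T_sol J in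
  let solD := veselova_D_sol J in
  let proj := veselova_proj J in
  let P := fun y : 'cV[R]_4 * 'cV[R]_4 => dot y.2 y.2 in
  [/\ (* (i) *)
      (forall y, solT y -> forall t, (S0 (y t) \/ S0' (y t)) ->
         is_equilibrium y) /\
      (forall x, solD x -> forall t, (S0 (proj (x t)) \/ S0' (proj (x t))) ->
         is_equilibrium x),
      (* (ii) *)
      [/\ forall y, solT y -> forall t, (S1 (y t) \/ S1' (y t)) ->
            is_relative_equilibrium (@orbit_T R) y,
          forall x, solD x -> forall t, S1 (proj (x t)) ->
            is_relative_equilibrium (@orbit_D R) x /\
            exists Pi, [/\ steady_rotation_in J Pi x, pure_plane J Pi &
                           moment_of_inertia J Pi (2 * J2)] &
          forall x, solD x -> forall t, S1' (proj (x t)) ->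
            is_relative_equilibrium (@orbit_D R) x /\
            exists Pi, [/\ steady_rotation_in J Pi x, pure_plane J Pi &
                           moment_of_inertia J Pi (2 * J1)]],
      (* (iii) *)
      (forall y, solT y -> forall t, S2 (y t) ->
         (P (y t) = 0 -> is_equilibrium y) /\
         (0 < P (y t) -> ~ is_relative_equilibrium (@orbit_T R) y)) /\
      (forall x, solD x -> forall t, S2 (proj (x t)) ->
         (P (proj (x t)) = 0 -> is_equilibrium x) /\
         (0 < P (proj (x t)) ->
            (exists Pi, steady_rotation_in J Pi x /\ mixed_plane J J1 J2 Pi) /\
            ~ is_relative_equilibrium (@orbit_D R) x)),
      (* (iv) *)
      [/\ forall y, solT y -> forall t, S3 (y t) ->
            lies_on_torus solT 2 y /\ like_3D_T J J1 J2 y,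
          forall y, solT y -> forall t, S3' (y t) ->
            lies_on_torus solT 2 y /\ like_3D_T J J2 J1 y,
          forall x, solD x -> forall t, S3 (proj (x t)) ->
            lies_on_torus solD 2 x /\ like_3D_D J J1 J2 x &
          forall x, solD x -> forall t, S3' (proj (x t)) ->
            lies_on_torus solD 2 x /\ like_3D_D J J2 J1 x] &
      (* (v) *)
      (forall y, solT y -> forall t, S4 (y t) ->
         [/\ is_relative_equilibrium (@orbit_T R) y, lies_on_torus solT 2 y &
             orbit_Lyapunov_stable (@cotangent_sphere R 3) solT (@orbit_T R) y]
         \/ (is_relative_periodic (@orbit_T R) y /\ lies_on_torus solT 3 y)) /\
      (forall x, solD x -> forall t, S4 (proj (x t)) ->
         [/\ is_relative_equilibrium (@orbit_D R) x, lies_on_torus solD 3 x &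
             orbit_Lyapunov_stable (@cotangent_sphere R 3) solT (@orbit_T R)
               (proj \o x)]
         \/ (is_relative_periodic (@orbit_D R) x /\ lies_on_torus solD 4 x))].

Proof.
move=> J solT solD proj P.
have pos1 := J1_gt0; have pos2 := J2_gt0.
have p_eq0 (z : 'cV[R]_4 * 'cV[R]_4) : fst2 z.2 = 0 -> snd2 z.2 = 0 -> z.2 = 0.
  by move=> p1 p2; apply: part_inj => -[]; rewrite part0.
have solP x : solD x -> solT (fun t => proj (x t)).
  by move=> sx; exact: (D_proj_sol (cyl_symposdef pos1 pos2) sx).
have P_eq0 z : P z = 0 -> z.2 = 0 by exact: dot_eq0.
have P_gt0 z : 0 < P z -> z.2 != 0.
  by move=> Pz; apply/eqP => z0; move: Pz; rewrite /P z0 /dot mulmx0 mxE ltxx.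
have S2_area z : S2 z -> (forall c, area c z = 0) /\
    (forall c, ~ (part c z.1 = 0 /\ part c z.2 = 0)).
  move=> [[f1 n1] [f2 n2]]; split => -[] //.
    by apply/eqP; rewrite -[_ == _]negbK -free2.
  by apply/eqP; rewrite -[_ == _]negbK -free2.
split.
- split=> [y soly t H|x solx t H].
    by apply: (T_rest pos1 pos2 soly (t0 := t)); case: H => -[_ p1 p2]; exact: p_eq0.
  by apply: (D_rest pos1 pos2 solx (t0 := t)); case: H => -[_ p1 p2]; exact: p_eq0.
- split=> [y soly t H|x solx t [q1 p1 /eqP p2]|x solx t [q2 p2 /eqP p1]].
  (* In [planar_relative_equilibrium] the boolean names the half that vanishes, in
     [pure_steady_rotation] the half that survives. *)
  + case: H => -[q0 p0 /eqP p1].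
      by have [] := planar_relative_equilibrium pos1 pos2 soly (c := false) q0 p0 p1.
    by have [] := planar_relative_equilibrium pos1 pos2 soly (c := true) q0 p0 p1.
  + exact: (pure_steady_rotation pos1 pos2 solx (c := true) q1 p1 p2).
  + exact: (pure_steady_rotation pos1 pos2 solx (c := false) q2 p2 p1).
- split=> [y soly t /S2_area[a0 nz]|x solx t /S2_area[a0 nz]].
    split=> [/P_eq0 p0|/P_gt0 p0]; first exact: (T_rest pos1 pos2 soly p0).
    exact: (rectilinear_not_relative_equilibrium pos1 pos2 soly p0 (a0 false) (nz false)).
  split=> [/P_eq0 p0|/P_gt0 p0]; first exact: (D_rest pos1 pos2 solx p0).
  split; first exact: (mixed_steady_rotation pos1 pos2 solx a0 nz p0).
  move=> /(relative_equilibrium_D pos1 pos2 solx).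
  exact: (rectilinear_not_relative_equilibrium pos1 pos2 (solP _ solx) p0 (a0 false) (nz false)).
- split=> [y soly t|y soly t|x solx t|x solx t] H.
  + exact: (S3_T pos1 pos2 soly H).
  + exact: (S3'_T pos1 pos2 soly H).
  + exact: (S3_D pos1 pos2 solx H).
  + exact: (S3'_D pos1 pos2 solx H).
- split=> [y soly t Sy|x solx t Sx].
    have a0 := S4_persists pos1 pos2 soly Sy.
    have q0 c s : part c (y s).1 != 0 := area_neq0_q (a0 c s).
    have [[req [T [b [T0 yT ph]]]]|[rper [T [a [b [T0 yT ph]]]]]] := S4_cases pos1 pos2 soly Sy.
      left; split => //; first exact: (T_torus2 pos1 pos2 soly T0 yT ph (q0 true)).
      apply: (steady_stable pos1 pos2 soly a0).
      exact: (relative_equilibrium_radial pos1 pos2 soly req).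
    by right; split => //; exact: (T_torus3 pos1 pos2 soly T0 yT ph q0).
  have soly := solP _ solx.
  have a0 := S4_persists pos1 pos2 soly Sx.
  have q0 c s : part c (proj (x s)).1 != 0 := area_neq0_q (a0 c s).
  have p0 : (proj (x 0)).2 != 0 := area_neq0_momentum (a0 true 0).
  have [[req [T [b [T0 yT ph]]]]|[rper [T [a [b [T0 yT ph]]]]]] := S4_cases pos1 pos2 soly Sx.
    left; have [Q [a1 [oQ Q0 _ xT _]]] := D_monodromy pos1 pos2 solx yT p0.
    split.
    + exact/(relative_equilibrium_D pos1 pos2 solx).
    + exact: (D_torus3 pos1 pos2 solx oQ Q0 T0 xT ph (q0 true)).
    + apply: (steady_stable pos1 pos2 soly a0).
      exact: (relative_equilibrium_radial pos1 pos2 soly req).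
  right; have [Q [a1 [oQ Q0 _ xT _]]] := D_monodromy pos1 pos2 solx yT p0.
  split; first exact/(relative_periodic_D pos1 pos2 solx).
  exact: (D_torus4 pos1 pos2 solx oQ Q0 T0 xT ph q0).
Qed.
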